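(* The $P$-Voros coefficient $W(c,\eta)$ of $(P_{\rm II})$ is given explicitly by the formal power series $$W(c,\eta)=-\sum_{n=1}^{\infty}\frac{2^{1-2n}-1}{2n(2n-1)}\,B_{2n}\,(c\,\eta)^{1-2n},$$ where $B_{2n}$ are the Bernoulli numbers defined by $\frac{w}{e^w-1}=1-\frac w2+\sum_{n\ge1}\frac{B_{2n}}{(2n)!}w^{2n}$.
   Context: Let $\eta$ be a large parameter and $c\in\mathbb C\setminus\{0\}$ with $\arg c$ close to $\pi/2$. The second Painlevé equation with a large parameter is $(P_{\rm II})$: $\frac{d^2\lambda}{dt^2}=\eta^2(2\lambda^3+t\lambda+c)$, equivalently the Hamiltonian system $(H_{\rm II})$: $\frac{d\lambda}{dt}=\eta\nu$, $\frac{d\nu}{dt}=\eta(2\lambda^3+t\lambda+c)$. Let $\lambda_0(t,c)$ be a branch of the algebraic function defined by $2\lambda_0^3+t\lambda_0+c=0$. The 0-parameter solution is the unique pair of formal power series $\lambda^{(0)}=\sum_{k\ge0}\eta^{-k}\lambda^{(0)}_k(t,c)$, $\nu^{(0)}=\sum_{k\ge0}\eta^{-k}\nu^{(0)}_k(t,c)$ solving $(H_{\rm II})$ formally with $\lambda^{(0)}_0=\lambda_0$, $\nu^{(0)}_0=0$. Set $\Delta(t,c)=6\lambda_0^2+t$; its zeros $\tau_j=-6(c/4)^{2/3}e^{2\pi ij/3}$ ($j=1,2,3$) are the $P$-turning points, and $P$-Stokes curves are the curves ${\rm Im}\int_{\tau_j}^t\sqrt{\Delta}\,dt=0$. Let $R=\sum_{k\ge-1}\eta^{-k}R_k(t,c)$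 be the formal solution of the Riccati equation $R^2+\frac{dR}{dt}=\eta^2\big(6(\lambda^{(0)})^2+t\big)$ with $R_{-1}=\sqrt{\Delta}$ (the $R_k$, $k\ge0$, are then uniquely determined recursively), $R^\dagger$ the solution with $R^\dagger_{-1}=-\sqrt\Delta$, and $R_{\rm odd}=\frac12(R-R^\dagger)=\sum_{k\ge0}\eta^{1-2k}R_{2k-1}$. Branch convention: $\Gamma$ is the $P$-Stokes curve emanating from $\tau_1$ and running to $t=\infty$ along which (with ${\rm Re}\,t^{1/2}>0$) $\lambda_0\sim-\frac{i}{\sqrt2}t^{1/2}$ and $\sqrt\Delta\sim-\sqrt2\,i\,t^{1/2}$ as $t\to\infty$; this fixes the branches of $\lambda_0$ and $\sqrt\Delta$. The $P$-Voros coefficient is $W(c,\eta)=\frac12\int_{\Gamma_\infty}\big(R_{\rm odd}-\eta R_{-1}\big)\,dt$, integrated coefficientwise in $\eta^{-1}$, where $\Gamma_\infty$ is a path on the Riemann surface of $\sqrt\Delta$ that starts at $t=\infty$ on the sheet where $\sqrt\Delta$ has the opposite sign, comes along $\Gamma$ to $\tau_1$, encircles $\tau_1$, and returns to $t=\infty$ along $\Gamma$ on the sheet fixed above (this is the meaning of $\int_{\tau_1}^\infty$; the coefficients are integrable at $\infty$). *)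

(* Defs.v *)
From Stdlib Require Import Reals List Arith ClassicalEpsilon.
From Coquelicot Require Import Coquelicot.
Import ListNotations.

Open Scope R_scope.
Open Scope C_scope.

Definition Cder (f : C -> C) (z : C) : C :=
  epsilon (inhabits (RtoC 0))
    (fun l => @is_derive C_AbsRing C_NormedModule f z l).

Fixpoint Cpow (z : C) (n : nat) : C :=
  match n with O => RtoC 1 | S m => z * Cpow z m end.

Fixpoint csum (f : nat -> C) (n : nat) : C :=
  match n with O => RtoC 0 | S m => csum f m + f m end.

(* Functions on the Riemann surface of sqrt(Delta).  A point of that  *)
(* surface is described by  x = lambda_0(t)  (which determines t, see  *)
(* tfun) and  s = sqrt(Delta(t))  (s^2 = Delta).  Coefficients are     *)
(* functions of the pair (x, s).                                       *)
Definition Fn := C -> C -> C.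

(* t as a function of lambda_0 = x  (from 2x^3 + t x + c = 0) *)
Definition tfun (c x : C) : C := - (2 * x * x * x + c) / x.
Definition Dfun (c x : C) : C := 6 * x * x + tfun c x.

(* d/dt of a function F(lambda_0(t), sqrt(Delta(t))) on the surface:
   chain rule, with d lambda_0/dt = 1/(dt/d lambda_0) and
   d sqrt(Delta)/d lambda_0 = (dDelta/d lambda_0) / (2 sqrt(Delta)). *)
Definition Dt (c : C) (F : Fn) : Fn := fun x s =>
  (Cder (fun z => F z s) x
   + Cder (fun w => F x w) s * (Cder (Dfun c) x / (2 * s)))
  / Cder (tfun c) x.

Definition zeroFn : Fn := fun _ _ => RtoC 0.

(* 0-parameter solution of (H_II):  lambda^(0) = sum eta^-k lam_k,     *)
(* nu^(0) = sum eta^-k nu_k.  Comparing coefficients of eta^{-k} in    *)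
(*   dlambda/dt = eta nu,   dnu/dt = eta (2 lambda^3 + t lambda + c):   *)
(*   nu_0 = 0, 2 lam_0^3 + t lam_0 + c = 0 (lam_0 = lambda_0),          *)
(*   nu_m = d lam_{m-1}/dt,                                             *)
(*   d nu_{m-1}/dt = [2 lambda^3 + t lambda + c]_m                      *)
(*                 = Delta lam_m + 2 * sum_{a+b+d=m, a,b,d<m} lam_a lam_b lam_d *)
(* The list [zps c n] holds the pairs (lam_k, nu_k) for k = 0..n.       *)
Definition nthF (l : list (Fn * Fn)) (k : nat) : Fn * Fn :=
  nth k l (zeroFn, zeroFn).

Definition zstep (c : C) (l : list (Fn * Fn)) : Fn * Fn :=
  let m := length l in
  let lm a := fst (nthF l a) in
  ( (fun x s =>
       (Dt c (snd (nthF l (m - 1)%nat)) x s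
        - 2 * csum (fun a => csum (fun b => csum (fun d =>
              if Nat.eqb (a + b + d)%nat m
              then lm a x s * lm b x s * lm d x s else RtoC 0) m) m) m)
       / Dfun c x),
    Dt c (fst (nthF l (m - 1)%nat)) ).

Fixpoint zps (c : C) (n : nat) : list (Fn * Fn) :=
  match n with
  | O => [ ((fun x _ => x), zeroFn) ]
  | S n' => let l := zps c n' in l ++ [zstep c l]
  end.

Definition lam0 (c : C) (k : nat) : Fn := fst (nthF (zps c k) k).
Definition nu0 (c : C) (k : nat) : Fn := snd (nthF (zps c k) k).

(* coefficient of eta^{-j} in 6 (lambda^(0))^2 + t *)
Definition Qc (c : C) (j : nat) : Fn := fun x s =>
  match j with
  | O => 6 * lam0 c 0 x s * lam0 c 0 x s + tfun c x
  | S _ => 6 * csum (fun a => lam0 c a x s * lam0 c (j - a)%nat x s) (S j)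
  end.

(* Riccati equation  R^2 + dR/dt = eta^2 (6 (lambda^(0))^2 + t),       *)
(* R = sum_{k >= -1} eta^{-k} R_k.  We index K_i := R_{i-1}.           *)
(* Coefficient of eta^{-m} (m >= -1), solved for R_{m+1}:              *)
(*  K_{p} = (Q_p - dK_{p-1}/dt - sum_{i=1}^{p-1} K_i K_{p-i}) / (2 K_0). *)
Definition Rstep (c : C) (K0 : Fn) (l : list Fn) : Fn :=
  let p := length l in
  let K i := nth i l zeroFn in
  fun x s =>
    (Qc c p x s - Dt c (K (p - 1)%nat) x s
     - csum (fun i => if Nat.eqb i 0 then RtoC 0
                      else K i x s * K (p - i)%nat x s) p)
    / (2 * K0 x s).

Fixpoint Rlist (c : C) (K0 : Fn) (n : nat) : list Fn :=
  match n with
  | O => [K0]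
  | S n' => let l := Rlist c K0 n' in l ++ [Rstep c K0 l]
  end.

(* Rc c K0 i = R_{i-1} for the solution with R_{-1} = K0 *)
Definition Rc (c : C) (K0 : Fn) (i : nat) : Fn := nth i (Rlist c K0 i) zeroFn.

Definition Kplus : Fn := fun _ s => s.
Definition Kminus : Fn := fun _ s => - s.

(* coefficient of eta^{-(i-1)} in  R_odd - eta R_{-1},
   R_odd = (R - R^dagger)/2 *)
Definition Wint (c : C) (i : nat) : Fn := fun x s =>
  (Rc c Kplus i x s - Rc c Kminus i x s) / 2
  - (if Nat.eqb i 0 then Rc c Kplus 0 x s else RtoC 0).

Definition bgen (w : R) : R :=
  if Req_EM_T w 0 then 1%R else (w / (exp w - 1))%R.
Definition bernoulli (n : nat) : R := Derive_n bgen n 0.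

(* coefficient of eta^{-(i-1)} in
   - sum_{n>=1} (2^{1-2n}-1)/(2n(2n-1)) B_{2n} (c eta)^{1-2n} *)
Definition target (c : C) (i : nat) : C :=
  if andb (Nat.even i) (Nat.leb 2 i) then
    let n := Nat.div2 i in
    RtoC (- ((/ (2 ^ (2 * n - 1)%nat) - 1) / (INR (2 * n)%nat * INR (2 * n - 1)%nat))
            * bernoulli (2 * n)%nat)%R
    / Cpow c (2 * n - 1)%nat
  else RtoC 0.

(* The parameter c = rho e^{i theta} and the P-turning point           *)
(* tau_1 = -6 (c/4)^{2/3} e^{2 pi i/3} (principal power, theta in      *)
(* (-pi, pi]).                                                         *)
Definition cpolar (rho theta : R) : C := (rho * cos theta, rho * sin theta)%R.
Definition tau1_of (rho theta : R) : C :=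
  let a := (2 * theta / 3 + 2 * PI / 3)%R in
  (- 6 * Rpower (rho / 4) (2 / 3) * cos a,
   - 6 * Rpower (rho / 4) (2 / 3) * sin a)%R.

Definition Delta (c t x : C) : C := 6 * x * x + t.
Definition cubic (c t x : C) : C := 2 * x * x * x + t * x + c.

(* The P-Stokes curve Gamma, parametrised by g on [0, +oo) (derivative g'),
   with the continuous branches L = lambda_0 and S = sqrt Delta along it. *)
Definition IsGamma (c tau1 : C) (g g' L S : R -> C) : Prop :=
  g 0%R = tau1
  /\ (forall u : R, @is_derive R_AbsRing C_R_NormedModule g u (g' u))
  /\ (forall u : R, (0 <= u)%R -> continuous g' u)
  /\ (forall u : R, (0 <= u)%R -> continuous L u /\ continuous S u)
  /\ (forall u : R, (0 <= u)%R ->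
        cubic c (g u) (L u) = 0 /\ S u * S u = Delta c (g u) (L u))
  /\ (forall u : R, (0 < u)%R -> S u <> 0)
  /\ (forall U : R, (0 <= U)%R ->
        Im (@RInt C_R_CompleteNormedModule (fun u => S u * g' u) 0 U) = 0%R)
  /\ filterlim (fun u => Cmod (g u)) (Rbar_locally p_infty) (Rbar_locally p_infty)
  (* branch convention: lambda_0 ~ -(i/sqrt 2) t^{1/2},
     sqrt Delta ~ - sqrt 2 i t^{1/2}, Re t^{1/2} > 0 *)
  /\ (exists r : R -> C,
        (exists M : R, forall u : R, (M < u)%R ->
            r u * r u = g u /\ (0 < Re (r u))%R)
        /\ filterlim (fun u => L u / r u) (Rbar_locally p_infty)
             (locally (- Ci / RtoC (sqrt 2)))
        /\ filterlim (fun u => S u / r u) (Rbar_locally p_infty)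
             (locally (- RtoC (sqrt 2) * Ci))).

(* The part of Gamma_infty encircling tau1: a loop h (on [0,1]) based at the
   point g u0 of Gamma, inside the disc |t - tau1| < |tau1| (which contains no
   other P-turning point), avoiding tau1, along which the continuous lift
   (Lh, Sh) goes from the sheet (L u0, - S u0) to the sheet (L u0, S u0). *)
Definition IsLoop (c tau1 : C) (u0 : R) (g L S h h' Lh Sh : R -> C) : Prop :=
  (0 < u0)%R
  /\ (Cmod (g u0 - tau1) < Cmod tau1)%R
  /\ (forall v : R, @is_derive R_AbsRing C_R_NormedModule h v (h' v))
  /\ (forall v : R, (0 <= v <= 1)%R -> continuous h' v)
  /\ h 0%R = g u0 /\ h 1%R = g u0
  /\ (forall v : R, (0 <= v <= 1)%R ->
        (Cmod (h v - tau1) < Cmod tau1)%R /\ h v <> tau1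
        /\ continuous Lh v /\ continuous Sh v
        /\ cubic c (h v) (Lh v) = 0 /\ Sh v * Sh v = Delta c (h v) (Lh v))
  /\ Lh 0%R = L u0 /\ Lh 1%R = L u0
  /\ Sh 0%R = - S u0 /\ Sh 1%R = S u0.

(* (1/2) int over Gamma_infty, truncated at parameter U on Gamma:
   inbound from U to u0 on the sheet (L, -S), the loop, outbound from u0 to U
   on the sheet (L, S). *)
Definition Wtrunc (c : C) (i : nat) (u0 : R) (g g' L S h h' Lh Sh : R -> C)
  (U : R) : C :=
  / 2 * ( @RInt C_R_CompleteNormedModule
            (fun u => Wint c i (L u) (S u) * g' u) u0 U
        - @RInt C_R_CompleteNormedModule
            (fun u => Wint c i (L u) (- S u) * g' u) u0 U
        + @RInt C_R_CompleteNormedModule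
            (fun v => Wint c i (Lh v) (Sh v) * h' v) 0 1 ).

(* Main.v *)
(* Put hbar = 1 / eta, s = sqrt Delta, w = lambda_0 / s and eps = hbar / c.  By homogeneity the
   coefficients of lambda^(0) and of R are polynomials in w, up to powers of s and c, and those of
   R_odd - eta R_{-1} are exact: their primitives are polynomials in w (odd ones).  Since w tends
   to 1/2 at the end of Gamma on the given sheet and to -1/2 on the other sheet, the Voros
   coefficient is the value W of this primitive at w = 1/2, a formal power series in eps = 1 / a.

   The Backlund transformation lambda(c + hbar) = - lambda - (c + hbar / 2) / (lambda^2 +
   hbar d lambda/dt + t / 2) acts on the 0-parameter solution, the shift being the exponential of
   hbar d/dc, and makes R(c + hbar) - R(c) a logarithmic derivative.  Evaluating at w = 1/2 gives
   d/da (W(a + 1) - W(a)) = log (1 + 1/a) - 1 / (a + 1/2), and the coefficients of its only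
   solution without constant term are multiples of the numbers B_n(1/2) = (2^(1-n) - 1) B_n. *)
Require Import Defs.
From Stdlib Require Import Reals Lra Lia Classical ClassicalEpsilon.
From Coquelicot Require Import Coquelicot.
From HB Require Import structures.

(** The factor by which the linearised Backlund transformation multiplies a solution of the
    linearised equation is - H / fkh; this is where [H] comes from and why its logarithmic
    derivative is R(c + hbar) - R(c). This relation cannot be integrated in t within polynomials in
    w: the c-derivative of the leading term s of R has the primitive log ((1 + 2w) / (1 - 2w)),
    singular at w = 1/2. One more hbar d/dc turns the logarithm into the polynomial 4 eps w (1 - 6
    w^2), which is why the difference equation concerns d/da. The constant of integration is read at
    w = 0, a simple zero of H. The uniqueness arguments in t share one shape: hbar d/dt raises the
    order in eps, so in a homogeneous linear equation the lowest coefficient is killed by an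
    invertible leading factor. On the analytic side, [Dt] differentiates in x and s independently,
    whereas a coefficient agrees with its polynomial in w only where s^2 = Delta. Such an equality
    cannot be differentiated, so the derivatives are tracked along with the values. *)

Module Calculus.
Open Scope R_scope.
Open Scope C_scope.

(** * Complex calculus: continuity, derivatives, fundamental theorem *)

Section Continuity.
Context {U : UniformSpace}.
Implicit Types f g : U -> C.

Lemma continuous_C f x : continuous (fun y => fst (f y)) x ->
  continuous (fun y => snd (f y)) x -> continuous f x.
Proof.
intros h1 h2. apply filterlim_locally; intros eps.
assert (h1' := proj1 (filterlim_locally _ _) h1 eps).
assert (h2' := proj1 (filterlim_locally _ _) h2 eps).
generalize (filter_and _ _ h1' h2'); apply filter_imp.
intros y [a b]; split; assumption.
Qed.
Lemma continuous_Cfst f x : continuous f x -> continuous (fun y => fst (f y)) x.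
Proof. intros h; apply (continuous_comp f (@fst R R)); [exact h|apply continuous_fst]. Qed.
Lemma continuous_Csnd f x : continuous f x -> continuous (fun y => snd (f y)) x.
Proof. intros h; apply (continuous_comp f (@snd R R)); [exact h|apply continuous_snd]. Qed.

Lemma continuous_Cplus f g x : continuous f x -> continuous g x ->
  continuous (fun y => f y + g y) x.
Proof.
intros hf hg; apply continuous_C; simpl;
 apply (@continuous_plus U R_AbsRing R_NormedModule); auto using continuous_Cfst, continuous_Csnd.
Qed.
Lemma continuous_Copp f x : continuous f x -> continuous (fun y => - f y) x.
Proof.
intros hf; apply continuous_C; simpl;
 apply (@continuous_opp U R_AbsRing R_NormedModule); auto using continuous_Cfst, continuous_Csnd.
Qed.
Lemma continuous_Cmult f g x : continuous f x -> continuous g x ->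
  continuous (fun y => f y * g y) x.
Proof.
intros hf hg; apply continuous_C; simpl.
- apply (@continuous_minus U R_AbsRing R_NormedModule);
  apply (@continuous_mult U R_AbsRing); auto using continuous_Cfst, continuous_Csnd.
- apply (@continuous_plus U R_AbsRing R_NormedModule);
  apply (@continuous_mult U R_AbsRing); auto using continuous_Cfst, continuous_Csnd.
Qed.
Lemma Cnorm2_neq0 (z : C) : z <> 0 -> (fst z * (fst z * 1) + snd z * (snd z * 1) <> 0)%R.
Proof.
intros hz h; apply hz; destruct z as [a b]; simpl in h.
assert (a = 0%R) by nra; assert (b = 0%R) by nra; subst; reflexivity.
Qed.
Lemma continuous_Cinv f x : continuous f x -> f x <> 0 -> continuous (fun y => / f y) x.
Proof.
intros hf hx.
assert (hn : continuous (fun y => (fst (f y) * (fst (f y) * 1) + snd (f y) * (snd (f y) * 1))%R) x).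
{ apply (@continuous_plus U R_AbsRing R_NormedModule);
  apply (@continuous_mult U R_AbsRing); auto using continuous_Cfst, continuous_Csnd;
  apply (@continuous_mult U R_AbsRing); auto using continuous_Cfst, continuous_Csnd, continuous_const. }
assert (hi := continuous_comp _ Rinv x hn (continuous_Rinv _ (Cnorm2_neq0 _ hx))).
apply continuous_C; simpl; apply (@continuous_mult U R_AbsRing); try exact hi.
- now apply continuous_Cfst.
- apply (@continuous_opp U R_AbsRing R_NormedModule); now apply continuous_Csnd.
Qed.
Lemma continuous_Cdiv f g x : continuous f x -> continuous g x -> g x <> 0 ->
  continuous (fun y => f y / g y) x.
Proof. intros; apply continuous_Cmult; auto; now apply continuous_Cinv. Qed.

Lemma locally_neq0 f x : continuous f x -> f x <> 0 -> locally x (fun y => f y <> 0).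
Proof.
intros hf hx.
destruct (Req_dec (fst (f x)) 0) as [h|h].
- assert (h2 : snd (f x) <> 0%R).
  { intros h2; apply hx; destruct (f x); simpl in *; subst; reflexivity. }
  assert (hs := continuous_Csnd _ _ hf _ (open_neq 0%R _ h2)); revert hs; apply (@filter_imp U (locally x) _).
  intros y hy e; apply hy; now rewrite e.
- assert (hs := continuous_Cfst _ _ hf _ (open_neq 0%R _ h)); revert hs; apply (@filter_imp U (locally x) _).
  intros y hy e; apply hy; now rewrite e.
Qed.
Lemma continuous_eq_loc f g x : locally x (fun y => f y = g y) -> continuous f x -> continuous g x.
Proof.
intros h hf. assert (e : f x = g x) by (destruct h as [eps h]; apply h, ball_center).
unfold continuous; rewrite <- e. revert hf; apply filterlim_ext_loc, h.
Qed.
End Continuity.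

(* Caratheodory's form of differentiability, uniformly for a real variable (iota = RtoC)
   and a complex one (iota = identity). *)
Section Caratheodory.
Context {T : UniformSpace} (iota : T -> C).
Hypothesis iota_cont : forall a, continuous iota a.

Definition Der (f : T -> C) (a : T) (l : C) :=
  exists phi : T -> C, continuous phi a /\ phi a = l /\
    locally a (fun y => f y - f a = phi y * (iota y - iota a)).

Lemma Der_continuous f a l : Der f a l -> continuous f a.
Proof.
intros (phi & c & e & h).
apply (continuous_eq_loc (fun y => f a + phi y * (iota y - iota a))).
- revert h; apply filter_imp; intros y h; rewrite <- h; ring.
- apply continuous_Cplus; [apply continuous_const|].
  apply continuous_Cmult; [exact c|].
  apply continuous_Cplus; [apply iota_cont|apply continuous_const].
Qed.
Lemma Der_const k a : Der (fun _ => k) a 0.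
Proof.
exists (fun _ => RtoC 0); split; [apply continuous_const|split; [reflexivity|]].
apply filter_forall; intros; ring.
Qed.
Lemma Der_iota a : Der iota a 1.
Proof.
exists (fun _ => RtoC 1); split; [apply continuous_const|split; [reflexivity|]].
apply filter_forall; intros; ring.
Qed.
Lemma Der_plus f g a l m : Der f a l -> Der g a m -> Der (fun y => f y + g y) a (l + m).
Proof.
intros (p & cp & ep & hp) (q & cq & eq & hq).
exists (fun y => p y + q y); split; [now apply continuous_Cplus|split; [now rewrite ep, eq|]].
generalize (filter_and _ _ hp hq); apply filter_imp; intros y [h1 h2].
transitivity ((f y - f a) + (g y - g a)); [ring|rewrite h1, h2; ring].
Qed.
Lemma Der_mult f g a l m : Der f a l -> Der g a m ->
  Der (fun y => f y * g y) a (l * g a + f a * m).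
Proof.
intros hf hg; assert (cg := Der_continuous _ _ _ hg).
destruct hf as (p & cp & ep & hp); destruct hg as (q & cq & eq & hq).
exists (fun y => p y * g y + f a * q y); split; [|split; [now rewrite ep, eq|]].
- apply continuous_Cplus; apply continuous_Cmult; auto using continuous_const.
- generalize (filter_and _ _ hp hq); apply filter_imp; intros y [h1 h2].
  transitivity ((f y - f a) * g y + f a * (g y - g a)); [ring|rewrite h1, h2; ring].
Qed.
Lemma Der_inv f a l : Der f a l -> f a <> 0 -> Der (fun y => / f y) a (- l / (f a * f a)).
Proof.
intros hf h0; assert (cf := Der_continuous _ _ _ hf).
destruct hf as (p & cp & ep & hp).
exists (fun y => - p y / (f y * f a)); split; [|split; [now rewrite ep|]].
- apply continuous_Cdiv; [now apply continuous_Copp| |now apply Cmult_neq_0].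
  apply continuous_Cmult; auto using continuous_const.
- generalize (filter_and _ _ hp (locally_neq0 _ _ cf h0)); apply filter_imp; intros y [h1 h2].
  transitivity (- (f y - f a) / (f y * f a)); [field; auto|rewrite h1; field; auto].
Qed.
Lemma Der_eq_loc f g a l : locally a (fun y => f y = g y) -> Der f a l -> Der g a l.
Proof.
intros h (p & cp & ep & hp). exists p; split; [exact cp|split; [exact ep|]].
assert (e : f a = g a) by (destruct h as [eps h]; apply h, ball_center).
generalize (filter_and _ _ h hp); apply filter_imp; intros y [h1 h2].
now rewrite <- h1, <- e.
Qed.
Lemma Der_ext f g a l : (forall y, f y = g y) -> Der f a l -> Der g a l.
Proof. intros h; apply Der_eq_loc, filter_forall, h. Qed.
Lemma Der_eq f a l m : l = m -> Der f a l -> Der f a m.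
Proof. intros ->; auto. Qed.
End Caratheodory.

Definition DerC := @Der C_UniformSpace (fun z => z).
Definition DerR := @Der R_UniformSpace RtoC.
Lemma id_cont (a : C_UniformSpace) : continuous (fun z : C_UniformSpace => z) a.
Proof. apply continuous_id. Qed.
Lemma RtoC_cont (a : R_UniformSpace) : continuous (RtoC : R_UniformSpace -> C_UniformSpace) a.
Proof.
apply (continuous_C RtoC); simpl; [apply continuous_id|apply continuous_const].
Qed.

Lemma Der_comp {T : UniformSpace} (iota : T -> C) f g a l m :
  (forall a, continuous iota a) ->
  DerC g (f a) m -> Der iota f a l -> Der iota (fun y => g (f y)) a (m * l).
Proof.
intros hi hg hf; assert (cf := Der_continuous _ hi _ _ _ hf).
destruct hf as (p & cp & ep & hp); destruct hg as (q & cq & eq & hq).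
exists (fun y => q (f y) * p y); split; [|split; [now rewrite eq, ep|]].
- apply continuous_Cmult; [|exact cp]. now apply (continuous_comp f q).
- generalize (filter_and _ _ hp (cf _ hq)); apply filter_imp; intros y [h1 h2].
  rewrite h2, h1; ring.
Qed.

Lemma Cmod_lt_ball (x y : C) (eps : posreal) : (Cmod (y - x) < eps)%R -> ball x eps y.
Proof. intros h. apply C_NormedModule_mixin_compat1. exact h. Qed.
Lemma ball_Cmod_lt (x y : C) (eps : posreal) : ball x eps y -> (Cmod (y - x) < sqrt 2 * eps)%R.
Proof. intros h. now apply (C_NormedModule_mixin_compat2 x y eps). Qed.

Lemma continuous_Cmod {T : UniformSpace} (phi : T -> C) a :
  continuous phi a <-> (forall eps : posreal, locally a (fun y => (Cmod (phi y - phi a) <= eps)%R)).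
Proof.
split.
- intros h eps.
  assert (h2 : (0 < eps / sqrt 2)%R).
  { apply Rdiv_lt_0_compat; [apply cond_pos|apply sqrt_lt_R0; lra]. }
  generalize (proj1 (filterlim_locally _ _) h (mkposreal _ h2)); apply filter_imp.
  intros y hy; apply ball_Cmod_lt in hy; simpl in hy.
  apply Rlt_le; replace (pos eps) with (sqrt 2 * (eps / sqrt 2))%R; [exact hy|].
  field; apply Rgt_not_eq, sqrt_lt_R0; lra.
- intros h; apply filterlim_locally; intros eps.
  assert (h2 : (0 < eps / 2)%R) by (generalize (cond_pos eps); lra).
  generalize (h (mkposreal _ h2)); apply filter_imp; intros y hy; simpl in hy.
  apply Cmod_lt_ball; generalize (cond_pos eps); lra.
Qed.

Lemma Cminus_neq0 (y z : C) : y <> z -> y - z <> 0.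
Proof. intros h e; apply h; replace y with ((y - z) + z) by ring; rewrite e; ring. Qed.

Lemma Cmod_quotient (p q l : C) (eps : R) : q <> 0 ->
  (Cmod (p - q * l) <= eps * Cmod q -> Cmod (p / q - l) <= eps)%R.
Proof.
intros hq h. replace (p / q - l) with ((p - q * l) / q) by (field; exact hq).
rewrite Cmod_div by exact hq.
apply Rmult_le_reg_r with (Cmod q); [now apply Cmod_gt_0|].
unfold Rdiv; rewrite Rmult_assoc, Rinv_l, Rmult_1_r; [exact h|].
now apply Rgt_not_eq, Cmod_gt_0.
Qed.

Definition slope {T : Type} (iota f : T -> C) (z : T) (l : C) (y : T) : C :=
  match excluded_middle_informative (iota y = iota z) with
  | left _ => l | right _ => (f y - f z) / (iota y - iota z) end.

(** The slope completed by l at z is the Caratheodory function; the estimate is exactly its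
    continuity at z. *)
Lemma Der_of_small {T : UniformSpace} (iota f : T -> C) z l :
  (forall y, iota y = iota z -> y = z) ->
  (forall eps : posreal, locally z (fun y =>
    (Cmod ((f y - f z) - (iota y - iota z) * l) <= eps * Cmod (iota y - iota z))%R)) ->
  Der iota f z l.
Proof.
intros inj h.
assert (pz : slope iota f z l z = l).
{ unfold slope; destruct excluded_middle_informative; congruence. }
exists (slope iota f z l); split; [|split; [exact pz|]].
- apply continuous_Cmod; intros eps.
  generalize (h eps); apply filter_imp; intros y hy.
  rewrite pz; unfold slope; destruct excluded_middle_informative as [e|e].
  + replace (l - l) with (RtoC 0) by ring. rewrite Cmod_0. apply Rlt_le, cond_pos.
  + apply Cmod_quotient; [now apply Cminus_neq0|exact hy].
- apply filter_forall; intros y; unfold slope.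
  destruct excluded_middle_informative as [e|e].
  + rewrite (inj y e); ring.
  + field; now apply Cminus_neq0.
Qed.

Lemma small_of_Der {T : UniformSpace} (iota f : T -> C) z l :
  Der iota f z l ->
  (forall eps : posreal, locally z (fun y =>
    (Cmod ((f y - f z) - (iota y - iota z) * l) <= eps * Cmod (iota y - iota z))%R)).
Proof.
intros (phi & c & e & h) eps.
generalize (filter_and _ _ h (proj1 (continuous_Cmod _ _) c eps)); apply filter_imp.
intros y [h1 h2]; rewrite h1, e in *.
replace (phi y * (iota y - iota z) - (iota y - iota z) * l)
  with ((phi y - l) * (iota y - iota z)) by ring.
rewrite Cmod_mult; apply Rmult_le_compat_r; [apply Cmod_ge_0|exact h2].
Qed.

Lemma is_derive_DerC (f : C -> C) z l :
  @is_derive C_AbsRing C_NormedModule f z l <-> DerC f z l.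
Proof.
split.
- intros [_ h]; apply Der_of_small; [auto|]; intros eps.
  apply locally_C. exact (h z (fun P hP => hP) eps).
- intros h; split; [apply is_linear_scal_l|].
  intros x hx. assert (ex : z = x).
  { exact (@is_filter_lim_locally_unique C_AbsRing (AbsRing_NormedModule C_AbsRing) z x hx). }
  subst x; intros eps; apply (proj1 (locally_C z _)).
  exact (small_of_Der _ _ _ _ h eps).
Qed.

Lemma is_derive_DerR (f : R -> C) z l :
  @is_derive R_AbsRing C_R_NormedModule f z l <-> DerR f z l.
Proof.
assert (e : forall y, minus (minus (f y) (f z)) (@scal R_AbsRing C_R_NormedModule (minus y z) l)
   = (f y - f z) - (RtoC y - RtoC z) * l).
{ intros y; rewrite <- RtoC_minus.
  apply injective_projections; unfold minus, plus, opp, scal; simpl;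
  unfold mult, plus, opp, scal; simpl; unfold mult; simpl; ring. }
assert (n : forall p : C, @norm R_AbsRing C_R_NormedModule p = Cmod p).
{ intros p; change (sqrt (Rabs (fst p) ^ 2 + Rabs (snd p) ^ 2) = Cmod p); now rewrite !pow2_abs. }
assert (m : forall y, @norm R_AbsRing R_NormedModule (minus y z) = Cmod (RtoC y - RtoC z)).
{ intros y; rewrite <- RtoC_minus, Cmod_R; reflexivity. }
split.
- intros [_ h]; apply Der_of_small; [intros y hy; now apply RtoC_inj|]; intros eps.
  generalize (h z (fun P hP => hP) eps); apply (@filter_imp R_UniformSpace (locally z) _).
  intros y hy; rewrite <- e, <- n, <- m; exact hy.
- intros h; split; [apply is_linear_scal_l|].
  intros x hx. assert (ex : z = x).
  { exact (@is_filter_lim_locally_unique R_AbsRing R_NormedModule z x hx). }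
  subst x; intros eps.
  generalize (small_of_Der _ _ _ _ h eps); apply (@filter_imp R_UniformSpace (locally z) _).
  intros y hy; generalize hy; rewrite <- e, <- n, <- m; exact (fun H => H).
Qed.

Lemma DerC_unique f z l m : DerC f z l -> DerC f z m -> l = m.
Proof.
intros h1 h2; apply is_derive_DerC in h1; apply is_derive_DerC in h2.
now rewrite <- (is_C_derive_unique _ _ _ h1), <- (is_C_derive_unique _ _ _ h2).
Qed.
(** Complex derivatives are unique, so the choice made by [epsilon] in [Cder] can only be l. *)
Lemma Cder_eq f z l : DerC f z l -> Cder f z = l.
Proof.
intros h; apply (DerC_unique f z); [|exact h].
apply is_derive_DerC; unfold Cder; apply epsilon_spec.
exists l; now apply is_derive_DerC.
Qed.

Lemma DerR_fst f z l : DerR f z l -> is_derive (fun u => fst (f u)) z (fst l).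
Proof.
intros h; apply is_derive_DerR in h.
apply (filterdiff_comp' f fst z (fun y => @scal R_AbsRing C_R_NormedModule y l) fst h).
apply filterdiff_linear, is_linear_fst.
Qed.
Lemma DerR_snd f z l : DerR f z l -> is_derive (fun u => snd (f u)) z (snd l).
Proof.
intros h; apply is_derive_DerR in h.
apply (filterdiff_comp' f snd z (fun y => @scal R_AbsRing C_R_NormedModule y l) snd h).
apply filterdiff_linear, is_linear_snd.
Qed.

(* Only interior differentiability is available: at the endpoints the branches of the
   algebraic functions are merely continuous. *)
Lemma FTC_open (F f : R -> R) a b : (a <= b)%R ->
  (forall x, (a < x < b)%R -> is_derive F x (f x)) ->
  (forall x, (a <= x <= b)%R -> continuous F x) ->
  (forall x, (a <= x <= b)%R -> continuous f x) ->
  is_RInt f a b (F b - F a)%R.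
Proof.
intros hab hd hc hf.
(* Clamping to [a, b] makes f continuous on the whole line: its integral G is then differentiable
   everywhere, and F - G is constant by the mean value theorem. *)
pose (cl := fun x => Rmax a (Rmin x b)).
assert (clc : forall x, continuous cl x).
{ intros x; apply filterlim_locally; intros eps; exists eps; intros y hy.
  change (Rabs (y - x) < eps)%R in hy; change (Rabs (cl y - cl x) < eps)%R; revert hy; unfold cl.
  unfold Rmax, Rmin; repeat destruct Rle_dec; unfold Rabs; repeat destruct Rcase_abs; lra. }
assert (clb : forall x, (a <= cl x <= b)%R).
{ intros x; unfold cl; split; [apply Rmax_l|apply Rmax_lub; [exact hab|apply Rmin_r]]. }
assert (cle : forall x, (a <= x <= b)%R -> cl x = x).
{ intros x hx; unfold cl; rewrite Rmin_left, Rmax_right; lra. }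
pose (g := fun x => f (cl x)).
assert (gc : forall x, continuous g x).
{ intros x; apply (continuous_comp cl f); [apply clc|apply hf, clb]. }
pose (G := fun x => RInt g a x).
assert (Gd : forall x, is_derive G x (g x)).
{ intros x; apply (is_derive_RInt g G a x); [|apply gc].
  apply filter_forall; intros y; apply (RInt_correct g a y), ex_RInt_continuous; intros; apply gc. }
assert (e : (F b - F a = G b - G a)%R).
{ destruct (MVT_gen (fun x => F x - G x)%R a b (fun x => f x - g x)%R) as (c & hc1 & hc2).
  - rewrite Rmin_left, Rmax_right by exact hab; intros x hx.
    apply (is_derive_minus F G x (f x) (g x)); [now apply hd|apply Gd].
  - rewrite Rmin_left, Rmax_right by exact hab; intros x hx.
    apply continuity_pt_filterlim.
    apply (continuous_minus F G x); [now apply hc|].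
    apply ex_derive_continuous; exists (g x); apply Gd.
  - rewrite Rmin_left, Rmax_right in hc1 by exact hab.
    unfold g in hc2; rewrite cle in hc2 by exact hc1.
    lra. }
assert (Ga : G a = 0%R) by (unfold G; rewrite RInt_point; reflexivity).
rewrite e, Ga, Rminus_0_r.
apply (is_RInt_ext g).
- rewrite Rmin_left, Rmax_right by exact hab; intros x hx; unfold g; rewrite cle; lra || reflexivity.
- apply (RInt_correct g a b), ex_RInt_continuous; intros; apply gc.
Qed.

Lemma FTC_open_C (F f : R -> C) a b : (a <= b)%R ->
  (forall x, (a < x < b)%R -> DerR F x (f x)) ->
  (forall x, (a <= x <= b)%R -> continuous F x) ->
  (forall x, (a <= x <= b)%R -> continuous f x) ->
  @is_RInt C_R_NormedModule f a b (F b - F a).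
Proof.
intros hab hd hc hf.
apply (is_RInt_fct_extend_pair f a b (fst (F b - F a)) (snd (F b - F a))); simpl.
- apply (FTC_open (fun x => fst (F x)) (fun x => fst (f x))); auto using continuous_Cfst.
  intros x hx; apply DerR_fst; auto.
- apply (FTC_open (fun x => snd (F x)) (fun x => snd (f x))); auto using continuous_Csnd.
  intros x hx; apply DerR_snd; auto.
Qed.

(** A continuous square root is differentiable off its zeros: (f y - f a) (f y + f a) = h y - h a,
    and f y + f a stays nonzero near a. *)
Lemma Der_sqrt {T : UniformSpace} (iota f h : T -> C) a l :
  continuous f a -> f a <> 0 -> locally a (fun y => f y * f y = h y) ->
  Der iota h a l -> Der iota f a (l / (2 * f a)).
Proof.
intros cf f0 hs (p & cp & ep & hp).
assert (e : f a * f a = h a) by (destruct hs as [eps hs]; apply hs, ball_center).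
assert (cs : continuous (fun y => f y + f a) a).
{ apply continuous_Cplus; auto using continuous_const. }
assert (n0 : f a + f a <> 0).
{ intros h0; apply f0. replace (f a) with ((f a + f a) / 2) by field. rewrite h0; field. }
exists (fun y => p y / (f y + f a)); split; [|split].
- now apply continuous_Cdiv.
- rewrite ep; field. split; auto. 
- generalize (filter_and _ _ (filter_and _ _ hs hp) (locally_neq0 _ _ cs n0)); apply filter_imp.
  intros y [[h1 h2] h3].
  replace (p y / (f y + f a) * (iota y - iota a)) with ((p y * (iota y - iota a)) / (f y + f a)) by (field; auto).
  rewrite <- h2, <- h1, <- e; field; auto.
Qed.

End Calculus.

(** * Formal power series and power series of operators *)

Module Series.

From mathcomp Require Import all_boot ssralg poly polydiv ssrnum order ring boolp.
Set Implicit Arguments.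
Unset Strict Implicit.
Unset Printing Implicit Defensive.
Import Order.TTheory GRing.Theory Num.Theory.
Local Open Scope ring_scope.

Definition fps (A : Type) := nat -> A.

HB.instance Definition _ (A : Type) := gen_eqMixin (fps A).
HB.instance Definition _ (A : Type) := gen_choiceMixin (fps A).

Lemma fpsP (A : Type) (f g : fps A) : (forall k, f k = g k) -> f = g.
Proof. by move=> h; apply: funext. Qed.

Section FpsZmod.
Variable A : zmodType.
Definition fps_zero : fps A := fun=> 0.
Definition fps_opp (f : fps A) : fps A := fun k => - f k.
Definition fps_add (f g : fps A) : fps A := fun k => f k + g k.
Fact fps_addA : associative fps_add.
Proof. by move=> f g h; apply: fpsP => k; apply: addrA. Qed.
Fact fps_addC : commutative fps_add.
Proof. by move=> f g; apply: fpsP => k; apply: addrC. Qed.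
Fact fps_add0 : left_id fps_zero fps_add.
Proof. by move=> f; apply: fpsP => k; apply: add0r. Qed.
Fact fps_addN : left_inverse fps_zero fps_opp fps_add.
Proof. by move=> f; apply: fpsP => k; apply: addNr. Qed.
HB.instance Definition _ :=
  GRing.isZmodule.Build (fps A) fps_addA fps_addC fps_add0 fps_addN.

Lemma fps0E k : (0 : fps A) k = 0. Proof. by []. Qed.
Lemma fpsDE (f g : fps A) k : (f + g) k = f k + g k. Proof. by []. Qed.
Lemma fpsNE (f : fps A) k : (- f) k = - f k. Proof. by []. Qed.
Lemma fpsBE (f g : fps A) k : (f - g) k = f k - g k. Proof. by []. Qed.
Lemma fpsMnE (f : fps A) n k : (f *+ n) k = f k *+ n.
Proof. by elim: n => // n IH; rewrite !mulrS fpsDE IH. Qed.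
Lemma fps_sumE (I : Type) (r : seq I) (P : pred I) (F : I -> fps A) k :
  (\sum_(i <- r | P i) F i) k = \sum_(i <- r | P i) F i k.
Proof. by apply: (big_morph (fun f : fps A => f k)). Qed.
End FpsZmod.

Section FpsRing.
Variable A : comNzRingType.
Implicit Types f g h : fps A.

Definition fps_mul f g : fps A := fun n => \sum_(i < n.+1) f i * g (n - i)%N.
Definition fconst (a : A) : fps A := fun k => if k is 0%N then a else 0.
Definition fps_trunc N f : {poly A} := \poly_(i < N) f i.

Lemma coef_fps_trunc N f k : (k < N)%N -> (fps_trunc N f)`_k = f k.
Proof. by move=> h; rewrite coef_poly h. Qed.

(** A coefficient of a product only sees truncations, so commutativity and associativity are
    inherited from [{poly A}]. *)
Lemma fps_mul_trunc N f g n : (n < N)%N ->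
  fps_mul f g n = (fps_trunc N f * fps_trunc N g)`_n.
Proof.
move=> h; rewrite coefM; apply: eq_bigr => i _.
by rewrite !coef_fps_trunc //; [apply: leq_ltn_trans (leq_subr _ _) h|apply: leq_trans (ltn_ord i) h].
Qed.

Fact fps_mulC : commutative fps_mul.
Proof. by move=> f g; apply: fpsP => n; rewrite !(@fps_mul_trunc n.+1) // mulrC. Qed.
Fact fps_mulA : associative fps_mul.
Proof.
move=> f g h; apply: fpsP => n.
have e1 : fps_mul f (fps_mul g h) n = (fps_trunc n.+1 f * (fps_trunc n.+1 g * fps_trunc n.+1 h))`_n.
  rewrite coefM; apply: eq_bigr => i _.
  by rewrite coef_fps_trunc // (@fps_mul_trunc n.+1) // ltnS leq_subr.
have e2 : fps_mul (fps_mul f g) h n = (fps_trunc n.+1 f * fps_trunc n.+1 g * fps_trunc n.+1 h)`_n.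
  rewrite coefM; apply: eq_bigr => i _.
  by rewrite -(@fps_mul_trunc n.+1) // coef_fps_trunc // ltnS leq_subr.
by rewrite e1 e2 mulrA.
Qed.
Fact fps_mul1 : left_id (fconst 1) fps_mul.
Proof.
move=> f; apply: fpsP => n; rewrite /fps_mul big_ord_recl /= mul1r subn0.
by rewrite big1 ?addr0 // => i _; rewrite mul0r.
Qed.
Fact fps_mulDl : left_distributive fps_mul +%R.
Proof.
move=> f g h; apply: fpsP => n; rewrite fpsDE -big_split /=.
by apply: eq_bigr => i _; rewrite fpsDE mulrDl.
Qed.
Fact fps_one_neq0 : fconst 1 != 0.
Proof. by apply/eqP => /(congr1 (fun f : fps A => f 0%N)) /eqP; rewrite fps0E oner_eq0. Qed.
HB.instance Definition _ := GRing.Zmodule_isComNzRing.Build (fps A)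
  fps_mulA fps_mulC fps_mul1 fps_mulDl fps_one_neq0.

Lemma fpsME f g n : (f * g) n = \sum_(i < n.+1) f i * g (n - i)%N.
Proof. by []. Qed.
Lemma fps1E k : (1 : fps A) k = (k == 0)%:R. Proof. by case: k. Qed.
Lemma fpsM0 f g : (f * g) 0%N = f 0%N * g 0%N.
Proof. by rewrite fpsME big_ord_recl big_ord0 addr0. Qed.

Definition feps : fps A := fun k => (k == 1)%:R.
Lemma feps_mul f k : (feps * f) k = if k is k'.+1 then f k' else 0.
Proof.
case: k => [|k]; first by rewrite fpsM0 mul0r.
rewrite fpsME !big_ord_recl /= mul0r add0r mul1r subSS subn0 big1 ?addr0 // => i _.
by rewrite mul0r.
Qed.
Lemma fconst_mul a f k : (fconst a * f) k = a * f k.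
Proof.
rewrite fpsME big_ord_recl /= subn0 big1 ?addr0 // => i _.
by rewrite mul0r.
Qed.

Fact fconst_is_zmod : zmod_morphism fconst.
Proof. by move=> a b; apply: fpsP => -[|k] //; rewrite fpsBE subrr. Qed.
Fact fconst_is_monoid : monoid_morphism fconst.
Proof. by split=> // a b; apply: fpsP => -[|k]; rewrite fconst_mul //= mulr0. Qed.
HB.instance Definition _ := GRing.isZmodMorphism.Build A (fps A) fconst fconst_is_zmod.
HB.instance Definition _ := GRing.isMonoidMorphism.Build A (fps A) fconst fconst_is_monoid.

Definition vanish n f := forall k, (k < n)%N -> f k = 0.

Lemma vanish0 f : vanish 0 f. Proof. by []. Qed.
Lemma vanishD n f g : vanish n f -> vanish n g -> vanish n (f + g).
Proof. by move=> hf hg k hk; rewrite fpsDE hf // hg // addr0. Qed.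
Lemma vanishN n f : vanish n f -> vanish n (- f).
Proof. by move=> hf k hk; rewrite fpsNE hf // oppr0. Qed.
Lemma vanishM m n f g : vanish m f -> vanish n g -> vanish (m + n) (f * g).
Proof.
move=> hf hg k hk; rewrite fpsME big1 // => i _.
have [hi|hi] := ltnP i m; first by rewrite hf // mul0r.
rewrite hg ?mulr0 //.
have := ltn_ord i; rewrite ltnS => ik.
by rewrite ltn_subLR // (leq_trans hk) // leq_add2r.
Qed.
Lemma vanishW m n f : (m <= n)%N -> vanish n f -> vanish m f.
Proof. by move=> h hf k hk; apply: hf; apply: leq_trans hk h. Qed.
Lemma vanishMl n f g : vanish n g -> vanish n (f * g).
Proof. by move=> hg; rewrite -[n]add0n; apply: vanishM. Qed.
Lemma vanish_eq0 f : (forall n, vanish n f) -> f = 0.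
Proof. by move=> h; apply: fpsP => k; apply: (h k.+1). Qed.
Lemma vanish_eps n f : vanish n f -> vanish n.+1 (feps * f).
Proof. by move=> h [|k] hk; rewrite feps_mul //; apply: h. Qed.
(** Turns a linear equation between series of order n into an equation between their lowest
    coefficients; the uniqueness arguments rest on it. *)
Lemma vanishMlead n f g : vanish n f -> (f * g) n = f n * g 0%N.
Proof.
move=> h; rewrite fpsME big_ord_recr /= subnn big1 ?add0r // => i _.
by rewrite h ?mul0r.
Qed.

Definition raises (Delta : fps A -> fps A) := forall n q, vanish n q -> vanish n.+1 (Delta q).

Lemma raises_iter Delta n q : raises Delta -> vanish n (iter n Delta q).
Proof. by move=> h; elim: n => // n IH; apply: h. Qed.

(* For a raising Delta the terms n > k do not contribute to the coefficient k. *)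
Definition opser (a : nat -> A) (Delta : fps A -> fps A) (q : fps A) : fps A :=
  fun k => \sum_(n < k.+1) a n * iter n Delta q k.
Definition opsum N (a : nat -> A) (Delta : fps A -> fps A) (q : fps A) : fps A :=
  \sum_(n < N) fconst (a n) * iter n Delta q.

(** Replaces the coefficientwise [opser] by a finite sum of operators, which additive maps pass
    through, at the price of an error of order N. *)
Lemma opser_opsum N a Delta q : raises Delta -> vanish N (opser a Delta q - opsum N a Delta q).
Proof.
move=> h k hk; rewrite fpsBE /opser /opsum fps_sumE.
under [X in _ - X]eq_bigr do rewrite fconst_mul.
rewrite -(subnKC hk) big_split_ord /= [X in _ - (_ + X)]big1 ?addr0 ?subrr // => i _.
by rewrite -[Delta _]/(iter (k + i).+1 Delta q) (@raises_iter Delta _ q h) ?mulr0 // ltnS leq_addr.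
Qed.

Lemma big_triangle (V : nmodType) N (G : nat -> nat -> V) :
  (forall i j, (N <= i + j)%N -> G i j = 0) ->
  \sum_(i < N) \sum_(j < N) G i j = \sum_(n < N) \sum_(i < n.+1) G i (n - i)%N.
Proof.
move=> hG.
transitivity (\sum_(i < N) \sum_(n < N | (i <= n)%N) G i (n - i)%N).
  apply: eq_bigr => i _.
  have hi : (i <= N)%N by apply: ltnW.
  rewrite -(big_mkord xpredT (G i)) -(big_mkord (leq i) (fun n => G i (n - i)%N)).
  rewrite (@big_cat_nat _ _ _ (N - i)) ?leq_subr //= [X in _ + X]big1_seq ?addr0; last first.
    by move=> j /andP [_]; rewrite mem_index_iota leq_subLR => /andP [h _]; apply: hG.
  rewrite [RHS](@big_cat_nat _ _ _ i) //= [X in _ = X + _]big_nat_cond.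
  rewrite [X in _ = X + _]big1 ?add0r; last first.
    by move=> j /andP [/andP [_ h1] h2]; rewrite leqNgt h1 in h2.
  rewrite big_nat_cond [RHS]big_nat_cond.
  rewrite [RHS](_ : _ = \sum_(0 + i <= j < N | (i <= j < N)%N && (i <= j)%N) G i (j - i)%N) // big_addn /=.
  apply: eq_big => [j|j _]; last by rewrite addnK.
  by rewrite leq_addl !andbT ltn_subRL addnC.
rewrite (exchange_big_dep xpredT) //=.
apply: eq_bigr => n _.
by rewrite (big_ord_widen_cond N xpredT (fun i => G i (n - i)%N)) //= ltn_ord.
Qed.

(** Composing two series in one operator multiplies their symbols, provided that the inner
    coefficients commute with the operator. Coefficient k is computed with finite sums modulo order
    k.+1. *)
Lemma opser_comp a b Delta q :
  raises Delta -> {morph Delta : f g / f + g} ->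
  (forall n f, Delta (fconst (b n) * f) = fconst (b n) * Delta f) ->
  opser a Delta (opser b Delta q) = opser ((a : fps A) * b) Delta q.
Proof.
move=> hr hD hc.
have D0 : Delta 0 = 0 by apply: (addrI (Delta 0)); rewrite -hD !addr0.
have DN f : Delta (- f) = - Delta f.
  by apply: (addrI (Delta f)); rewrite -hD !subrr.
have iterDl n : {morph iter n Delta : f g / f + g}.
  by elim: n => // n IH f g; rewrite !iterS IH hD.
have iter0 n : iter n Delta 0 = 0 by elim: n => // n IH; rewrite iterS IH D0.
have iterN n f : iter n Delta (- f) = - iter n Delta f.
  by elim: n => // n IH; rewrite !iterS IH DN.
have iterc n m f : iter n Delta (fconst (b m) * f) = fconst (b m) * iter n Delta f.
  by elim: n => // n IH; rewrite !iterS IH hc.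
have itersum n N (G : 'I_N -> fps A) :
    iter n Delta (\sum_(i < N) G i) = \sum_(i < N) iter n Delta (G i).
  by apply: (big_morph _ (iterDl n) (iter0 n)).
apply: fpsP => k; set N := k.+1.
have hv f n : vanish N f -> vanish N (iter n Delta f).
  by move=> hf; elim: n => // n IH; apply: vanishW (hr _ _ IH).
have e1 : opser a Delta (opser b Delta q) k = opsum N a Delta (opsum N b Delta q) k.
  have h1 := @opser_opsum N a Delta (opser b Delta q) hr.
  move/(_ k (ltnSn k))/eqP: h1; rewrite fpsBE subr_eq0 => /eqP ->.
  rewrite /opsum !fps_sumE; apply: eq_bigr => n _; rewrite !fconst_mul; congr (_ * _).
  apply/eqP; rewrite -subr_eq0 -fpsBE -iterN -iterDl; apply/eqP.
  by apply: hv (ltnSn k); apply: opser_opsum.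
have e2 : opser ((a : fps A) * b) Delta q k = opsum N ((a : fps A) * b) Delta q k.
  by have /(_ k (ltnSn k))/eqP := @opser_opsum N ((a : fps A) * b) Delta q hr; rewrite fpsBE subr_eq0 => /eqP ->.
rewrite e1 e2 /opsum !fps_sumE.
under eq_bigr => n _ do rewrite itersum mulr_sumr fps_sumE.
under eq_bigr => n _ do under eq_bigr => m _ do
  rewrite iterc -iterD !fconst_mul.
rewrite (@big_triangle _ N (fun n m => a n * (b m * iter (n + m) Delta q k))).
  apply: eq_bigr => n _; rewrite fconst_mul fpsME mulr_suml.
  by apply: eq_bigr => i _; rewrite mulrA subnKC // -ltnS.
by move=> i j h; rewrite (@raises_iter Delta _ q hr _ h) !mulr0.
Qed.
End FpsRing.

(** A map carrying one operator into another carries every series in it; preservation of the order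
    lets h act on the truncation error. It is applied with h a derivation, a multiplication by a
    constant or an evaluation. *)
Lemma opser_intertwine (A A' : comNzRingType) (a : nat -> A) (a' : nat -> A')
    (D1 : fps A -> fps A) (D2 : fps A' -> fps A') (h : fps A -> fps A') q :
  raises D1 -> raises D2 -> {morph h : f g / f + g} ->
  (forall n f, vanish n f -> vanish n (h f)) ->
  (forall n f, h (fconst (a n) * f) = fconst (a' n) * h f) ->
  (forall f, D2 (h f) = h (D1 f)) ->
  opser a' D2 (h q) = h (opser a D1 q).
Proof.
move=> r1 r2 hD hv hc hi.
have h0 : h 0 = 0 by apply: (addrI (h 0)); rewrite -hD !addr0.
have hN f : h (- f) = - h f by apply: (addrI (h f)); rewrite -hD !subrr.
have iE n : iter n D2 (h q) = h (iter n D1 q) by elim: n => // n IH; rewrite !iterS IH hi.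
apply: fpsP => k; set N := k.+1.
have := @opser_opsum _ N a' D2 (h q) r2 k (ltnSn k).
rewrite fpsBE => /eqP; rewrite subr_eq0 => /eqP ->.
have := hv _ _ (@opser_opsum _ N a D1 q r1) k (ltnSn k).
rewrite hD hN fpsBE => /eqP; rewrite subr_eq0 => /eqP ->.
rewrite /opsum (big_morph _ hD h0); congr (_ k); apply: eq_bigr => i _.
by rewrite hc iE.
Qed.

Lemma opserD (A : comNzRingType) (a : nat -> A) Delta (f g : fps A) :
  {morph Delta : f g / f + g} -> opser a Delta (f + g) = opser a Delta f + opser a Delta g.
Proof.
move=> hD; have iE n : iter n Delta (f + g) = iter n Delta f + iter n Delta g.
  by elim: n => // n IH; rewrite !iterS IH hD.
apply: fpsP => k; rewrite fpsDE /opser -big_split; apply: eq_bigr => i _.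
by rewrite iE fpsDE mulrDr.
Qed.

(** * The graded operators hbar d/dt and hbar d/dc, and the shift of c *)

Section PIIOperators.
Variable F : numFieldType.
Notation B := {poly F}.
Notation S := (fps {poly F}).
Implicit Types f g p q : S.

Definition fcst (x : F) : S := fconst x%:P.
Definition fw : S := fconst 'X.
Definition fe : S := feps B.
Definition fhf : S := fcst 2^-1.
Definition fu : S := 1 - 4 * fw ^+ 2.
Lemma fhf2 : 2 * fhf = 1.
Proof.
rewrite /fhf /fcst; apply: fpsP => k; rewrite -[2]/(1 + 1) mulrDl mul1r fpsDE fps1E.
case: k => [|k] /=; last by rewrite addr0.
by rewrite -polyCD [X in X%:P](_ : _ = 1) // [RHS](splitr 1) !mul1r.
Qed.

Definition dw f : S := fun k => (f k)^`().
Definition Nop f : S := fun k => f k *+ k.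

Lemma dwD : {morph dw : f g / f + g}.
Proof. by move=> f g; apply: fpsP => k; apply: derivD. Qed.
Lemma dwM f g : dw (f * g) = dw f * g + f * dw g.
Proof.
apply: fpsP => k; rewrite fpsDE /dw fpsME raddf_sum !fpsME -big_split /=.
by apply: eq_bigr => i _; rewrite derivM.
Qed.
Lemma NopD : {morph Nop : f g / f + g}.
Proof. by move=> f g; apply: fpsP => k; apply: mulrnDl. Qed.
Lemma NopM f g : Nop (f * g) = Nop f * g + f * Nop g.
Proof.
apply: fpsP => k; rewrite fpsDE /Nop fpsME -sumrMnl !fpsME -big_split /=.
apply: eq_bigr => i _; rewrite mulrnAl mulrnAr -mulrnDr subnKC //.
by rewrite -ltnS.
Qed.
Lemma dw_Nop f : dw (Nop f) = Nop (dw f).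
Proof. by apply: fpsP => k; rewrite /dw /Nop derivMn. Qed.
Lemma dwN f : dw (- f) = - dw f.
Proof. by apply: fpsP => k; apply: derivN. Qed.
Lemma NopN f : Nop (- f) = - Nop f.
Proof. by apply: fpsP => k; rewrite /Nop fpsNE mulNrn. Qed.
Lemma dwMn f n : dw (f *+ n) = dw f *+ n.
Proof. by apply: fpsP => k; rewrite /dw !fpsMnE derivMn. Qed.
Lemma NopMn f n : Nop (f *+ n) = Nop f *+ n.
Proof. by apply: fpsP => k; rewrite /Nop !fpsMnE mulrnAC. Qed.
Lemma dw_const b : dw (fconst b) = fconst b^`().
Proof. by apply: fpsP => -[|k] //=; rewrite /dw /= deriv0. Qed.
Lemma Nop_const b : Nop (fconst b) = 0.
Proof. by apply: fpsP => -[|k] //=; rewrite /Nop /= mul0rn. Qed.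
Lemma dw_w : dw fw = 1. Proof. by rewrite dw_const derivX rmorph1. Qed.
Lemma Nop_w : Nop fw = 0. Proof. exact: Nop_const. Qed.
Lemma dw_cst x : dw (fcst x) = 0. Proof. by rewrite dw_const derivC rmorph0. Qed.
Lemma Nop_cst x : Nop (fcst x) = 0. Proof. exact: Nop_const. Qed.
Lemma dw_hf : dw fhf = 0. Proof. exact: dw_cst. Qed.
Lemma Nop_hf : Nop fhf = 0. Proof. exact: Nop_cst. Qed.
Lemma dw1 : dw 1 = 0.
Proof. by rewrite -(rmorph1 (@fconst B)) dw_const -polyC1 derivC rmorph0. Qed.
Lemma Nop1 : Nop 1 = 0.
Proof. by rewrite -(rmorph1 (@fconst B)) Nop_const. Qed.
Lemma dw_e : dw fe = 0.
Proof. by apply: fpsP => k; rewrite /dw /fe /feps -polyC_natr derivC. Qed.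
Lemma Nop_e : Nop fe = fe.
Proof. by apply: fpsP => -[|[|k]]; rewrite /Nop /fe /feps //= mul0rn. Qed.
Lemma dwX f n : dw (f ^+ n.+1) = n.+1%:R * f ^+ n * dw f.
Proof.
elim: n => [|n IH]; first by rewrite expr1 expr0 !mul1r.
by rewrite exprS dwM IH (exprS f n) -[in RHS]natr1; ring.
Qed.
Lemma NopX f n : Nop (f ^+ n.+1) = n.+1%:R * f ^+ n * Nop f.
Proof.
elim: n => [|n IH]; first by rewrite expr1 expr0 !mul1r.
by rewrite exprS NopM IH (exprS f n) -[in RHS]natr1; ring.
Qed.
Lemma dw_nat n : dw n%:R = 0. Proof. by rewrite dwMn dw1 mul0rn. Qed.
Lemma Nop_nat n : Nop n%:R = 0. Proof. by rewrite NopMn Nop1 mul0rn. Qed.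

Definition derE := (dwD, dwN, dwM, dwX, dw_w, dw_hf, dw_e, dw1, dw_nat, dw_Nop,
  NopD, NopN, NopM, NopX, Nop_w, Nop_hf, Nop_e, Nop1, Nop_nat).

(* The weights of the grading: s^m q(w, eps) is mapped by hbar d/dt to
   s^(m+1) (Dm m q)(w, eps) and by hbar d/dc to s^m (Em m q)(w, eps), where hbar = 1 / eta,
   s = sqrt Delta, w = lambda_0 / s and eps = hbar / c. *)
Definition fa : S := 3 * fhf * fw ^+ 2 * fu ^+ 2.
Definition fbet : S := fe * (fhf * fw * fu * (12 * fw ^+ 2 - 1)).
Definition Dm (m : nat) f : S := fe * (fa * dw f) + m%:R * fbet * f.
Definition falp : S := 6 * fe * fw ^+ 2 * fu.
Definition Em (m : nat) f : S :=
  fe * ((1 - 6 * fw ^+ 2) * fu * fw * dw f) - fe * Nop f + m%:R * falp * f.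

Lemma DmD m : {morph Dm m : f g / f + g}.
Proof. by move=> f g; rewrite /Dm dwD; ring. Qed.
Lemma DmN m f : Dm m (- f) = - Dm m f.
Proof. by rewrite /Dm dwN; ring. Qed.
Lemma EmD m : {morph Em m : f g / f + g}.
Proof. by move=> f g; rewrite /Em dwD NopD; ring. Qed.
Lemma EmN m f : Em m (- f) = - Em m f.
Proof. by rewrite /Em dwN NopN; ring. Qed.
Lemma DmM m n f g : Dm (m + n) (f * g) = Dm m f * g + f * Dm n g.
Proof. by rewrite /Dm dwM natrD; ring. Qed.
Lemma EmM m n f g : Em (m + n) (f * g) = Em m f * g + f * Em n g.
Proof. by rewrite /Em dwM NopM natrD; ring. Qed.

Lemma vanish_dw n f : vanish n f -> vanish n (dw f).
Proof. by move=> h k hk; rewrite /dw h // deriv0. Qed.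
Lemma vanish_Nop n f : vanish n f -> vanish n (Nop f).
Proof. by move=> h k hk; rewrite /Nop h // mul0rn. Qed.
Lemma Dm_raises m : raises (Dm m).
Proof.
move=> n f h; rewrite /Dm /fbet.
rewrite (_ : m%:R * _ * f = fe * (m%:R * (fhf * fw * fu * (12 * fw ^+ 2 - 1)) * f)); last by ring.
by apply: vanishD; apply: vanish_eps; do ?apply: vanishMl => //; apply: vanish_dw.
Qed.
Lemma Em_raises m : raises (Em m).
Proof.
move=> n f h; rewrite /Em /falp.
rewrite (_ : m%:R * _ * f = fe * (m%:R * 6 * fw ^+ 2 * fu * f)); last by ring.
apply: vanishD; first (apply: vanishD; last apply: vanishN); apply: vanish_eps.
- by apply/vanishMl/vanish_dw.
- exact: vanish_Nop.
- exact: vanishMl.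
Qed.

(* The two hypotheses say that the vector fields d/dt and d/dc commute. *)
Lemma bracket_identity (K : comNzRingType) (m e a a1 b b1 al al1 be be1 f f1 f2 nf nf1 : K) :
  b * a1 - a * b1 = a - al * a -> b * be1 - a * al1 = be - al * be ->
  e * (b * (e * (a1 * f1 + a * f2) + m * (e * be1) * f + m * (e * be) * f1)) -
    e * (e * (a * f1) + e * (a * nf1) + (m * (e * be) * f + m * (e * be) * nf)) +
    (m + 1) * (e * al) * (e * (a * f1) + m * (e * be) * f) =
  e * (a * (e * (b1 * f1 + b * f2) - e * nf1 + m * (e * al1) * f + m * (e * al) * f1)) +
  m * (e * be) * (e * (b * f1) - e * nf + m * (e * al) * f).
Proof.
move=> h1 h2; apply/eqP; rewrite -subr_eq0; apply/eqP.
transitivity (e ^+ 2 * f1 * (b * a1 - a * b1 - (a - al * a)) +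
  m * e ^+ 2 * f * (b * be1 - a * al1 - (be - al * be))); first by ring.
by rewrite h1 h2; ring.
Qed.

Definition fbh : S := fhf * fw * fu * (12 * fw ^+ 2 - 1).
Definition fah : S := 6 * fw ^+ 2 * fu.
Definition fb : S := (1 - 6 * fw ^+ 2) * fu * fw.
Lemma fbetE : fbet = fe * fbh. Proof. by []. Qed.
Lemma falpE : falp = fe * fah. Proof. by rewrite /falp /fah; ring. Qed.
Lemma dw_u : dw fu = - (8 * fw).
Proof. by rewrite /fu !derE; ring. Qed.
Lemma Nop_u : Nop fu = 0.
Proof. by rewrite /fu !derE; ring. Qed.
Lemma dw_a : dw fa = 6 * fhf * fw * fu ^+ 2 - 48 * fhf * fw ^+ 3 * fu.
Proof. by rewrite /fa !(dw_u, derE); ring. Qed.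
Lemma Nop_a : Nop fa = 0.
Proof. by rewrite /fa !(Nop_u, derE); ring. Qed.
Lemma dw_bh : dw fbh = fhf * (fu * (12 * fw ^+ 2 - 1) - 8 * fw ^+ 2 * (12 * fw ^+ 2 - 1) + 24 * fw ^+ 2 * fu).
Proof. by rewrite /fbh !(dw_u, derE); ring. Qed.
Lemma Nop_bh : Nop fbh = 0.
Proof. by rewrite /fbh !(Nop_u, derE); ring. Qed.
Lemma dw_ah : dw fah = 12 * fw * fu - 48 * fw ^+ 3.
Proof. by rewrite /fah !(dw_u, derE); ring. Qed.
Lemma Nop_ah : Nop fah = 0.
Proof. by rewrite /fah !(Nop_u, derE); ring. Qed.
Lemma dw_b : dw fb = fu - 18 * fw ^+ 2 * fu - 8 * fw ^+ 2 + 48 * fw ^+ 4.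
Proof. by rewrite /fb !(dw_u, derE); ring. Qed.
Lemma Nop_b : Nop fb = 0.
Proof. by rewrite /fb !(Nop_u, derE); ring. Qed.

Lemma EmDm m f : Em m.+1 (Dm m f) = Dm m (Em m f).
Proof.
(* In [h1] and [h2] the first term on the right comes from - fe * Nop acting on the factor fe of
   [Dm], the second from the weight m.+1 reached after [Dm]. *)
have h1 : fb * dw fa - fa * dw fb = fa - fah * fa.
  by rewrite dw_a dw_b /fb /fah /fa /fu; ring.
have h2 : fb * dw fbh - fa * dw fah = fbh - fah * fbh.
  by rewrite dw_bh dw_ah /fb /fah /fa /fbh /fu; ring.
rewrite /Em /Dm -/fb fbetE falpE -natr1.
move: Nop_a Nop_b Nop_bh Nop_ah h1 h2; move: fa fb fah fbh => a b ah bh na nb nbh nah h1 h2.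
have := bracket_identity m%:R fe f (dw f) (dw (dw f)) (Nop f) (Nop (dw f)) h1 h2.
rewrite !(dwD, dwN, dwM, NopD, NopM, dw_e, Nop_e, dw_nat, Nop_nat, na, nbh, dw_Nop) => h.
by etransitivity; [etransitivity; last exact: h|]; ring.
Qed.

(* [Tm m] is the shift c -> c + hbar, as the exponential of hbar d/dc. *)
Definition expc (n : nat) : B := (n`!%:R^-1)%:P.
Definition Tm m := opser expc (Em m).

Lemma expcS n : expc n.+1 *+ n.+1 = expc n.
Proof.
rewrite /expc -(raddfMn (@polyC F)) factS natrM invfM -(mulr_natl (_ * _)) mulrA mulfV ?mul1r //.
by rewrite pnatr_eq0.
Qed.

Lemma fpsS_mulIn n f g : f *+ n.+1 = g *+ n.+1 -> f = g.
Proof.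
move=> h; apply: fpsP => k; have := congr1 (fun x : S => x k) h.
rewrite !fpsMnE => e; apply/polyP => j; have := congr1 (fun x : B => x`_j) e.
rewrite !coefMn -[LHS]mulr_natr -[RHS]mulr_natr => h'; apply: mulIf h'.
by rewrite pnatr_eq0.
Qed.

Lemma Em_const m b f : b^`() = 0 -> Em m (fconst b * f) = fconst b * Em m f.
Proof. by move=> h; rewrite /Em dwM NopM dw_const Nop_const h rmorph0; ring. Qed.
Lemma expc_deriv n : (expc n)^`() = 0. Proof. exact: derivC. Qed.

(** Leibniz rule in divided powers: Em (P i) = (i + 1) P (i + 1), likewise for Q, and the factor n +
    1 on the left splits as i + (n + 1 - i). *)
Lemma iter_Em_mul m1 m2 n f g :
  fconst (expc n) * iter n (Em (m1 + m2)) (f * g) =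
  \sum_(i < n.+1) (fconst (expc i) * iter i (Em m1) f) *
                  (fconst (expc (n - i)) * iter (n - i) (Em m2) g).
Proof.
pose P i := fconst (expc i) * iter i (Em m1) f.
pose Q i := fconst (expc i) * iter i (Em m2) g.
have PS_ i : Em m1 (P i) = P i.+1 *+ i.+1.
  by rewrite /P Em_const ?expc_deriv // iterS -mulrnAl -raddfMn expcS.
have QS_ i : Em m2 (Q i) = Q i.+1 *+ i.+1.
  by rewrite /Q Em_const ?expc_deriv // iterS -mulrnAl -raddfMn expcS.
elim: n => [|n IH]; first by rewrite big_ord1 /= /expc fact0 invr1 !mul1r.
apply: (@fpsS_mulIn n).
rewrite -mulrnAl -raddfMn expcS iterS -Em_const ?expc_deriv // IH.
rewrite (big_morph _ (EmD (m1 + m2)) (_ : _ = 0)); last first.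
  by apply: (addrI (Em (m1 + m2) 0)); rewrite -EmD !addr0.
rewrite -/(P _).
transitivity (\sum_(i < n.+1) (P i.+1 * Q (n - i)%N *+ i.+1 + P i * Q (n - i).+1 *+ (n - i).+1)).
  by apply: eq_bigr => i _; rewrite EmM PS_ QS_ mulrnAl mulrnAr.
rewrite big_split /= -/(Q _) -sumrMnl.
have -> : \sum_(i < n.+2) P i * Q (n.+1 - i)%N *+ n.+1 =
  \sum_(i < n.+2) P i * Q (n.+1 - i)%N *+ i + \sum_(i < n.+2) P i * Q (n.+1 - i)%N *+ (n.+1 - i).
  by rewrite -big_split; apply: eq_bigr => i _ /=; rewrite -mulrnDr subnKC // -ltnS.
congr (_ + _); first by rewrite [RHS]big_ord_recl mulr0n add0r.
rewrite [RHS]big_ord_recr /= subnn mulr0n addr0.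
by apply: eq_bigr => i _; rewrite subSn // -ltnS.
Qed.

(** The exponential of a derivation is multiplicative; the terms with i + j > k drop out by order,
    which leaves the triangle of [iter_Em_mul]. *)
Lemma TmM m1 m2 f g : Tm (m1 + m2) (f * g) = Tm m1 f * Tm m2 g.
Proof.
apply: fpsP => k; set N := k.+1.
have e m q : exists2 r, Tm m q = opsum N expc (Em m) q + r & vanish N r.
  exists (Tm m q - opsum N expc (Em m) q); first by ring.
  by apply: opser_opsum; apply: Em_raises.
have [r1 -> h1] := e m1 f; have [r2 -> h2] := e m2 g; have [r3 -> h3] := e (m1 + m2)%N (f * g).
set p1 := opsum _ _ _ _; set p2 := opsum _ _ _ _; set p3 := opsum _ _ _ _.
have -> : (p2 + r1) * (p3 + r2) = p2 * p3 + (p2 * r2 + r1 * (p3 + r2)) by ring.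
rewrite fpsDE h3 // addr0 [RHS]fpsDE [X in _ = _ + X](_ : _ = 0) ?addr0; last first.
  apply: (_ : vanish N _) => //; apply: vanishD; first exact: vanishMl.
  by rewrite mulrC; apply: vanishMl.
rewrite /p1 /p2 /p3 /opsum fps_sumE mulr_suml fps_sumE.
under [RHS]eq_bigr do rewrite mulr_sumr fps_sumE.
rewrite (@big_triangle _ N (fun i j => (fconst (expc i) * iter i (Em m1) f *
   (fconst (expc j) * iter j (Em m2) g)) k)).
  by apply: eq_bigr => i _; rewrite iter_Em_mul fps_sumE.
move=> i j hij; apply: (@vanishM _ i j) (leq_trans (ltnSn k) hij).
  by apply: vanishMl; apply: raises_iter; apply: Em_raises.
by apply: vanishMl; apply: raises_iter; apply: Em_raises.
Qed.

Lemma TmD m f g : Tm m (f + g) = Tm m f + Tm m g.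
Proof. by apply: opserD; apply: EmD. Qed.
Lemma TmN m f : Tm m (- f) = - Tm m f.
Proof.
have T0 : Tm m 0 = 0 by apply: (addrI (Tm m 0)); rewrite -TmD !addr0.
by apply: (addrI (Tm m f)); rewrite -TmD !subrr.
Qed.
Lemma Dm_const m b f : b^`() = 0 -> Dm m (fconst b * f) = fconst b * Dm m f.
Proof. by move=> h; rewrite /Dm dwM dw_const h rmorph0; ring. Qed.
Lemma TmDm m f : Tm m.+1 (Dm m f) = Dm m (Tm m f).
Proof.
apply: opser_intertwine; try exact: Em_raises; try exact: DmD.
- by move=> n g h; apply: vanishW (Dm_raises m h).
- by move=> n g; apply: Dm_const; apply: expc_deriv.
- by move=> g; apply: EmDm.
Qed.
Lemma Tm_cst m x f : Tm m (fcst x * f) = fcst x * Tm m f.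
Proof.
symmetry; apply/esym; apply: (@opser_intertwine _ _ expc expc _ _ (fun f => fcst x * f));
  try exact: Em_raises.
- by move=> g h; rewrite mulrDr.
- by move=> n g; apply: vanishMl.
- by move=> n g; rewrite mulrCA.
- by move=> g; apply: Em_const; apply: derivC.
Qed.
Lemma Tm_nat m n f : Tm m (n%:R * f) = n%:R * Tm m f.
Proof. by rewrite -(rmorph_nat (@fconst B)) -(rmorph_nat (@polyC F)) Tm_cst. Qed.

(* t = s^2 ft, c = - s^3 fk and c + hbar / 2 = - s^3 fkh. *)
Definition ft : S := 1 - 6 * fw ^+ 2.
Definition fk : S := fw * fu.
Definition fkh : S := fk * (1 + fhf * fe).

(** Since hbar = - s^3 fe fk, this and the next lemmas express dt/dt = 1, dc/dt = 0, dt/dc = 0 and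
    dc/dc = 1; [Em_ek] says that hbar is independent of c. *)
Lemma Dm_t : Dm 2 ft = - (fe * fk).
Proof.
have dt : dw ft = - (12 * fw) by rewrite /ft !derE; ring.
rewrite /Dm dt /fa /fbet /fk.
transitivity (- (2 * fhf) * (fe * (fw * fu)) * (18 * fw ^+ 2 * fu + (12 * fw ^+ 2 - 1) * - ft)).
  by ring.
by rewrite fhf2 /ft /fu; ring.
Qed.
Lemma Dm_k : Dm 3 fk = 0.
Proof.
have dt : dw fk = fu - 8 * fw ^+ 2 by rewrite /fk !(dw_u, derE); ring.
by rewrite /Dm dt /fa /fbet /fk /fu; ring.
Qed.
Lemma Dm_kh : Dm 3 fkh = 0.
Proof.
rewrite (DmM 3 0) Dm_k mul0r add0r /Dm !derE; ring.
Qed.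
Lemma Em_t : Em 2 ft = 0.
Proof.
have dt : dw ft = - (12 * fw) by rewrite /ft !derE; ring.
have nt : Nop ft = 0 by rewrite /ft !derE; ring.
by rewrite /Em dt nt /falp /ft /fu; ring.
Qed.
Lemma Em_k : Em 3 fk = fe * fk.
Proof.
have dt : dw fk = fu - 8 * fw ^+ 2 by rewrite /fk !(dw_u, derE); ring.
have nt : Nop fk = 0 by rewrite /fk !(Nop_u, derE); ring.
by rewrite /Em dt nt /falp /fk /fu; ring.
Qed.
Lemma Em_ek : Em 3 (fe * fk) = 0.
Proof.
have e0 : Em 0 fe = - fe ^+ 2 by rewrite /Em !derE; ring.
by rewrite (EmM 0 3) Em_k e0; ring.
Qed.

Lemma Em0 m : Em m 0 = 0.
Proof. by apply: (addrI (Em m 0)); rewrite -EmD !addr0. Qed.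
Lemma DmB m f g : Dm m (f - g) = Dm m f - Dm m g.
Proof. by rewrite DmD DmN. Qed.
Lemma TmB m f g : Tm m (f - g) = Tm m f - Tm m g.
Proof. by rewrite TmD TmN. Qed.
Lemma Dm_natl m n f : Dm m (n%:R * f) = n%:R * Dm m f.
Proof. by rewrite /Dm !derE; ring. Qed.
Lemma Dm_hf m f : Dm m (fhf * f) = fhf * Dm m f.
Proof. by rewrite /Dm !derE; ring. Qed.
Lemma expc0 : expc 0 = 1. Proof. by rewrite /expc fact0 invr1. Qed.
Lemma expc1 : expc 1 = 1. Proof. by rewrite /expc factS fact0 invr1. Qed.

Lemma Tm_fix m f : Em m f = 0 -> Tm m f = f.
Proof.
move=> h; apply: fpsP => k; rewrite /Tm /opser big_ord_recl /= expc0 mul1r big1 ?addr0 // => i _.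
rewrite /bump /= -iterS iterSr h.
have -> : iter i (Em m) 0 = 0 by elim: (nat_of_ord i) => // n IH; rewrite iterS IH Em0.
by rewrite mulr0.
Qed.
Lemma Tm_coef0 m f : Tm m f 0%N = f 0%N.
Proof. by rewrite /Tm /opser big_ord1 expc0 mul1r. Qed.
Lemma Tm_k : Tm 3 fk = fk * (1 + fe).
Proof.
apply: fpsP => k; rewrite /Tm /opser.
have h n : iter n.+2 (Em 3) fk = 0.
  elim: n => [|n IH]; last by rewrite iterS IH Em0.
  by rewrite /= Em_k Em_ek.
have -> : fk * (1 + fe) = fk + fe * fk by ring.
rewrite fpsDE.
case: k => [|k].
  by rewrite big_ord1 expc0 mul1r /= /fe feps_mul addr0.
rewrite !big_ord_recl /= expc0 expc1 !mul1r Em_k big1 ?addr0 // => i _.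
by rewrite -[Em 3 _]/(iter i.+2 (Em 3) fk) h mulr0.
Qed.

(** [Dm] raises the order of Y while multiplication by g keeps it, so x times the lowest coefficient
    of Y is zero. *)
Lemma lin_zero m x g Y : g 0%N = x%:P -> x != 0 -> Dm m Y = g * Y -> Y = 0.
Proof.
move=> g0 x0 h; apply: vanish_eq0; elim=> [|n IH] //.
move=> k; rewrite ltnS leq_eqVlt => /predU1P [->|]; last exact: IH.
have := Dm_raises m IH (ltnSn n); rewrite h mulrC (vanishMlead _ IH) g0 mulrC mul_polyC.
by move/eqP; rewrite scaler_eq0 (negbTE x0) => /eqP.
Qed.

Definition ev (x : F) f : fps F := fun k => (f k).[x].
Lemma evD x : {morph ev x : f g / f + g}.
Proof. by move=> f g; apply: fpsP => k; rewrite /ev !fpsDE hornerD. Qed.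
Lemma evN x f : ev x (- f) = - ev x f.
Proof. by apply: fpsP => k; rewrite /ev !fpsNE hornerN. Qed.
Lemma evM x f g : ev x (f * g) = ev x f * ev x g.
Proof.
apply: fpsP => k; rewrite /ev !fpsME horner_sum; apply: eq_bigr => i _.
by rewrite hornerM.
Qed.
Lemma ev_const x b : ev x (fconst b) = fconst b.[x].
Proof. by apply: fpsP => -[|k] //=; rewrite /ev /= horner0. Qed.
Lemma ev1 x : ev x 1 = 1.
Proof. by rewrite -(rmorph1 (@fconst B)) ev_const hornerE rmorph1. Qed.
Lemma ev_nat x n : ev x n%:R = n%:R.
Proof. by elim: n => [|n IH]; [apply: fpsP => k; rewrite /ev horner0|rewrite -natr1 evD IH ev1 natr1]. Qed.
Lemma ev_e x : ev x fe = feps F.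
Proof. by apply: fpsP => k; rewrite /ev /fe /feps -polyC_natr hornerC. Qed.
Lemma evX x f n : ev x (f ^+ n) = ev x f ^+ n.
Proof. by elim: n => [|n IH]; rewrite ?expr0 ?ev1 // !exprS evM IH. Qed.
Lemma ev_w x : ev x fw = fconst x.
Proof. by rewrite ev_const hornerX. Qed.
Lemma ev_hf x : ev x fhf = fconst 2^-1.
Proof. by rewrite ev_const hornerC. Qed.
Definition evE := (evD, evN, evM, ev1, ev_nat, evX, ev_w, ev_hf, ev_e).

(* d/da on formal series in eps = 1/a. *)
Definition Xop (q : fps F) : fps F := - (feps F * (fun k => q k *+ k)).
Definition expf (n : nat) : F := n`!%:R^-1.
(** Taylor coefficients of (e^z - 1) / z, so that the shift minus the identity is this series in
    [Em] composed with [Em]. *)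
Definition psif (n : nat) : F := n.+1`!%:R^-1.
Definition psic (n : nat) : B := (psif n)%:P.

Lemma ev_Nop x f : ev x (Nop f) = (fun k => ev x f k *+ k) :> fps F.
Proof. by apply: fpsP => k; rewrite /ev /Nop hornerMn. Qed.
Lemma fconst_nat n : fconst (n%:R : F) = n%:R. Proof. exact: rmorph_nat. Qed.
Lemma half_sq : fconst (2^-1 : F) *+ 2 = 1.
Proof. by rewrite -(raddfMn (@fconst F)) /= -[_ *+ 2]mulr_natr mulVf ?pnatr_eq0 // rmorph1. Qed.
Lemma ev_u_half : ev 2^-1 fu = 0.
Proof.
rewrite /fu !evE; move: half_sq; set h := fconst _ => e.
transitivity (1 - (h *+ 2) ^+ 2); first by ring.
by rewrite e; ring.
Qed.
Lemma ev0_w : ev 0 fw = 0. Proof. by rewrite ev_w rmorph0. Qed.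
(** The d/dw term and [falp] both contain u, which vanishes at w = 1/2; what remains of hbar d/dc is
    - eps^2 d/deps = d/da. At w = 0 the factor w plays the same part. *)
Lemma ev_Em_half m f : ev 2^-1 (Em m f) = Xop (ev 2^-1 f).
Proof.
rewrite /Em /falp (_ : ev _ _ = ev 2^-1 (fu * (fe * ((1 - 6 * fw ^+ 2) * fw * dw f) + m%:R * 6 * fe * fw ^+ 2 * f)) - ev 2^-1 fe * ev 2^-1 (Nop f)); last first.
  by rewrite -evM -evN -evD; congr (ev _ _); ring.
by rewrite evM ev_u_half mul0r add0r ev_e ev_Nop.
Qed.
Lemma ev_Em_0 m f : ev 0 (Em m f) = Xop (ev 0 f).
Proof.
rewrite /Em /falp (_ : ev _ _ = ev 0 (fw * (fe * ((1 - 6 * fw ^+ 2) * fu * dw f) + m%:R * 6 * fe * fw * fu * f)) - ev 0 fe * ev 0 (Nop f)); last first.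
  by rewrite -evM -evN -evD; congr (ev _ _); ring.
by rewrite evM ev0_w mul0r add0r ev_e ev_Nop.
Qed.
Lemma XopD : {morph Xop : f g / f + g}.
Proof.
move=> f g; rewrite /Xop -opprD -mulrDr; congr (- (_ * _)).
by apply: fpsP => k; rewrite !fpsDE mulrnDl.
Qed.
Lemma Xop_raises : raises Xop.
Proof.
move=> n q h; apply/vanishN/vanish_eps => k hk.
by rewrite h // mul0rn.
Qed.
Lemma Xop_const (c : F) (q : fps F) : Xop (fconst c * q) = fconst c * Xop q.
Proof.
apply: fpsP => k; rewrite /Xop fconst_mul !fpsNE !feps_mul.
by case: k => [|k]; rewrite ?oppr0 ?mulr0 // fconst_mul mulrN mulrnAr.
Qed.
Lemma ev_opser x m (a : nat -> F) f : (forall f, ev x (Em m f) = Xop (ev x f)) ->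
  ev x (opser (fun n => (a n)%:P) (Em m) f) = opser a Xop (ev x f).
Proof.
move=> h; symmetry; apply: opser_intertwine; try exact: Em_raises.
- exact: Xop_raises.
- exact: evD.
- by move=> n g hg k hk; rewrite /ev hg // horner0.
- by move=> n g; rewrite evM ev_const hornerC.
- by move=> g; rewrite h.
Qed.

Lemma Psi_Em m f : opser psic (Em m) (Em m f) = Tm m f - f.
Proof.
apply: fpsP => k.
(* The last term on the left vanishes by order, which makes the two finite sums equally long after
   the index shift. *)
have e : iter k (Em m) (Em m f) k = 0 by rewrite -iterSr (@raises_iter _ _ k.+1 f (Em_raises m)).
rewrite fpsBE /Tm /opser [in RHS]big_ord_recl /= expc0 mul1r [RHS]addrC addKr.
rewrite big_ord_recr /= e mulr0 addr0.
apply: eq_bigr => i _; rewrite -iterSr; congr (_ * _).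
Qed.
Lemma Em_Tm m f : Em m (Tm m f) = Tm m (Em m f).
Proof.
symmetry; apply: opser_intertwine.
- exact: Em_raises.
- exact: Em_raises.
- exact: EmD.
- by move=> n g h; apply: vanishW (Em_raises m h).
- by move=> n g; apply: Em_const; apply: expc_deriv.
- by [].
Qed.

(** The quotient p / g is constant and vanishes at 0. In coefficients: at the first index j >= 2
    where p might be nonzero the equation reads (j - 1) p_j = 0. *)
Lemma wronskian_zero (g p : B) : g`_0 = 0 -> g`_1 = 1 -> p`_0 = 0 -> p`_1 = 0 ->
  g * p^`() = p * g^`() -> p = 0.
Proof.
move=> g0 g1 p0 p1 h.
have hp : forall j, (forall i, (i < j)%N -> p`_i = 0) -> p`_j = 0.
  move=> [|[|j]] // IH; have := congr1 (fun q : B => q`_(j.+2)) h.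
  rewrite /= !coefM 2!big_ord_recl /= g0 mul0r add0r g1 mul1r big1 ?addr0; last first.
    by move=> i _; rewrite coef_deriv IH ?mul0rn ?mulr0 // /bump /= !add1n !subSS !ltnS leq_subr.
  rewrite big_ord_recr /= subnn [in RHS]coef_deriv g1 big1 ?add0r; last first.
    by move=> i _; rewrite IH ?mul0r.
  rewrite subSS subn0 coef_deriv mulr1n mulr1 => /eqP.
  rewrite -subr_eq0 -[X in _ - X]mulr1n -mulrnBr //.
  by rewrite mulrn_eq0 => /orP [/eqP|/eqP].
have {}hp j : forall i, (i < j)%N -> p`_i = 0.
  elim: j => // j IH i; rewrite ltnS leq_eqVlt => /predU1P [->|]; last exact: IH.
  exact: hp.
by apply/polyP => i; rewrite coef0; apply: (hp i.+1).
Qed.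

Lemma fuE : fu = fconst (1 - 4%:R * 'X^2).
Proof. by rewrite rmorphB rmorph1 rmorphM rmorphXn rmorph_nat. Qed.

(** Neither factor is a zero divisor; this passes from an equation for [Dm] to one for d/dw. *)
Lemma fe_fa_cancel f g : fe * (fa * f) = fe * (fa * g) -> f = g.
Proof.
have ea : fa = fconst ((3%:R * 2^-1)%:P * 'X^2 * (1 - 4%:R * 'X^2) ^+ 2).
  rewrite /fa fuE /fhf /fcst /fw -(rmorph_nat (@fconst B)) -!rmorphXn -!rmorphM /=.
  by rewrite polyCM polyC_natr.
move=> h; apply: fpsP => k; have := congr1 (fun q : S => q k.+1) h.
have nz : 1 - 4%:R * 'X^2 != 0 :> B.
  apply/eqP => /(congr1 (fun q : B => q.[0])) /eqP.
  by rewrite hornerD hornerN hornerM hornerXn expr0n mulr0 subr0 -polyC1 !hornerC oner_eq0.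
rewrite /fe !feps_mul ea !fconst_mul => /mulfI; apply.
rewrite !mulf_neq0 ?expf_neq0 ?polyX_eq0 //.
by rewrite polyC_eq0 mulf_neq0 ?invr_eq0 ?pnatr_eq0.
Qed.

(** * The Backlund transformation and the difference equation *)

Section Backlund.
Variables l r : S.
Hypothesis hl0 : l 0%N = 'X.
Hypothesis hl : Dm 2 (Dm 1 l) = 2 * l ^+ 3 + ft * l - fk.
Hypothesis hr0 : r 0%N = 1.
Hypothesis hr : r ^+ 2 + Dm 1 r = 6 * l ^+ 2 + ft.

Let lt := Tm 1 l.
Let rt := Tm 1 r.

(** The shift is multiplicative, commutes with hbar d/dt, fixes t and sends c to c + hbar. *)
Lemma shifted_PII : Dm 2 (Dm 1 lt) = 2 * lt ^+ 3 + ft * lt - fk * (1 + fe).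
Proof.
rewrite /lt -!TmDm hl TmB TmD Tm_k; congr (_ + _ - _).
  by rewrite Tm_nat !exprS expr0 !mulr1 (TmM 1 2) (TmM 1 1).
by rewrite (TmM 2 1) (Tm_fix Em_t).
Qed.

Lemma shifted_Riccati : rt ^+ 2 + Dm 1 rt = 6 * lt ^+ 2 + ft.
Proof.
have := congr1 (Tm 2) hr; rewrite (TmD 2 (r ^+ 2)) (TmD 2 (6 * l ^+ 2)) (Tm_fix Em_t) TmDm Tm_nat.
by rewrite !expr2 !(TmM 1 1).
Qed.

Let phi := l ^+ 2 + Dm 1 l + fhf * ft.
Let pht := lt ^+ 2 - Dm 1 lt + fhf * ft.

(** The defects A and X of the two identities satisfy a homogeneous linear system. In lowest order
    it reads X = w A and phi_0 A + 2 w X = 0 with phi_0 = 1/2 - 2 w^2, that is A / 2 = 0: its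
    determinant is a unit. *)
Lemma backlund : phi = pht /\ (l + lt) * phi = fkh.
Proof.
have eDl : Dm 1 l = phi - l ^+ 2 - fhf * ft by rewrite /phi; ring.
have eDlt : Dm 1 lt = lt ^+ 2 + fhf * ft - pht by rewrite /pht; ring.
have et x : ft * x = 2 * (fhf * ft) * x by rewrite !mulrA fhf2 mul1r.
have d1 : Dm 2 phi = 2 * l * phi - fkh.
  rewrite {1}/phi DmD (DmD 2 (l ^+ 2)) Dm_hf Dm_t hl expr2 (DmM 1 1) eDl (et l) /fkh.
  by ring.
have d2 : Dm 2 pht = fkh - 2 * lt * pht.
  rewrite {1}/pht DmD (DmB 2 (lt ^+ 2)) Dm_hf Dm_t shifted_PII expr2 (DmM 1 1) eDlt (et lt) /fkh.
  transitivity ((1 - 2 * fhf) * (fe * fk) + (fkh - 2 * lt * pht)); last by rewrite fhf2 /fkh; ring.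
  by rewrite /fkh; ring.
pose A := phi - pht; pose X := (l + lt) * phi - fkh.
have hA : Dm 2 A = 2 * X - 2 * lt * A.
  by rewrite /A DmB d1 d2 /X; ring.
have hX : Dm 3 X = phi * A + (l + lt) * X.
  rewrite /X DmB Dm_kh (DmM 1 2) DmD d1 eDl eDlt /A.
  by ring.
have l0 : lt 0%N = 'X by rewrite /lt Tm_coef0.
have p0 : phi 0%N = 'X^2 + (2^-1)%:P * (1 - 6 * 'X^2).
  rewrite /phi !fpsDE (Dm_raises 1 (vanish0 l) (ltnSn 0)) addr0.
  rewrite expr2 fpsM0 hl0 fpsM0 -expr2; congr (_ + _ * _).
  rewrite /ft fpsBE fps1E -[6]/(6%:R) -(rmorph_nat (@fconst B)) /fw -rmorphXn -rmorphM /=.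
  by [].
have hv : forall n, vanish n A /\ vanish n X.
  elim=> [|n [vA vX]]; first by split.
  have cA := Dm_raises 2 vA (ltnSn n).
  have cX := Dm_raises 3 vX (ltnSn n).
  rewrite hA fpsBE mulrC (vanishMlead _ vX) mulrC in cA.
  rewrite [in X in _ - X]mulrC (vanishMlead _ vA) fpsM0 l0 in cA.
  rewrite hX fpsDE mulrC (vanishMlead _ vA) [in X in _ + X]mulrC (vanishMlead _ vX) fpsDE hl0 l0 p0 in cX.
  have two : (2 : S) 0%N = 2 by [].
  rewrite two in cA.
  have hh : 2 * (2^-1)%:P = 1 :> B.
    by have := congr1 (fun f : S => f 0%N) fhf2; rewrite fpsM0 two.
  have eX : X n = 'X * A n.
    have : 2 * (X n - 'X * A n) = 0 by rewrite -cA; ring.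
    move=> h; have : (2^-1)%:P * (2 * (X n - 'X * A n)) = 0 by rewrite h mulr0.
    by rewrite mulrA [_ * 2]mulrC hh mul1r => /eqP; rewrite subr_eq0 => /eqP.
  have eA : A n = 0.
    rewrite eX in cX.
    have h : (2^-1)%:P * A n = 0.
      rewrite -cX; apply/eqP; rewrite -subr_eq0; apply/eqP.
      by transitivity ((2 * (2^-1)%:P - 1) * (3 * 'X^2 * A n)); [ring|rewrite hh; ring].
    by rewrite -[A n]mul1r -hh -mulrA h mulr0.
  have eX0 : X n = 0 by rewrite eX eA mulr0.
  by split=> k; rewrite ltnS leq_eqVlt => /predU1P [->|] //; [apply: vA|apply: vX].
split; apply/eqP; rewrite -subr_eq0; apply/eqP; apply: vanish_eq0 => n; first by have [] := hv n.
by have [] := hv n.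
Qed.

(** If l varies by d with hbar d' = r d, linearising (l + lt) phi = fkh makes lt vary by - (H / fkh)
    d. Since fkh is constant in t, H should have the logarithmic derivative rt - r. *)
Let H := (l + lt) ^+ 2 * (2 * l + r) + fkh.

Lemma log_derivative_shift : Dm 3 H = H * (rt - r).
Proof.
have [eq1 eq2] := backlund.
have eDl : Dm 1 l = phi - l ^+ 2 - fhf * ft by rewrite /phi; ring.
have eDlt : Dm 1 lt = lt ^+ 2 + fhf * ft - phi by rewrite eq1 /pht; ring.
have et : ft = 2 * (fhf * ft) by rewrite mulrA fhf2 mul1r.
have eDr : Dm 1 r = 6 * l ^+ 2 + 2 * (fhf * ft) - r ^+ 2 by rewrite -et -hr; ring.
have eDrt : Dm 1 rt = 6 * lt ^+ 2 + 2 * (fhf * ft) - rt ^+ 2 by rewrite -et -shifted_Riccati; ring.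
(* Y = 0 is the linearisation of phi = pht; it holds because Y satisfies a homogeneous linear
   equation with leading coefficient - 2. *)
pose Y := H * (2 * lt - rt) + fkh * (2 * l + r).
have hH : Dm 3 H = H * (rt - r) + Y.
  rewrite {1}/H DmD Dm_kh (DmM 2 1) expr2 (DmM 1 1) (DmD 1 l) (DmD 1 (2 * l)) Dm_natl eDl eDlt eDr /Y /H -eq2.
  by ring.
have hY : Dm 4 Y = - (r + rt) * Y.
  rewrite {1}/Y DmD (DmM 3 1) (DmM 3 1) hH Dm_kh (DmB 1 (2 * lt)) (DmD 1 (2 * l)) !Dm_natl eDl eDlt eDr eDrt /Y /H -eq2.
  by ring.
have Y0 : Y = 0.
    apply: (@lin_zero 4 (- 2) (- (r + rt))) => //; last by rewrite oppr_eq0 pnatr_eq0.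
    by rewrite fpsNE fpsDE hr0 /rt Tm_coef0 hr0 polyCN polyC_natr.
by rewrite hH Y0 addr0.
Qed.

Variable P : S.
Hypothesis hP : r = 1 - fhf * fbet + Dm 0 P.
Hypothesis hP0 : ev 0 P = 0.
Hypothesis hl_0 : ev 0 l = 0.
Hypothesis hl_half : ev 2^-1 l = fconst 2^-1.
Hypothesis hr_half : ev 2^-1 r = 1.

(** The image under [Em 0] of log ((1 + 2w) / (1 - 2w)), whose w-derivative is 4 / u and whose image
    under [Dm 0] is [falp]. The logarithm itself is not a polynomial in w, this image is. *)
Let lgd : S := 4 * fe * fw * ft.
(** A primitive in t of hbar d/dc applied to rt - r; its three terms come from the three terms of r
    in [hP]. *)
Let M : S := opser psic (Em 0) lgd - fhf * (Tm 0 falp - falp) + Em 0 (Tm 0 P - P).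

Lemma Dm_lgd : Dm 0 lgd = Em 1 falp.
Proof.
have d1 : dw lgd = 4 * fe * (1 - 18 * fw ^+ 2) by rewrite /lgd /ft !derE; ring.
have d2 : dw falp = fe * dw fah by rewrite falpE dwM dw_e; ring.
have n2 : Nop falp = falp by rewrite falpE NopM Nop_e Nop_ah; ring.
rewrite /Dm /Em d1 d2 n2 dw_ah /fa /falp.
transitivity ((2 * fhf) * (fe * (6 * fw ^+ 2 * fu ^+ 2) * (fe * (1 - 18 * fw ^+ 2)))); first by ring.
by rewrite fhf2 /fu; ring.
Qed.
Lemma Em_one : Em 1 1 = falp.
Proof. by rewrite /Em !derE; ring. Qed.
(** Up to powers of s, [fbet] and [falp] are the logarithmic derivatives of s in t and in c, so this
    is the symmetry of mixed derivatives, [EmDm] applied to 1. *)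
Lemma Em_fbet : Em 1 fbet = Dm 0 falp.
Proof.
have d1 : Dm 1 1 = fbet by rewrite /Dm !derE; ring.
have := EmDm 1 1; rewrite d1 Em_one /Em /Dm => h.
apply: (addIr (falp * fbet)).
by etransitivity; [etransitivity; last exact: h|]; ring.
Qed.

Lemma Dm_M : Dm 0 M = Em 1 (rt - r).
Proof.
have e1 : Dm 0 (opser psic (Em 0) lgd) = Tm 1 falp - falp.
  rewrite -Psi_Em -Dm_lgd; symmetry; apply: opser_intertwine; try exact: Em_raises.
  - exact: DmD.
  - by move=> n g h; apply: vanishW (Dm_raises 0 h).
  - by move=> n g; apply: Dm_const; apply: derivC.
  - by move=> g; rewrite EmDm.
rewrite /M DmD DmB e1 Dm_hf DmB -(TmDm 0) -(EmDm 0) DmB -(TmDm 0).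
have -> : rt - r = (Tm 1 1 - 1) + (- (fhf * (Tm 1 fbet - fbet))) + (Tm 1 (Dm 0 P) - Dm 0 P).
  rewrite /rt hP TmD (TmB 1 1) Tm_cst; ring.
have Em_hf f : Em 1 (fhf * f) = fhf * Em 1 f by apply: Em_const; apply: derivC.
rewrite (EmD 1 (_ + _)) (EmD 1 (_ - _)) EmN Em_hf (EmD 1 (Tm 1 1)) (EmD 1 (Tm 1 fbet)) !EmN.
by rewrite !Em_Tm Em_one Em_fbet.
Qed.

(** The quotient V / H = hbar d/dc (log H) - M has zero t-derivative, hence depends on eps only. *)
Let V : S := Em 3 H - H * M.

Lemma wronskian_V : H * dw V = V * dw H.
Proof.
have e : Dm 3 V = (rt - r) * V.
  rewrite /V DmB (DmM 3 0) Dm_M -EmDm log_derivative_shift (EmM 3 1); ring.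
apply: fe_fa_cancel.
have := log_derivative_shift.
move: e; rewrite /Dm => e1 e2.
apply/eqP; rewrite -subr_eq0; apply/eqP.
transitivity (H * (fe * (fa * dw V) + 3 * fbet * V) - V * (fe * (fa * dw H) + 3 * fbet * H)).
  by ring.
by rewrite e1 e2; ring.
Qed.

Lemma ev_lt_0 : ev 0 lt = 0.
Proof.
rewrite /lt (ev_opser expf) ?hl_0; last by move=> f; apply: ev_Em_0.
apply: fpsP => k; rewrite /opser big1 // => i _.
have -> : iter i Xop 0 = 0.
  elim: (nat_of_ord i) => // n IH; rewrite iterS IH.
  by apply: (addrI (Xop 0)); rewrite -XopD !addr0.
by rewrite mulr0.
Qed.
Lemma opser0 (a : nat -> F) : opser a Xop 0 = 0.
Proof. by apply: (addrI (opser a Xop 0)); rewrite -(opserD _ _ _ XopD) !addr0. Qed.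

Lemma ev_lt_half : ev 2^-1 lt = fconst 2^-1.
Proof.
rewrite /lt (ev_opser expf) ?hl_half; last by move=> f; apply: ev_Em_half.
have X0 : Xop (fconst 2^-1) = 0.
  by apply: fpsP => -[|[|k]]; rewrite /Xop fpsNE feps_mul ?oppr0 //= mul0rn oppr0.
apply: fpsP => k; rewrite /opser big_ord_recl /= /expf fact0 invr1 mul1r big1 ?addr0 // => i _.
rewrite -iterS iterSr X0.
have -> : iter i Xop 0 = 0.
  elim: (nat_of_ord i) => // n IH; rewrite iterS IH.
  by apply: (addrI (Xop 0)); rewrite -XopD !addr0.
by rewrite mulr0.
Qed.

Lemma ev_dw_H_0 : ev 0 (dw H) = 1 + fconst 2^-1 * feps F.
Proof.
have -> : dw H = (l + lt) * (2 * (dw l + dw lt) * (2 * l + r) + (l + lt) * dw (2 * l + r)) +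
   ((fu - 8 * fw ^+ 2) * (1 + fhf * fe)).
  rewrite /H /fkh /fk dwD (dwM (_ ^+ 2)) dwX (dwD l) (dwM (fw * fu)) (dwM fw) dw_w dw_u.
  rewrite (dwD 1) dw1 (dwM fhf) dw_hf dw_e; ring.
rewrite evD evM (evD _ l) ev_lt_0 hl_0 addr0 mul0r add0r /fu !evE rmorph0; ring.
Qed.
Lemma ev_H_0 : ev 0 H = 0.
Proof.
rewrite /H evD evM evX (evD _ l) ev_lt_0 hl_0 /fkh /fk 2!evM ev0_w; ring.
Qed.
Lemma ev_M_0 : ev 0 M = 0.
Proof.
have T0 q : ev 0 q = 0 -> ev 0 (Tm 0 q) = 0.
  by move=> h; rewrite (ev_opser expf) ?h ?opser0 // => f; apply: ev_Em_0.
have a0 : ev 0 falp = 0 by rewrite /falp !(evM, evX) ev0_w; ring.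
have p0 : ev 0 (opser psic (Em 0) lgd) = 0.
  rewrite (ev_opser psif); last by move=> f; apply: ev_Em_0.
  by rewrite (_ : ev 0 lgd = 0) ?opser0 // /lgd !(evM, evX) ev0_w; ring.
have X0 : Xop 0 = 0 by apply: (addrI (Xop 0)); rewrite -XopD !addr0.
rewrite /M evD evD evN evM p0 evD evN a0 T0 // ev_Em_0 evD evN hP0 T0 //.
by rewrite !subr0 X0; ring.
Qed.
Lemma ev_dw_V_0 : ev 0 (dw V) = feps F.
Proof.
(* The terms are grouped so that one of w, H, M, all zero at w = 0, is a factor of each, except fe
   (1 - 6 w^2) u H' - fe Nop H'. *)
have -> : dw V = fw * ((- (fe * (12 * fu * fw * dw H)) +  fe * (1 - 6 * fw ^+ 2) * (- (8 * fw)) * dw H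
      + fe * (1 - 6 * fw ^+ 2) * fu * dw (dw H)) + 3 * fe * dw fah * 0
      + 18 * fe * fw * fu * dw H) + 3 * fe * dw fah * H + fe * (1 - 6 * fw ^+ 2) * fu * dw H
      - fe * Nop (dw H) - dw H * M - H * dw M.
  rewrite /V /Em falpE dwD dwN (dwM H) (dwD (_ - _)) (dwD (fe * _)) dwN (dwM fe) (dwM fe (Nop H)) dw_e dw_Nop.
  rewrite (dwM (3%:R * (fe * fah))) (dwM 3%:R) dw_nat (dwM fe fah) dw_e.
  rewrite (dwM (_ * fw)) (dwM (_ * fu)) (dwM _ fu) dw_u dw_w (dwD 1) dw1 dwN (dwM 6) dwX dw_w dw_nat.
  rewrite /fah; ring.
rewrite !(evD, evN) !(evM _ fw) ev0_w !(evM _ H) !(evM _ _ H) ev_H_0.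
rewrite (evM _ (fe * _ * fu)) ev_dw_H_0 (evM _ (dw H)) ev_M_0 (evM _ fe) ev_Nop ev_dw_H_0 /fu !evE rmorph0.
set h := fconst _; set e := feps F.
have -> : (fun k => (1 + h * e) k *+ k) = h * e :> fps F.
  apply: fpsP => -[|[|k]]; first by rewrite mulr0n fconst_mul mulr0.
    by rewrite mulr1n fpsDE fps1E add0r.
  by rewrite fpsDE fps1E add0r fconst_mul mulr0 mul0rn.
ring.
Qed.

Let W : fps F := ev 2^-1 P.
Let hh : fps F := fconst 2^-1.

(* d/da (W(a+1) - W(a)) = log (1 + 1/a) - 1/(a + 1/2), with a = 1/eps. *)
Lemma difference_equation :
  (1 + hh * feps F) * (opser psif Xop (feps F) - Xop (opser expf Xop W - W)) = feps F.
Proof.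
have dk : dw (1 + fhf * fe) = 0.
  rewrite (dwD 1) dw1 (dwM fhf) dw_hf dw_e; ring.
(* The constant V / H is the quotient eps / (1 + eps / 2) of the w-derivatives at w = 0, where V and
   H both vanish. *)
have hN : (1 + fhf * fe) * V - fe * H = 0.
  set N := _ - _.
  have wN : H * dw N = N * dw H.
    rewrite /N dwD dwN (dwM (1 + _)) dk (dwM fe) dw_e.
    transitivity ((1 + fhf * fe) * (H * dw V) - fe * H * dw H); first by ring.
    by rewrite wronskian_V; ring.
  have eN0 : ev 0 N = 0.
    rewrite /N evD evN evM (evM _ fe) ev_H_0 /V evD evN (evM _ H) ev_H_0 ev_Em_0 ev_H_0.
    have -> : Xop 0 = 0 by apply: (addrI (Xop 0)); rewrite -XopD !addr0.
    by ring.
  have edN0 : ev 0 (dw N) = 0.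
    rewrite /N dwD dwN (dwM (1 + _)) dk (dwM fe) dw_e.
    rewrite evD evN (evD _ (0 * _)) (evD _ (0 * _)) !(evM _ 0) (evM _ (1 + _)) (evM _ fe).
    rewrite ev_dw_V_0 ev_dw_H_0 (evD _ 1) ev1 (evM _ fhf) ev_hf ev_e.
    have -> : ev 0 0 = 0 by apply: fpsP => k; rewrite /ev horner0.
    by ring.
  have H0 : H 0%N = ('X * (1 + 2 * 'X) ^+ 2 : B).
    rewrite /H fpsDE fpsM0 expr2 fpsM0 !fpsDE fpsM0 /lt Tm_coef0 hl0 hr0 /fkh /fk !fpsM0.
    have -> : (1 + fhf * fe) 0%N = 1 by rewrite fpsDE fps1E fpsM0 [fe _]/(0) mulr0 addr0.
    have -> : (2 : S) 0%N = 2 by [].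
    by rewrite fuE /=; ring.
  (* Order by order in eps, the lowest coefficient of N satisfies the Wronskian relation with H_0
     and has a double zero at w = 0. *)
  apply: vanish_eq0; elim=> // n IH k; rewrite ltnS leq_eqVlt => /predU1P [->|]; last exact: IH.
  have := congr1 (fun q : S => q n) wN.
  rewrite mulrC (vanishMlead _ (vanish_dw IH)) (vanishMlead _ IH) /dw H0 => e.
  apply: (@wronskian_zero ('X * (1 + 2 * 'X) ^+ 2)).
  - by rewrite coefXM.
  - by rewrite coefXM /= -horner_coef0 horner_exp hornerD hornerM hornerX mulr0 addr0 -polyC1 hornerC expr1n.
  - by rewrite -horner_coef0; have := congr1 (fun q : fps F => q n) eN0.
  - have := congr1 (fun q : fps F => q n) edN0; rewrite /ev /dw horner_coef0 coef_deriv.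
    by rewrite mulr1n.
  - by rewrite mulrC e.
have := congr1 (ev 2^-1) hN.
rewrite evD evN (evM _ (1 + _)) (evM _ fe) (evD _ 1) ev1 (evM _ fhf) ev_hf ev_e -/hh.
have -> : ev 2^-1 0 = 0 by apply: fpsP => k; rewrite /ev horner0.
(* Here l = lt = 1/2, r = 1 and u = 0; since 2 is constant in eps, V reduces to - 2 M at w = 1/2. *)
have eH : ev 2^-1 H = 2.
  rewrite /H evD evM evX (evD _ l) ev_lt_half hl_half (evD _ (2 * l)) hr_half /fkh /fk (evM _ (fw * fu)) (evM _ fw) ev_u_half.
  rewrite (evM _ 2) hl_half ev_nat -mulr2n half_sq mulr_natl half_sq; ring.
have X2 : Xop 2 = 0.
  rewrite -fconst_nat; apply: fpsP => -[|[|k]]; by rewrite /Xop fpsNE feps_mul ?oppr0 //= mul0rn oppr0.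
rewrite {1}/V evD evN (evM _ H) eH ev_Em_half eH X2.
have eM : ev 2^-1 M = - (opser psif Xop (feps F) - Xop (opser expf Xop W - W)).
  have a0 : ev 2^-1 falp = 0 by rewrite /falp !evM ev_u_half; ring.
  have el : ev 2^-1 lgd = - feps F.
    rewrite /lgd /ft !evE; move: half_sq; set h := fconst _ => eh.
    transitivity (feps F * ((h *+ 2) *+ 2 - 3 * (h *+ 2) ^+ 3)); first by ring.
    by rewrite eh; ring.
  rewrite /M evD evD evN evM evD evN a0 ev_Em_half evD evN.
  rewrite (ev_opser psif); last by move=> f; apply: ev_Em_half.
  rewrite !(ev_opser expf); try by move=> f; apply: ev_Em_half.
  rewrite a0 el -/W opser0.
  have -> : opser psif Xop (- feps F) = - opser psif Xop (feps F).
    by apply: (addrI (opser psif Xop (feps F))); rewrite -(opserD _ _ _ XopD) !subrr opser0.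
  by ring.
rewrite eM => h.
have : 2 * ((1 + hh * feps F) * (opser psif Xop (feps F) - Xop (opser expf Xop W - W)) - feps F) = 0.
  by rewrite -h; ring.
set q := _ - feps F => hq.
apply/eqP; rewrite -subr_eq0 -/q; apply/eqP.
transitivity (fconst 2^-1 * (2 * q)); last by rewrite hq mulr0.
by rewrite mulrA [_ * 2]mulr_natr half_sq mul1r.
Qed.
End Backlund.
End PIIOperators.

(** * Polynomial coefficients of the 0-parameter solution and of the Riccati solutions *)

Section CausalRecursion.
Variables (A : Type) (x0 : A) (G : (nat -> A) -> nat -> A).
Hypothesis G_causal : forall k f g, (forall j, (j < k)%N -> f j = g j) -> G f k = G g k.
(** Iterating G n times settles the values below n, so k.+1 rounds suffice at k. *)
Definition causal_fix (k : nat) : A := iter k.+1 G (fun=> x0) k.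
Lemma causal_fixE k : causal_fix k = G causal_fix k.
Proof.
have h : forall k n, (k < n)%N -> iter n G (fun=> x0) k = causal_fix k.
  elim/ltn_ind=> {}k IH [|n] // hk; rewrite /causal_fix !iterS.
  apply: G_causal => j hj; rewrite IH // ?(leq_trans hj) //.
  by rewrite IH.
by rewrite -(h k k.+1) // iterS; apply: G_causal => j hj; apply: h.
Qed.
End CausalRecursion.

Section Coefficients.
Variable F : numFieldType.
Notation B := {poly F}.
Notation S := (fps {poly F}).

Definition pv : B := 'X * (1 - 4%:R * 'X^2).
Definition pa : B := (3%:R * 2^-1)%:P * pv ^+ 2.
Definition pb : B := (2^-1)%:P * pv * (12%:R * 'X^2 - 1).
(** The weight m is a scalar because 1 / s and 1 / Delta have negative weights. *)
Definition Dpol (m : F) (q : B) : B := pa * q^`() + m%:P * pb * q.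

Lemma fkE : fk F = fconst pv.
Proof. by rewrite /fk fuE -rmorphM. Qed.
Lemma fa_const : fa F = fconst pa.
Proof.
rewrite /fa fuE /fhf /fcst /fw -(rmorph_nat (@fconst B)) -!rmorphXn -!rmorphM /=.
by rewrite /pa polyCM polyC_natr /pv exprMn !mulrA.
Qed.
Lemma fbh_const : fbh F = fconst pb.
Proof.
rewrite /fbh fuE /fhf /fcst /fw -(rmorph_nat (@fconst B)) -!rmorphXn -(rmorph1 (@fconst B)) -!(rmorphM, rmorphB) /=.
by rewrite /pb /pv !mulrA.
Qed.
Lemma ft_const : ft F = fconst (1 - 6%:R * 'X^2).
Proof. by rewrite /ft rmorphB rmorph1 rmorphM rmorphXn rmorph_nat. Qed.
Lemma Dm_coef m (f : S) k : Dm m f k = if k is k'.+1 then Dpol m%:R (f k') else 0.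
Proof.
rewrite /Dm fbetE fa_const fbh_const.
rewrite (_ : _ + _ = feps B * (fconst pa * dw f + fconst (m%:R%:P * pb) * f)); last first.
  by rewrite (rmorphM (@fconst B) _ pb) (polyC_natr _ m) (rmorph_nat (@fconst B) m) /fe; ring.
rewrite feps_mul; case: k => // k.
by rewrite fpsDE !fconst_mul.
Qed.

Lemma conv3 (f : S) k :
  (f ^+ 3) k = \sum_(a < k.+1) \sum_(b < k.+1) \sum_(d < k.+1)
     (if (a + b + d == k)%N then f a * f b * f d else 0).
Proof.
rewrite !exprS expr0 mulr1 fpsME; apply: eq_bigr => a _.
rewrite fpsME mulr_sumr.
have ha : (a <= k)%N by rewrite -ltnS.
rewrite (big_ord_widen k.+1 (fun b => f a * (f b * f (k - a - b)%N))) ?ltnS ?leq_subr //.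
rewrite big_mkcond; apply: eq_bigr => b _.
rewrite ltnS leq_subRL //.
case: ifP => hb.
  have hd : (k - a - b < k.+1)%N by rewrite ltnS (leq_trans (leq_subr _ _)) // leq_subr.
  have e : (a + b + (k - a - b))%N = k by rewrite -subnDA subnKC.
  rewrite (bigD1 (Ordinal hd)) //= e eqxx big1 ?addr0 ?mulrA // => d.
  rewrite -val_eqE /= => hne; case: eqP => // e0.
  by rewrite -(eqn_add2l (a + b)) e0 e eqxx in hne.
rewrite big1 // => d _; case: eqP => // e.
by rewrite -[X in (_ <= X)%N]e leq_addr in hb.
Qed.

(** The recursion [zstep] in the variable w; its division by Delta = s^2 only lowers the weight and
    leaves no trace here. *)
Definition lstep (f : nat -> B) (k : nat) : B :=
  if k is k1.+1 then
    (if k1 is k2.+1 then Dpol 2 (Dpol 1 (f k2)) else 0)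
    - 2 * \sum_(a < k) \sum_(b < k) \sum_(d < k)
        (if (a + b + d == k)%N then f a * f b * f d else 0)
  else 'X.
Definition lpol : S := causal_fix 0 lstep.
Lemma lpolE k : lpol k = lstep lpol k.
Proof.
apply: causal_fixE => {}k f g h; rewrite /lstep.
case: k h => // k h; congr (_ - _ * _).
  by case: k h => // k h; rewrite h.
apply: eq_bigr => a _; apply: eq_bigr => b _; apply: eq_bigr => d _.
by rewrite !h.
Qed.

Lemma lpol0 : lpol 0%N = 'X. Proof. by rewrite lpolE. Qed.

(** Isolates the part linear in the top coefficient. For f_0 = w it combines with [ft] into 6 w^2 +
    (1 - 6 w^2) = 1, so the equation is solved without division. *)
Lemma cube_coef (f : S) k :
  (f ^+ 3) k.+1 = 3 * f 0%N ^+ 2 * f k.+1 +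
   \sum_(a < k.+1) \sum_(b < k.+1) \sum_(d < k.+1)
        (if (a + b + d == k.+1)%N then f a * f b * f d else 0).
Proof.
pose g : S := fun j => if (j <= k)%N then f j else 0.
have e : vanish k.+1 (f - g).
  by move=> j hj; rewrite fpsBE /g -ltnS hj subrr.
have -> : f ^+ 3 = g ^+ 3 + (f - g) * (3 * g ^+ 2 + (f - g) * (3 * g + (f - g))) by ring.
rewrite fpsDE addrC (vanishMlead _ e) fpsBE {1}/g ltnn subr0; congr (_ + _).
  rewrite fpsDE (fpsM0 (f - g)) (e 0%N) // mul0r addr0 fpsM0 expr2 fpsM0 /g /=.
  by rewrite [(3 : S) 0%N](_ : _ = 3) //; ring.
rewrite conv3 big_ord_recr /= [X in _ + X]big1 ?addr0; last first.
  move=> b _; rewrite big1 // => d _; case: ifP => // _.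
  by rewrite {1}/g ltnn !mul0r.
apply: eq_bigr => a _; rewrite big_ord_recr /= [X in _ + X]big1 ?addr0; last first.
  by move=> d _; case: ifP => // _; rewrite {2}/g ltnn mulr0 mul0r.
apply: eq_bigr => b _; rewrite big_ord_recr /= [X in _ + X](_ : _ = 0) ?addr0; last first.
  by case: ifP => // _; rewrite {3}/g ltnn mulr0.
apply: eq_bigr => d _; case: ifP => // _.
have hk (x : 'I_k.+1) : (x <= k)%N by rewrite -ltnS.
by rewrite /g !hk.
Qed.

Lemma lpol_PII : Dm 2 (Dm 1 lpol) = 2 * lpol ^+ 3 + ft F * lpol - fk F.
Proof.
apply: fpsP => -[|k].
  rewrite Dm_coef fpsBE fpsDE fpsM0 !exprS expr0 mulr1 !fpsM0 lpol0 fkE ft_const /= /pv.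
  by rewrite [(2 : S) 0%N](_ : _ = 2) //; ring.
rewrite Dm_coef Dm_coef fpsBE fpsDE.
rewrite fkE /= subr0 ft_const fconst_mul.
have -> : (2 * lpol ^+ 3) k.+1 = 2 * (lpol ^+ 3) k.+1.
  by rewrite -(rmorph_nat (@fconst B)) fconst_mul.
rewrite cube_coef lpol0.
have h := lpolE k.+1; rewrite /lstep in h.
set s := \sum_(a < _) _ in h *.
have {}h : (if k is k2.+1 then Dpol 2 (Dpol 1 (lpol k2)) else 0) = lpol k.+1 + 2 * s.
  by rewrite h subrK.
transitivity (lpol k.+1 + 2 * s); last by ring.
rewrite -h; case: k {s h} => [|k] //.
by rewrite /Dpol deriv0 !mulr0 addr0.
Qed.

Definition Qpol (l : nat -> B) (k : nat) : B := 6 * \sum_(a < k.+1) l a * l (k - a)%N.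
Definition rstep (f : nat -> B) (k : nat) : B :=
  if k is k1.+1 then
    (2^-1)%:P * (Qpol lpol k - Dpol 1 (f k1)
      - \sum_(i < k) (if (i : nat) == 0%N then 0 else f i * f (k - i)%N))
  else 1.
Definition rpol : S := causal_fix 0 rstep.
Lemma rpolE k : rpol k = rstep rpol k.
Proof.
apply: causal_fixE => {}k f g h; rewrite /rstep.
case: k h => // k h; rewrite h //; congr (_ * (_ - _)).
apply: eq_bigr => i _; case: eqP => // /eqP hi.
by rewrite !h // ltn_subLR ?(ltnW (ltn_ord i)) // -[X in (X < _)%N]add0n ltn_add2r lt0n.
Qed.
Lemma rpol0 : rpol 0%N = 1. Proof. by rewrite rpolE. Qed.

Lemma rpol_Riccati : rpol ^+ 2 + Dm 1 rpol = 6 * lpol ^+ 2 + ft F.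
Proof.
have s2 k : (6 * lpol ^+ 2) k = Qpol lpol k.
  by rewrite -(rmorph_nat (@fconst B)) fconst_mul expr2 fpsME.
apply: fpsP => -[|k].
  rewrite !fpsDE Dm_coef s2 /Qpol big_ord1 expr2 fpsM0 rpol0 subn0 lpol0 ft_const /=; ring.
rewrite !fpsDE Dm_coef s2 ft_const /= addr0 expr2 fpsME big_ord_recl big_ord_recr /= subn0 subnn rpol0.
have h := rpolE k.+1; rewrite /rstep big_ord_recl add0r in h.
rewrite /bump /= !add1n mul1r mulr1.
set s := \sum_(i < k) _ in h.
have -> : \sum_(i < k) rpol (bump 0 i) * rpol (k.+1 - bump 0 i)%N = s by [].
have hh : 2 * (2^-1)%:P = 1 :> B.
  by rewrite -polyC_natr -polyCM mulfV ?pnatr_eq0.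
have {}h : 2 * rpol k.+1 = Qpol lpol k.+1 - Dpol 1 (rpol k) - s.
  by rewrite h mulrA hh mul1r.
transitivity (2 * rpol k.+1 + s + Dpol 1 (rpol k)); first by ring.
by rewrite h; ring.
Qed.

(** The roots 0, 1/2, - 1/2 of v = w (1 - 4 w^2) are the points where l and r are evaluated; a
    factor v^2 is what dividing by [pa] requires. *)
Definition vdvd (n : nat) (q : B) := exists p, q = pv ^+ n * p.
Lemma vdvd0 n : vdvd n 0. Proof. by exists 0; rewrite mulr0. Qed.
Lemma vdvdD n p q : vdvd n p -> vdvd n q -> vdvd n (p + q).
Proof. by move=> [a ->] [b ->]; exists (a + b); rewrite mulrDr. Qed.
Lemma vdvdN n p : vdvd n p -> vdvd n (- p).
Proof. by move=> [a ->]; exists (- a); rewrite mulrN. Qed.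
Lemma vdvdMl n p q : vdvd n p -> vdvd n (q * p).
Proof. by move=> [a ->]; exists (q * a); rewrite mulrCA. Qed.
Lemma vdvdM m n p q : vdvd m p -> vdvd n q -> vdvd (m + n) (p * q).
Proof. by move=> [a ->] [b ->]; exists (a * b); rewrite exprD; ring. Qed.
Lemma vdvdW m n p : (m <= n)%N -> vdvd n p -> vdvd m p.
Proof. by move=> h [a ->]; exists (pv ^+ (n - m) * a); rewrite mulrA -exprD subnKC. Qed.
Lemma vdvd_sum n (I : finType) (G : I -> B) :
  (forall i, vdvd n (G i)) -> vdvd n (\sum_i G i).
Proof. by move=> h; apply: big_ind => //; [apply: vdvd0|apply: vdvdD]. Qed.
Lemma vdvd_Dpol1 m q : vdvd 1 (Dpol m q).
Proof. by exists ((3%:R * 2^-1)%:P * pv * q^`() + m%:P * (2^-1)%:P * (12%:R * 'X^2 - 1) * q); rewrite /Dpol /pa /pb; ring. Qed.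
Lemma vdvd_Dpol2 m q : vdvd 1 q -> vdvd 2 (Dpol m q).
Proof.
move=> [p ->]; rewrite expr1 /Dpol /pa /pb.
exists ((3%:R * 2^-1)%:P * (pv * p)^`() + m%:P * (2^-1)%:P * (12%:R * 'X^2 - 1) * p).
ring.
Qed.

Lemma vdvd_lpol k : vdvd 2 (lpol k.+1).
Proof.
elim/ltn_ind: k => k IH; rewrite lpolE /lstep.
apply: vdvdD; first by case: k {IH} => [|k]; [apply: vdvd0|apply/vdvd_Dpol2/vdvd_Dpol1].
apply/vdvdN/vdvdMl; do 3 (apply: vdvd_sum => ?).
case: ifP => [/eqP e|_]; last exact: vdvd0.
match goal with |- vdvd 2 (lpol (nat_of_ord ?a) * lpol (nat_of_ord ?b) * lpol (nat_of_ord ?d)) =>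
  move: (ltn_ord a) (ltn_ord b) (ltn_ord d) e; move: (nat_of_ord a) (nat_of_ord b) (nat_of_ord d) end.
move=> a b d ha hb hd e.
(* As d < k.+1 = a + b + d, one of a and b is positive, and the induction hypothesis applies to
   it. *)
case: a ha e => [|a] ha e.
  case: b hb e => [|b] hb e; first by rewrite !add0n in e; rewrite e ltnn in hd.
  by rewrite mulrC; apply/vdvdMl/vdvdMl/IH.
by rewrite -mulrA mulrC; apply/vdvdMl/IH.
Qed.

Lemma lpol1 : lpol 1%N = 0.
Proof. by rewrite lpolE /lstep /= !big_ord1 /= mulr0 subr0. Qed.

Lemma vdvd_Qpol k : vdvd 2 (Qpol lpol k.+1).
Proof.
apply/vdvdMl/vdvd_sum => -[[|a] ha] /=; first by rewrite subn0; apply/vdvdMl/vdvd_lpol.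
by rewrite mulrC; apply/vdvdMl/vdvd_lpol.
Qed.

Lemma rpol1 : rpol 1%N = - ((2^-1)%:P * pb).
Proof.
rewrite rpolE /rstep /= big_ord1 /= subr0 /Qpol !big_ord_recl big_ord0 /= lpol1 mulr0 mul0r.
by rewrite rpol0 /Dpol -polyC1 derivC; ring.
Qed.

Lemma vdvd_rpol1 k : vdvd 1 (rpol k.+1).
Proof.
elim/ltn_ind: k => k IH; rewrite rpolE /rstep.
apply/vdvdMl/vdvdD; first apply: vdvdD.
- exact: vdvdW (vdvd_Qpol k).
- exact/vdvdN/vdvd_Dpol1.
apply/vdvdN/vdvd_sum => -[[|i] hi] /=; first exact: vdvd0.
by rewrite mulrC; apply/vdvdMl/IH.
Qed.

(** [Dpol] doubles a factor v and each product has two factors of positive index. The coefficient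
    r_1 has only one factor v: it is the term - fhf * fbet set apart in [rpol_Ppol]. *)
Lemma vdvd_rpol2 k : vdvd 2 (rpol k.+2).
Proof.
rewrite rpolE /rstep.
apply/vdvdMl/vdvdD; first apply: vdvdD.
- exact: vdvd_Qpol.
- exact/vdvdN/vdvd_Dpol2/vdvd_rpol1.
apply/vdvdN/vdvd_sum => -[[|i] hi] /=; first exact: vdvd0.
by rewrite subSS subSn //; apply: (vdvdM (vdvd_rpol1 _) (vdvd_rpol1 _)).
Qed.

Definition prim (q : B) : B := \poly_(i < (size q).+1) (if i is j.+1 then q`_j / j.+1%:R else 0).
Lemma prim_deriv q : (prim q)^`() = q.
Proof.
apply/polyP => i; rewrite coef_deriv coef_poly ltnS.
case: ltnP => h; last by rewrite mul0rn nth_default.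
by rewrite -[LHS]mulr_natr divfK // pnatr_eq0.
Qed.
Lemma prim_0 q : (prim q).[0] = 0.
Proof. by rewrite horner_coef0 coef_poly. Qed.

(* [rpol k.+2] = (3/2) w^2 u^2 Ppol'(k+1): the Voros integrand is exact, its primitive Ppol
   vanishing at w = 0. *)
Definition Ppol : S := fun k =>
  if k is k1.+1 then prim (rpol k1.+2 %/ pa) else 0.
Lemma pv_neq0 : pv != 0.
Proof.
rewrite mulf_neq0 ?polyX_eq0 //.
apply/eqP => /(congr1 (fun q : B => q.[0])) /eqP.
by rewrite hornerD hornerN hornerM hornerXn expr0n mulr0 subr0 -polyC1 !hornerC oner_eq0.
Qed.
Lemma pa_neq0 : pa != 0.
Proof.
rewrite mulf_neq0 ?expf_neq0 ?pv_neq0 //.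
by rewrite polyC_eq0 mulf_neq0 ?invr_eq0 ?pnatr_eq0.
Qed.
Lemma Ppol_deriv k : rpol k.+2 = pa * (Ppol k.+1)^`().
Proof.
rewrite /Ppol prim_deriv mulrC divpK // /pa.
have [p ->] := vdvd_rpol2 k.
have e : (3%:R * 2^-1 : F) != 0 by rewrite mulf_neq0 ?invr_eq0 ?pnatr_eq0.
by rewrite mul_polyC dvdpZl // dvdp_mulr.
Qed.
Lemma rpol_Ppol : rpol = 1 - fhf F * fbet F + Dm 0 Ppol.
Proof.
apply: fpsP => k; rewrite fpsDE fpsBE Dm_coef fps1E fbetE fbh_const.
rewrite mulrCA /fhf /fcst -rmorphM /= feps_mul.
case: k => [|[|k]] /=; first by rewrite rpol0 subr0 addr0.
  by rewrite rpol1 /Dpol deriv0; ring.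
transitivity (Dpol 0 (Ppol k.+1)); last by rewrite subr0 add0r.
by rewrite Ppol_deriv /Dpol polyC0 !mul0r addr0.
Qed.

Lemma pv_0 : pv.[0] = 0. Proof. by rewrite hornerM hornerX mul0r. Qed.
Lemma pv_half : pv.[2^-1] = 0.
Proof.
rewrite hornerM hornerD hornerN hornerM hornerXn hornerX -polyC_natr -polyC1 !hornerC.
have e : 2^-1 * 2 = 1 :> F by rewrite mulVf ?pnatr_eq0.
transitivity (2^-1 * (1 - (2^-1 * 2) ^+ 2) : F); first by ring.
by rewrite e; ring.
Qed.
Lemma vdvd_root x k q : pv.[x] = 0 -> (0 < k)%N -> vdvd k q -> q.[x] = 0.
Proof. by move=> h hk [p ->]; rewrite hornerM horner_exp h expr0n eqn0Ngt hk mul0r. Qed.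
Lemma ev_lpol x : pv.[x] = 0 -> ev x lpol = fconst x.
Proof.
move=> h; apply: fpsP => -[|k]; rewrite /ev; first by rewrite lpol0 hornerX.
by rewrite (vdvd_root h _ (vdvd_lpol k)).
Qed.
Lemma ev_rpol x : pv.[x] = 0 -> ev x rpol = 1.
Proof.
move=> h; apply: fpsP => -[|k]; rewrite /ev fps1E; first by rewrite rpol0 -polyC1 hornerC.
by rewrite (vdvd_root h _ (vdvd_rpol1 k)).
Qed.
Lemma ev_Ppol0 : ev 0 Ppol = 0.
Proof. by apply: fpsP => -[|k]; rewrite /ev /= ?horner0 ?prim_0. Qed.

Lemma voros_difference_equation (W := ev 2^-1 Ppol) :
  (1 + fconst 2^-1 * feps F) *
    (opser (@psif F) (@Xop F) (feps F) - Xop (opser (@expf F) (@Xop F) W - W)) = feps F.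
Proof.
apply: (difference_equation lpol0 lpol_PII rpol0 rpol_Riccati rpol_Ppol ev_Ppol0).
- by rewrite (ev_lpol pv_0) rmorph0.
- exact: ev_lpol pv_half.
- exact: ev_rpol pv_half.
Qed.

Lemma Dpol_odd m q : (Dpol m q) \Po (- 'X) = - Dpol m (q \Po (- 'X)).
Proof.
have e : pv \Po (- 'X) = - pv.
  rewrite /pv rmorphM rmorphB rmorph1 rmorphM rmorphXn rmorph_nat /= comp_polyX; ring.
have ea : pa \Po (- 'X) = pa by rewrite /pa expr2 comp_polyM (comp_polyM pv) comp_polyC e; ring.
have eb : pb \Po (- 'X) = - pb.
  rewrite /pb (comp_polyM (_ * pv)) (comp_polyM _ pv) e -polyC_natr -polyC1 comp_polyB !comp_polyM !comp_polyC comp_polyX; ring.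
rewrite /Dpol deriv_comp derivN derivX comp_polyD (comp_polyM pa) (comp_polyM (m%:P * pb)) (comp_polyM m%:P) ea eb comp_polyC; ring.
Qed.
Lemma Dpol_sign m n q : Dpol m ((-1) ^+ n * q) = (-1) ^+ n * Dpol m q.
Proof.
rewrite -signr_odd; case: (odd n); rewrite ?expr1 ?expr0 ?mulN1r ?mul1r //.
by rewrite /Dpol derivN; ring.
Qed.
Lemma DpolD m p q : Dpol m (p + q) = Dpol m p + Dpol m q.
Proof. by rewrite /Dpol derivD; ring. Qed.
Lemma DpolM m m' p q : Dpol (m + m') (p * q) = Dpol m p * q + p * Dpol m' q.
Proof. by rewrite /Dpol derivM polyCD; ring. Qed.
(** On the surface - v = c / s^3, and c is constant in t. *)
Lemma Dpol_pv m q : Dpol (m + 3%:R) (- pv * q) = - pv * Dpol m q.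
Proof.
have e : Dpol 3%:R pv = 0.
  by have := Dm_k F; rewrite fkE => /(congr1 (fun f : S => f 1%N)); rewrite Dm_coef.
rewrite mulNr -mulN1r -[-1]expr1 Dpol_sign addrC DpolM e mul0r add0r.
by rewrite expr1 mulN1r mulNr.
Qed.
Lemma half_poly : (2^-1)%:P * 2 = 1 :> {poly F}.
Proof. by rewrite -polyC_natr -polyCM mulVf ?pnatr_eq0. Qed.
(** This and the next three lemmas are the t-derivatives of lambda_0, s, 1 / s and 1 / Delta; the
    left-hand sides keep the shape that [Rel_mul] and [Rel_shift] produce in [Rel_base]. *)
Lemma Dpol_x : - pv * ((-1)%:P * ('X * 1)) = Dpol 1 'X.
Proof.
have h := half_poly.
rewrite /Dpol derivX /pa /pb polyC1 polyCN polyC1 polyCM polyC_natr.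
transitivity ((((2^-1)%:P * 2)) * (pv * 'X)); first by rewrite h; ring.
by rewrite /pv; ring.
Qed.
Lemma Dpol_s : - pv * ((2^-1)%:P * 1 + (- 6%:R)%:P * ('X * 'X * (1 * 1))) = Dpol 1 1.
Proof.
have h := half_poly.
rewrite /Dpol -[in RHS]polyC1 derivC /pa /pb !polyCN polyC1 polyC_natr.
transitivity (- pv * ((2^-1)%:P + - ((2^-1)%:P * 2) * 6 * ('X * 'X))); first by rewrite h; ring.
by ring.
Qed.
Lemma Dpol_v : - pv * ((- 2^-1)%:P * (1 * (1 * 1)) + (6%:R)%:P * ('X * 'X * (1 * (1 * 1) * 1))) = Dpol (-1) 1.
Proof.
have h := half_poly.
rewrite /Dpol -[in RHS]polyC1 derivC /pa /pb !polyCN polyC1 polyC_natr.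
transitivity (- pv * (- (2^-1)%:P + ((2^-1)%:P * 2) * 6 * ('X * 'X))); first by rewrite h; ring.
by ring.
Qed.
Lemma Dpol_y : - pv * ((12%:R)%:P * ('X * 'X * (1 * (1 * 1))) + (-1)%:P * (1 * 1)) = Dpol (- 2%:R) 1.
Proof.
have h := half_poly.
rewrite /Dpol -[in RHS]polyC1 derivC /pa /pb !polyCN polyC1 !polyC_natr.
transitivity (((2^-1)%:P * 2) * - pv * (12 * 'X ^+ 2 - 1)); first by rewrite h; ring.
by ring.
Qed.
Lemma DpolN m q : Dpol m (- q) = - Dpol m q.
Proof. by rewrite -mulN1r -[-1]expr1 Dpol_sign expr1 mulN1r. Qed.
(** The change w -> - w is the passage to the sheet - s; each [Dpol] contributes one sign. *)
Lemma lpol_odd k : lpol k \Po (- 'X) = (-1) ^+ k.+1 * lpol k.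
Proof.
elim/ltn_ind: k => -[|k] IH; first by rewrite lpol0 comp_polyX expr1 mulN1r.
rewrite (lpolE k.+1) /lstep rmorphB rmorphM rmorph_nat mulrBr; congr (_ - _).
  case: k IH => [|k] IH; first by rewrite /= comp_poly0 mulr0.
  by rewrite /= !Dpol_odd IH // !(DpolN, Dpol_sign) !exprS; ring.
rewrite mulrCA; congr (_ * _); rewrite raddf_sum mulr_sumr; apply: eq_bigr => a _.
rewrite raddf_sum mulr_sumr; apply: eq_bigr => b _.
rewrite raddf_sum mulr_sumr; apply: eq_bigr => d _.
case: ifP => [/eqP e|_]; last by rewrite mulr0 /= comp_poly0.
rewrite /= !comp_polyM !IH //.
transitivity ((-1) ^+ (a.+1 + b.+1 + d.+1) * (lpol a * lpol b * lpol d)).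
  by rewrite !exprD; ring.
by rewrite !(addSn, addnS) e -[in RHS]signr_odd -signr_odd /= negbK.
Qed.

Lemma Qpol_odd k : Qpol lpol k \Po (- 'X) = (-1) ^+ k * Qpol lpol k.
Proof.
rewrite /Qpol -polyC_natr comp_polyM comp_polyC mulrCA; congr (_ * _).
rewrite (raddf_sum (comp_poly (- 'X))) mulr_sumr; apply: eq_bigr => a _.
rewrite /= comp_polyM !lpol_odd.
transitivity ((-1) ^+ (a.+1 + (k - a).+1) * (lpol a * lpol (k - a)%N)); first by rewrite exprD; ring.
rewrite addSn addnS subnKC; last by rewrite -ltnS.
by rewrite -signr_odd -[in RHS]signr_odd /= negbK.
Qed.
Lemma rpol_odd k : rpol k \Po (- 'X) = (-1) ^+ k * rpol k.
Proof.
elim/ltn_ind: k => -[|k] IH; first by rewrite rpol0 mul1r -polyC1 comp_polyC.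
pose s := \sum_(i < k.+1) (if (i : nat) == 0%N then 0 else rpol i * rpol (k.+1 - i)%N).
have es : s \Po (- 'X) = (-1) ^+ k.+1 * s.
  rewrite /s (raddf_sum (comp_poly (- 'X))) mulr_sumr; apply: eq_bigr => -[i hi] _ /=.
  case: eqP => [_|/eqP hi0]; first by rewrite comp_poly0 mulr0.
  have hki : (k.+1 - i < k.+1)%N by rewrite ltn_subrL lt0n hi0.
  rewrite comp_polyM !IH //.
  transitivity ((-1) ^+ (i + (k.+1 - i)) * (rpol i * rpol (k.+1 - i)%N)); first by rewrite exprD; ring.
  by rewrite subnKC // ltnW.
rewrite rpolE /rstep -/s comp_polyM 2!comp_polyB comp_polyC Qpol_odd Dpol_odd IH // Dpol_sign es.
by rewrite !exprS; ring.
Qed.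

(** The second Painleve equation contains hbar only through hbar^2, so the recursion links indices
    of equal parity and starts at 0. *)
Lemma lpol_odd_eq0 k : odd k -> lpol k = 0.
Proof.
elim/ltn_ind: k => -[|k] IH // hk; rewrite lpolE /lstep [X in X - _](_ : _ = 0) ?sub0r; last first.
  case: k IH hk => [|k] IH //= hk.
  by rewrite IH ?negbK //; [rewrite /Dpol !(deriv0, mulr0, addr0)|rewrite /= negbK in hk].
apply/eqP; rewrite oppr_eq0; apply/eqP; rewrite big1 ?mulr0 // => a _.
rewrite big1 // => b _; rewrite big1 // => d _; case: ifP => // /eqP e.
have := congr1 odd e; rewrite hk !oddD.
case ha : (odd a); first by rewrite (IH a) // !mul0r.
case hb' : (odd b); first by rewrite (IH b) // mulr0 mul0r.
by case hd : (odd d) => // _; rewrite (IH d) // mulr0.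
Qed.
Lemma Qpol_odd_eq0 k : odd k -> Qpol lpol k = 0.
Proof.
move=> hk; rewrite /Qpol big1 ?mulr0 // => -[a ha] _ /=.
case oa : (odd a); first by rewrite lpol_odd_eq0 // mul0r.
by rewrite (@lpol_odd_eq0 (k - a)) ?mulr0 // oddB ?hk ?oa.
Qed.

(* The two solutions of the Riccati equation, with leading term +s and -s: only the terms
   with even index change sign. *)
Definition rsgn (sg : bool) (k : nat) : B := (-1) ^+ (sg && ~~ odd k) * rpol k.
(** At even index all the signs agree. At odd index the derivative and the products change sign
    together, while Q would not, but there it vanishes. *)
Lemma rsgnE sg k : rsgn sg k.+1 =
  (-1) ^+ sg * ((2^-1)%:P * (Qpol lpol k.+1 - Dpol 1 (rsgn sg k)
      - \sum_(i < k.+1) (if (i : nat) == 0%N then 0 else rsgn sg i * rsgn sg (k.+1 - i)%N))).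
Proof.
rewrite /rsgn; case: sg => /=; last first.
  rewrite !mul1r {1}rpolE /rstep; congr (_ * (_ - _)).
  by apply: eq_bigr => i _; case: ifP => //; rewrite !mul1r.
rewrite {1}rpolE /rstep Dpol_sign.
have -> : \sum_(i < k.+1) (if (i : nat) == 0%N then 0 else
    (-1) ^+ (~~ odd i) * rpol i * ((-1) ^+ (~~ odd (k.+1 - i)) * rpol (k.+1 - i)%N)) =
  (-1) ^+ odd k.+1 * \sum_(i < k.+1) (if (i : nat) == 0%N then 0 else rpol i * rpol (k.+1 - i)%N).
  rewrite mulr_sumr; apply: eq_bigr => i _; case: ifP => //; first by rewrite mulr0.
  move=> _; rewrite mulrACA -signr_addb oddB; last by apply: ltnW.
  by congr (_ * _); case: (odd k.+1) (odd i) => [] [].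
rewrite /= !negbK; case hk : (odd k) => /=.
  rewrite !expr1 !expr0; ring.
have -> : Qpol lpol k.+1 = 0 by rewrite Qpol_odd_eq0 //= hk.
by rewrite !expr1 !expr0; ring.
Qed.

Lemma deriv_eq0 (p : B) : p^`() = 0 -> p.[0] = 0 -> p = 0.
Proof.
move=> h h0; apply/polyP => -[|i]; first by rewrite -horner_coef0 h0 coef0.
have := congr1 (fun q : B => q`_i) h; rewrite coef_deriv !coef0 => /eqP.
by rewrite mulrn_eq0 => /orP [//|/eqP].
Qed.
(** For even k the derivative is even and the primitive vanishes at 0. Hence both ends w = 1/2 and w
    = - 1/2 contribute equally, which absorbs the factor 1/2 in W. *)
Lemma Ppol_odd k : ~~ odd k -> Ppol k.+1 \Po (- 'X) = - Ppol k.+1.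
Proof.
move=> hk; apply/eqP; rewrite -addr_eq0; apply/eqP/deriv_eq0; last first.
  by rewrite hornerD horner_comp hornerN hornerX oppr0 /Ppol prim_0 addr0.
rewrite derivD deriv_comp derivN derivX; apply: (mulfI pa_neq0).
have e : pv \Po (- 'X) = - pv.
  rewrite /pv rmorphM rmorphB rmorph1 rmorphM rmorphXn rmorph_nat /= comp_polyX; ring.
have ea : pa \Po (- 'X) = pa by rewrite /pa expr2 comp_polyM (comp_polyM pv) comp_polyC e; ring.
rewrite mulrDr mulrA -{1}ea -comp_polyM -!Ppol_deriv rpol_odd -signr_odd /= negbK (negbTE hk).
by ring.
Qed.
Lemma Ppol_half_odd k : ~~ odd k -> (Ppol k.+1).[- 2^-1] = - (Ppol k.+1).[2^-1].
Proof.
by move=> hk; rewrite -hornerN -(Ppol_odd hk) horner_comp hornerN hornerX.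
Qed.
End Coefficients.

(** * The formal Bernoulli series *)

Section BernoulliSeries.
Variable F : numFieldType.

(* w / (e^w - 1) = sum bern_k w^k *)
Definition bern : fps F := causal_fix 0 (fun f k =>
  (k == 0)%:R - \sum_(i < k) f i * psif F (k - i)).
Lemma bernE k : bern k = (k == 0)%:R - \sum_(i < k) bern i * psif F (k - i).
Proof.
apply: (@causal_fixE F 0 (fun (f : nat -> F) k =>
  (k == 0)%:R - \sum_(i < k) f i * psif F (k - i))) => {}k f g h.
by congr (_ - _); apply: eq_bigr => i _; rewrite h.
Qed.
Lemma bern_psif : bern * @psif F = 1.
Proof.
apply: fpsP => k; rewrite fps1E fpsME big_ord_recr /= subnn /psif factS fact0 invr1 mulr1.
by rewrite [X in _ + X]bernE addrC subrK.
Qed.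
Lemma psif_le n : psif F n <= 2^-1 ^+ n.
Proof.
rewrite /psif exprVn lef_pV2 ?posrE ?ltr0n ?fact_gt0 ?exprn_gt0 //.
rewrite -natrX ler_nat; elim: n => // n IH.
by rewrite expnS factS leq_mul.
Qed.
(** As (n + 1)! >= 2^n, the recursion is dominated by a geometric sum of ratio 1/2 that stays below
    1. The bound provides a radius of convergence of at least 1. *)
Lemma bern_le n : `|bern n| <= 1.
Proof.
elim/ltn_ind: n => n IH; rewrite bernE; case: n IH => [|n] IH.
  by rewrite big_ord0 subr0 normr1.
rewrite sub0r normrN.
have hs m : \sum_(i < m) (2^-1 : F) ^+ (m - i) <= 1 - 2^-1 ^+ m.
  elim: m => [|m IHm]; first by rewrite big_ord0 expr0 subrr.
  rewrite big_ord_recr /= subSnn expr1.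
  have -> : \sum_(i < m) (2^-1 : F) ^+ (m.+1 - i) = 2^-1 * \sum_(i < m) 2^-1 ^+ (m - i).
    by rewrite mulr_sumr; apply: eq_bigr => i _; rewrite subSn ?exprS // ltnW.
  have h2 : (2^-1 : F) + 2^-1 = 1 by rewrite -mulr2n -[_ *+ 2]mulr_natr mulVf ?pnatr_eq0.
  apply: le_trans (_ : 2^-1 * (1 - 2^-1 ^+ m) + 2^-1 <= _).
    by rewrite lerD2r ler_wpM2l // invr_ge0 ler0n.
  by rewrite mulrBr mulr1 addrAC h2 exprS.
apply: le_trans (ler_norm_sum _ _ _) _.
apply: le_trans (le_trans _ (hs n.+1)) _; last by rewrite gerBl exprn_ge0 // invr_ge0 ler0n.
apply: ler_sum => i _; rewrite normrM -[leRHS]mul1r.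
have p0 : 0 <= psif F (n.+1 - i) by rewrite invr_ge0 ler0n.
by rewrite ler_pM ?normr_ge0 ?IH // ger0_norm ?psif_le.
Qed.
End BernoulliSeries.

(** * Solution of the difference equation by symbolic calculus in d/da *)

Section VorosSeries.
Variable F : numFieldType.
Notation SF := (fps F).
Notation X := (@Xop F).
Notation e := (feps F).

Lemma raises_opser_lead (a : nat -> F) Delta (q : SF) n : raises Delta -> vanish n q ->
  opser a Delta q n = a 0%N * q n.
Proof.
move=> hr hv; rewrite /opser big_ord_recl /= big1 ?addr0 // => i _.
have h : forall m, vanish (n + m) (iter m Delta q).
  by elim=> [|m IH]; [rewrite addn0|rewrite addnS; apply: hr].
by rewrite -iterS (h i.+1) ?mulr0 // addnS ltnS leq_addr.
Qed.

Lemma Xop_coef (q : SF) k : X q k = if k is k'.+1 then - (q k' *+ k') else 0.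
Proof. by rewrite /Xop fpsNE feps_mul; case: k => // ; rewrite oppr0. Qed.

Lemma opser_XopM (a b : SF) (q : SF) : opser a X (opser b X q) = opser (a * b) X q.
Proof.
apply: opser_comp; [exact: Xop_raises|exact: XopD|].
by move=> n f; apply: Xop_const.
Qed.
Lemma opser_e q : opser e X q = X q.
Proof.
apply: fpsP => -[|k]; rewrite /opser; first by rewrite big_ord1 /= mul0r Xop_coef.
by rewrite !big_ord_recl /= mul0r add0r mul1r big1 ?addr0 // => i _; rewrite mul0r.
Qed.
Lemma opserDl (a b : SF) q : opser (a + b) X q = opser a X q + opser b X q.
Proof.
apply: fpsP => k; rewrite fpsDE /opser -big_split; apply: eq_bigr => i _.
by rewrite fpsDE mulrDl.
Qed.
Lemma opserNl (a : SF) q : opser (- a) X q = - opser a X q.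
Proof.
apply: fpsP => k; rewrite fpsNE /opser -sumrN; apply: eq_bigr => i _.
by rewrite fpsNE mulNr.
Qed.
Lemma opser_XopD (a : SF) (p q : SF) : opser a X (p + q) = opser a X p + opser a X q.
Proof. exact/opserD/XopD. Qed.

Lemma opser_inj (a : SF) (q : SF) : a 0%N != 0 -> opser a X q = 0 -> q = 0.
Proof.
move=> ha h; apply: vanish_eq0; elim=> // n IH k; rewrite ltnS leq_eqVlt => /predU1P [->|]; last exact: IH.
have := raises_opser_lead a (@Xop_raises F) IH; rewrite h => /esym /eqP.
by rewrite mulf_eq0 (negbTE ha) => /eqP.
Qed.
Lemma Xop_inj (q : SF) : q 0%N = 0 -> X q = 0 -> q = 0.
Proof.
move=> h0 h; apply: fpsP => -[|k] //.
have := congr1 (fun p : SF => p k.+2) h; rewrite Xop_coef fps0E => /eqP.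
by rewrite oppr_eq0 mulrn_eq0 => /orP [|/eqP].
Qed.

Lemma expf0 : expf F 0 = 1. Proof. by rewrite /expf fact0 invr1. Qed.
Lemma expf_psif : (@expf F : SF) = 1 + e * @psif F.
Proof.
apply: fpsP => k; rewrite fpsDE feps_mul fps1E.
by case: k => [|k]; rewrite ?expf0 ?addr0 // add0r.
Qed.

(* In the variable w: expf is e^w, psif is (e^w - 1) / w, half is e^(w/2), sc f is f(w/2). *)
Definition half : SF := fun n => (2^-1) ^+ n * expf F n.
Definition sc (f : SF) : SF := fun n => f n * (2^-1) ^+ n.
Lemma scM f g : sc (f * g) = sc f * sc g.
Proof.
apply: fpsP => k; rewrite /sc !fpsME mulr_suml; apply: eq_bigr => i _.
have hi : (i <= k)%N by rewrite -ltnS.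
have -> : (2^-1 : F) ^+ k = 2^-1 ^+ i * 2^-1 ^+ (k - i) by rewrite -exprD subnKC.
by ring.
Qed.
Lemma expf_bin n i : (i <= n)%N -> expf F i * expf F (n - i)%N = 'C(n, i)%:R * expf F n.
Proof.
move=> h; rewrite /expf.
have e1 : n`!%:R = 'C(n, i)%:R * (i`!%:R * (n - i)`!%:R) :> F.
  by rewrite -!natrM bin_fact.
have n0 m : m`!%:R != 0 :> F by rewrite pnatr_eq0 -lt0n fact_gt0.
apply: (mulIf (n0 n)); rewrite -[RHS]mulrA mulVf // mulr1 e1.
by rewrite -invfM [X in _ * X]mulrC mulrA mulVf ?mul1r // mulf_neq0.
Qed.
Lemma half_half : half * half = @expf F.
Proof.
apply: fpsP => n; rewrite fpsME.
under eq_bigr => i _.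
  have hi : (i <= n)%N by rewrite -ltnS.
  rewrite /half mulrACA expf_bin // -exprD subnKC // mulrCA.
  over.
rewrite -mulr_suml -natr_sum.
have -> : (\sum_(i < n.+1) 'C(n, i) = 2 ^ n)%N.
  have := Pascal 1 1 n; rewrite addn1 => ->.
  by apply: eq_bigr => i _; rewrite !exp1n !muln1.
rewrite natrX mulrA -exprMn mulfV ?pnatr_eq0 // expr1n mul1r //.
Qed.
Lemma half0 : half 0%N = 1. Proof. by rewrite /half expr0 mul1r expf0. Qed.
Lemma half_sc : 2 * (half - 1) = e * sc (@psif F).
Proof.
apply: fpsP => k; rewrite -fconst_nat fconst_mul fpsBE feps_mul fps1E.
case: k => [|k]; first by rewrite half0 subrr mulr0.
rewrite subr0 /half /sc exprS -[psif F k]/(expf F k.+1) mulrA mulrA mulfV ?pnatr_eq0 //.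
by rewrite mul1r mulrC.
Qed.
Lemma feps_inj (f g : SF) : e * f = e * g -> f = g.
Proof.
move=> h; apply: fpsP => k; have := congr1 (fun p : SF => p k.+1) h.
by rewrite !feps_mul.
Qed.
Lemma psif_half : 2 * (@psif F : SF) = sc (@psif F) * (1 + half).
Proof.
apply: feps_inj.
transitivity (2 * ((@expf F : SF) - 1)); first by rewrite expf_psif; ring.
by rewrite mulrA -half_sc -half_half; ring.
Qed.

Variable b : SF.
Hypothesis hb : b * @psif F = 1.

(** The series w e^(w/2) / (e^w - 1), which generates B_n(1/2) / n!. *)
Definition bern_mid : SF := 2 * sc b - b.
Lemma psif0 : psif F 0 = 1. Proof. by rewrite /psif factS fact0 invr1. Qed.
Lemma b0 : b 0%N = 1.
Proof. by have := congr1 (fun p : SF => p 0%N) hb; rewrite fpsM0 psif0 mulr1. Qed.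
Lemma bern_mid_psif : bern_mid * @psif F = half.
Proof.
have hs : sc b * sc (@psif F) = 1.
  rewrite -scM hb; apply: fpsP => -[|k]; rewrite /sc fps1E ?mul1r ?mul0r //.
transitivity (sc b * (2 * (@psif F : SF)) - b * @psif F); first by rewrite /bern_mid; ring.
rewrite psif_half hb mulrA hs; ring.
Qed.
Lemma bern_midE n : bern_mid n = (2 / 2 ^+ n - 1) * b n.
Proof. by rewrite /bern_mid fpsBE -fconst_nat fconst_mul /sc exprVn; ring. Qed.
Definition bern_mid2 : SF := fun n => bern_mid n.+2.
(** There is no linear term because B_1(1/2) = 0; the factor e^2 matches the two derivatives that
    act on W in the difference equation. *)
Lemma bern_mid_split : bern_mid = 1 + e ^+ 2 * bern_mid2.
Proof.
apply: fpsP => k; rewrite fpsDE fps1E expr2 -mulrA feps_mul.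
case: k => [|k]; first by rewrite bern_midE b0 expr0 divr1 mulr1 addr0 /=; ring.
rewrite feps_mul; case: k => [|k]; last by rewrite add0r.
by rewrite bern_midE expr1 mulfV ?pnatr_eq0 // subrr mul0r addr0.
Qed.

Lemma iter_Xop_e n : iter n X e = fun k => if k == n.+1 then (-1) ^+ n * n`!%:R else 0.
Proof.
elim: n => [|n IH]; first by apply: fpsP => k /=; rewrite fact0 mulr1 /feps; case: eqP.
rewrite iterS IH; apply: fpsP => -[|k]; rewrite Xop_coef // eqSS.
case: eqP => [->|_]; last by rewrite mul0rn oppr0.
by rewrite factS natrM exprS -mulr_natr; ring.
Qed.
Lemma opser_e_coef (a : SF) n : opser a X e n.+1 = a n * ((-1) ^+ n * n`!%:R).
Proof.
rewrite /opser big_ord_recr /= big_ord_recr /= big1 ?add0r; last first.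
  by move=> i _; rewrite iter_Xop_e eqSS eq_sym ltn_eqF ?mulr0.
rewrite -[X (iter _ _ _)]/(iter n.+1 X e) !iter_Xop_e eqxx ltn_eqF //.
by rewrite mulr0 addr0.
Qed.
(** The operator e^(X/2) translates a by 1/2, so it sends eps = 1 / a to 1 / (a + 1/2). *)
Lemma opser_half_e : (1 + fconst 2^-1 * e) * opser half X e = e.
Proof.
apply: fpsP => k; rewrite mulrDl mul1r -mulrA fpsDE fconst_mul feps_mul.
have P0 : opser half X e 0%N = 0 by rewrite /opser big_ord1 /= mulr0.
case: k => [|[|k]].
- by rewrite mulr0 addr0.
- by rewrite P0 mulr0 addr0 opser_e_coef half0 !mul1r.
have hk m (x : F) : expf F m * (x * m`!%:R) = x.
  by rewrite /expf mulrCA mulVf ?mulr1 // pnatr_eq0 -lt0n fact_gt0.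
rewrite !opser_e_coef /half -!mulrA !hk !exprS [feps F _](_ : _ = 0) //.
by ring.
Qed.

(** The equation becomes X^2 psif(X) W = psif(X) eps - half(X) eps. With half = bern_mid * psif the
    right side is - X^2 psif(X) bern_mid2(X) eps; cancelling psif(X) and then X twice gives W = -
    bern_mid2(X) eps. *)
Theorem solve_difference_equation (W : SF) : W 0%N = 0 ->
  (1 + fconst 2^-1 * e) * (opser (@psif F) X e - X (opser (@expf F) X W - W)) = e ->
  forall n, W n.+1 = - bern_mid n.+2 * ((-1) ^+ n * n`!%:R).
Proof.
move=> W0 h n.
have e1 : opser (@psif F) X e - X (opser (@expf F) X W - W) = opser half X e.
  have := opser_half_e; rewrite -{3}h => h'.
  apply/eqP; rewrite -subr_eq0; apply/eqP; apply: vanish_eq0.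
  set q := _ - opser half X e.
  have hq : (1 + fconst 2^-1 * e) * q = 0 by rewrite /q mulrBr h'; ring.
  elim=> // m IH k; rewrite ltnS leq_eqVlt => /predU1P [->|]; last exact: IH.
  have := congr1 (fun p : SF => p m) hq.
  by rewrite mulrC (vanishMlead _ IH) fpsDE fps1E fconst_mul /= mulr0 addr0 mulr1.
have e2 : X (opser (@expf F) X W - W) = opser (e ^+ 2 * @psif F : SF) X W.
  have P1 : opser (1 : SF) X W = W.
    apply: fpsP => k; rewrite /opser big_ord_recl /= mul1r big1 ?addr0 // => i _.
    by rewrite mul0r.
  have -> : opser (@expf F) X W - W = opser ((@expf F : SF) - 1) X W by rewrite opserDl opserNl P1.
  rewrite -opser_e opser_XopM expf_psif (_ : e * (1 + e * @psif F - 1) = e ^+ 2 * @psif F :> SF) //.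
  by ring.
have e3 : opser (e ^+ 2 * @psif F : SF) X (W + opser bern_mid2 X e) = 0.
  rewrite opser_XopD opser_XopM -e2.
  have := e1; rewrite -bern_mid_psif bern_mid_split mulrDl mul1r opserDl => h1.
  rewrite (_ : e ^+ 2 * @psif F * bern_mid2 = e ^+ 2 * bern_mid2 * @psif F); last by ring.
  by apply: (addrI (opser (@psif F) X e)); rewrite addr0 addrCA -h1; ring.
have e4 : W + opser bern_mid2 X e = 0.
  apply: Xop_inj; first by rewrite fpsDE W0 /opser big_ord1 /= mulr0 addr0.
  apply: Xop_inj; first by rewrite Xop_coef.
  apply: (@opser_inj (@psif F)); first by rewrite psif0 oner_eq0.
  rewrite -e3 -[X (X _)]opser_e -[X (W + _)]opser_e !opser_XopM.
  rewrite (_ : (@psif F : SF) * e * e = e ^+ 2 * @psif F :> SF) //; ring.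
have := congr1 (fun p : SF => p n.+1) e4.
by rewrite fpsDE opser_e_coef => /eqP; rewrite addr_eq0 mulNr => /eqP.
Qed.

Corollary Ppol_half n :
  (Ppol F n.+1).[2^-1] = - bern_mid n.+2 * ((-1) ^+ n * n`!%:R).
Proof.
apply: (solve_difference_equation (W := ev 2^-1 (Ppol F))).
  by rewrite /ev horner0.
exact: voros_difference_equation.
Qed.
End VorosSeries.

End Series.

Module Voros.

From mathcomp Require Import all_boot ssralg poly ssrnum boolp Rstruct.
From Stdlib Require Import Reals Lra Lia.
From Coquelicot Require Import Coquelicot.
Import Series Calculus.
Import GRing.Theory.
Delimit Scope ring_scope with ri.
Open Scope R_scope.

(** * Bernoulli numbers as derivatives of w / (e^w - 1) at 0 *)

Lemma psifE n : psif R n = / INR (Factorial.fact (S n)).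
Proof. by rewrite INRE factE. Qed.

Lemma PS_mult_fps (a b : fps R) n : PS_mult a b n = fps_mul a b n.
Proof.
rewrite /PS_mult sum_f_R0E /fps_mul big_mkord.
by apply: eq_bigr => i _.
Qed.

Lemma CV_radius_ge_1 (a : nat -> R) : (forall n, Rabs (a n) <= 1) -> Rbar_le 1 (CV_radius a).
Proof.
move=> h; have [hu _] := CV_radius_bounded a.
by apply: (hu 1); exists 1 => n; rewrite pow1 Rmult_1_r.
Qed.

Lemma bgen_PSeries w : Rabs w < 1 -> bgen w = PSeries (bern R) w.
Proof.
move=> hw.
have rb : Rbar_lt (Rabs w) (CV_radius (bern R)).
  apply: (Rbar_lt_le_trans _ 1) => //; apply: CV_radius_ge_1 => n.
  by have := bern_le R n; rewrite RabsE => /RleP.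
have rp : Rbar_lt (Rabs w) (CV_radius (psif R)).
  apply: (Rbar_lt_le_trans _ 1) => //; apply: CV_radius_ge_1 => n.
  rewrite psifE Rabs_pos_eq.
    rewrite -Rinv_1; apply: Rinv_le_contravar; first lra.
    by rewrite -/(INR 1); apply: le_INR; apply: Factorial.lt_O_fact.
  by apply/Rlt_le/Rinv_0_lt_compat/INR_fact_lt_0.
(* Both series converge for |w| < 1, so the formal identity [bern_psif] passes to their sums. *)
have m : PSeries (bern R) w * PSeries (psif R) w = 1.
  rewrite -PSeries_mult //.
  rewrite (PSeries_ext _ (fun n => if n is O then 1 else 0)); last first.
    move=> n; rewrite PS_mult_fps.
    have := congr1 (fun f : fps R => f n) (bern_psif R); rewrite fps1E => e.
    rewrite [LHS]e => {e}; by case: n.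
  rewrite PSeries_decr_1; last first.
    apply: CV_radius_inside; apply: (Rbar_lt_le_trans _ 1) => //; apply: CV_radius_ge_1 => -[|n].
      by rewrite Rabs_R1; lra.
    by rewrite Rabs_R0; lra.
  rewrite (PSeries_ext _ (fun=> 0)); last by case.
  by rewrite PSeries_const_0; lra.
rewrite /bgen; case: Req_EM_T => [w0|w0].
  move: m; rewrite w0 !PSeries_0 => _.
  by rewrite bernE big_ord0 /= GRing.subr0.
have e : exp w = 1 + w * PSeries (psif R) w.
  have := is_exp_Reals w => /is_pseries_unique <-.
  rewrite PSeries_decr_1; last by exists (exp w); apply: is_exp_Reals.
  rewrite /= Rinv_1; congr (_ + _ * _).
  by apply: PSeries_ext => n; rewrite psifE.
have p0 : PSeries (psif R) w <> 0 by move=> h; rewrite h in m; lra.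
rewrite e; have -> : 1 + w * PSeries (psif R) w - 1 = w * PSeries (psif R) w by ring.
rewrite -[RHS]Rmult_1_r -[1](Rinv_r (PSeries (psif R) w)) //.
rewrite -Rmult_assoc m; field; split => //.
Qed.

Lemma bernoulliE n : bernoulli n = bern R n * INR (Factorial.fact n).
Proof.
rewrite /bernoulli (Derive_n_ext_loc _ (PSeries (bern R))).
  apply: Derive_n_coef; apply: (Rbar_lt_le_trans _ 1); first by simpl; lra.
  apply: CV_radius_ge_1 => k; by have := bern_le R k; rewrite RabsE => /RleP.
exists (mkposreal 1 Rlt_0_1) => y hy; apply: bgen_PSeries.
by move: hy; rewrite /ball /= /AbsRing_ball /abs /minus /plus /opp /= Ropp_0 Rplus_0_r.
Qed.

Open Scope C_scope.

(** * Real polynomials evaluated at complex points *)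

Definition CC := C.
HB.instance Definition _ := gen_eqMixin CC.
HB.instance Definition _ := gen_choiceMixin CC.
Fact CC_addA : associative (Cplus : CC -> CC -> CC). Proof. exact: Cplus_assoc. Qed.
Fact CC_addC : commutative (Cplus : CC -> CC -> CC). Proof. exact: Cplus_comm. Qed.
Fact CC_add0 : left_id (RtoC 0 : CC) (Cplus : CC -> CC -> CC). Proof. exact: Cplus_0_l. Qed.
Fact CC_addN : left_inverse (RtoC 0 : CC) (Copp : CC -> CC) (Cplus : CC -> CC -> CC).
Proof. by move=> x; rewrite -[LHS]CC_addC; apply: Cplus_opp_r. Qed.
HB.instance Definition _ := GRing.isZmodule.Build CC CC_addA CC_addC CC_add0 CC_addN.
Fact CC_mulA : associative (Cmult : CC -> CC -> CC). Proof. exact: Cmult_assoc. Qed.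
Fact CC_mulC : commutative (Cmult : CC -> CC -> CC). Proof. exact: Cmult_comm. Qed.
Fact CC_mul1 : left_id (RtoC 1 : CC) (Cmult : CC -> CC -> CC). Proof. exact: Cmult_1_l. Qed.
Fact CC_mulDl : left_distributive (Cmult : CC -> CC -> CC) (Cplus : CC -> CC -> CC).
Proof. by move=> x y z; apply: Cmult_plus_distr_r. Qed.
Fact CC_one_neq0 : (RtoC 1 : CC) != (0%ri : CC).
Proof. by apply/eqP => h; apply: R1_neq_R0; apply: RtoC_inj. Qed.
HB.instance Definition _ := GRing.Zmodule_isComNzRing.Build CC
  CC_mulA CC_mulC CC_mul1 CC_mulDl CC_one_neq0.

Definition RC (x : R) : CC := RtoC x.
Fact RC_zmod : zmod_morphism RC.
Proof. by move=> x y; apply: RtoC_minus. Qed.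
Fact RC_monoid : monoid_morphism RC.
Proof. by split=> // x y; apply: RtoC_mult. Qed.
HB.instance Definition _ := GRing.isZmodMorphism.Build R CC RC RC_zmod.
HB.instance Definition _ := GRing.isMonoidMorphism.Build R CC RC RC_monoid.

Definition pev (p : {poly R}) (z : C) : C := ((map_poly RC p).[(z : CC)])%ri.

Lemma pevD p q z : pev (p + q)%ri z = pev p z + pev q z.
Proof. by rewrite /pev rmorphD hornerD. Qed.
Lemma pevN p z : pev (- p)%ri z = - pev p z.
Proof. by rewrite /pev rmorphN hornerN. Qed.
Lemma pevB p q z : pev (p - q)%ri z = pev p z - pev q z.
Proof. by rewrite pevD pevN. Qed.
Lemma pevM p q z : pev (p * q)%ri z = pev p z * pev q z.
Proof. by rewrite /pev rmorphM hornerM. Qed.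
Lemma pevC x z : pev (polyC x) z = RtoC x.
Proof. by rewrite /pev map_polyC hornerC. Qed.
Lemma pevX z : pev 'X%ri z = z.
Proof. by rewrite /pev map_polyX hornerX. Qed.
Lemma pev0 z : pev 0%ri z = 0.
Proof. exact: pevC. Qed.
Lemma pev1 z : pev 1%ri z = 1.
Proof. exact: pevC. Qed.
Lemma natC n : INR n = (n%:R%ri : R). Proof. by rewrite INRE. Qed.
Lemma pev_nat n z : pev (n%:R)%ri z = INR n.
Proof. by rewrite -polyC_natr pevC -natC. Qed.
Lemma pev_real (p : {poly R}) (x : R) : pev p (RtoC x) = RtoC (p.[x])%ri.
Proof. by rewrite /pev -[RtoC x]/(RC x) horner_map. Qed.
Lemma pev_pow p n z : pev (GRing.exp p n) z = Cpow (pev p z) n.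
Proof. by elim: n => [|n IH]; rewrite ?pev1 // exprS pevM IH. Qed.

Lemma pev_der (p : {poly R}) z : DerC (pev p) z (pev (deriv p) z).
Proof.
move: p; apply: poly_ind => [|p c IH].
  apply: (Der_ext _ (fun=> 0)) => [y|]; first by rewrite pev0.
  by rewrite deriv0 pev0; apply: Der_const.
apply: (Der_ext _ (fun y => pev p y * y + RtoC c)) => [y|].
  by rewrite pevD pevM pevX pevC.
rewrite derivD derivM derivX derivC addr0 mulr1 pevD pevM pevX.
have h := Der_plus (fun z : C => z) _ _ z _ _ (Der_mult (fun z : C => z) id_cont _ _ z _ _ IH (Der_iota (fun z : C => z) z)) (Der_const (fun z : C => z) (RtoC c) z).
apply: Der_eq h; ring.
Qed.
Lemma pev_cont (p : {poly R}) z : continuous (pev p) z.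
Proof. exact: (Der_continuous _ id_cont _ _ _ (pev_der p z)). Qed.

Lemma pev_pv z : pev (pv R) z = z * (1 - 4 * z * z).
Proof.
have e4 : INR 4 = 4%R by simpl; lra.
rewrite /pv pevM pevB pevM pev1 pev_nat pev_pow pevX e4 /=; ring.
Qed.

Lemma pev_pa z : pev (pa R) z = 3 / 2 * (pev (pv R) z * pev (pv R) z).
Proof.
rewrite /pa (pevM (polyC _)) pevC pev_pow /=; congr (_ * _); last by ring.
rewrite -natC -[((INR 3) * _)%ri]/(INR 3 * / (1 + 1))%R RtoC_mult RtoC_inv; last by lra.
by congr (RtoC _ * / RtoC _); rewrite /=; lra.
Qed.

(** * The coefficients as functions on the Riemann surface *)

Section Surface.
Variable c : C.
Hypothesis c0 : c <> 0.

(** An open condition on the independent pair (x, s): functions equal on [good] have the same [Dt],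
    which fails for equality on [surf] alone. *)
Definition good (x s : C) := x <> 0 /\ s <> 0 /\ Dfun c x <> 0.
Definition surf (x s : C) := s * s = Dfun c x.

Lemma tfun_der (x : C) : x <> 0 -> DerC (tfun c) x (- Dfun c x / x).
Proof.
move=> x0.
have id' := Der_iota (fun z : C => z) x.
have hk k := Der_const (fun z : C => z) k x.
have hm := fun f g l m hf hg => Der_mult (fun z : C => z) id_cont f g x l m hf hg.
have hp := fun f g l m hf hg => Der_plus (fun z : C => z) f g x l m hf hg.
have hi := Der_inv (fun z : C => z) id_cont _ _ _ id' x0.
have h2 := hm _ _ _ _ (hk (- RtoC 2)) (hm _ _ _ _ id' id').
have h3 := hm _ _ _ _ (hk (- c)) hi.
apply: Der_eq_loc (Der_eq _ _ _ _ _ _ (hp _ _ _ _ h2 h3)).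
  have := locally_neq0 (fun z : C => z) x (id_cont x) x0.
  apply: (@filter_imp C_UniformSpace (locally x) _) => y hy.
  by rewrite /tfun; field.
by rewrite /Dfun /tfun; field.
Qed.
Lemma Dfun_der (x : C) : x <> 0 -> DerC (Dfun c) x ((12 * x * x - Dfun c x) / x).
Proof.
move=> x0.
have id' := Der_iota (fun z : C => z) x.
have hm := fun f g l m hf hg => Der_mult (fun z : C => z) id_cont f g x l m hf hg.
have h := Der_plus (fun z : C => z) _ _ x _ _ (hm _ _ _ _ (hm _ _ _ _ (Der_const _ (RtoC 6) x) id') id') (tfun_der x x0).
apply: Der_eq h; by field.
Qed.
Lemma good_locx (x s : C) : good x s -> locally (x : C_UniformSpace) (fun y => good y s).
Proof.
move=> [x0 [s0 d0]].
have h1 := locally_neq0 (fun z : C => z) x (id_cont x) x0.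
have h2 := locally_neq0 _ x (Der_continuous _ id_cont _ _ _ (Dfun_der x x0)) d0.
refine (filter_imp _ _ _ (filter_and _ _ h1 h2)).
by move=> y [h3 h4]; split.
Qed.
Lemma good_locs (x s : C) : good x s -> locally (s : C_UniformSpace) (fun y => good x y).
Proof.
move=> [x0 [s0 d0]].
have h1 := locally_neq0 (fun z : C => z) s (id_cont s) s0.
by move: h1; apply: (@filter_imp C_UniformSpace (locally s) _) => y h3; split.
Qed.

Definition PD (F : Defs.Fn) (x s a b : C) :=
  DerC (fun z => F z s) x a /\ DerC (fun w => F x w) s b.

Lemma Dt_PD F x s a b : good x s -> PD F x s a b ->
  Dt c F x s = (a * x + b * (12 * x * x - Dfun c x) / (2 * s)) * - (/ Dfun c x).
Proof.
move=> [x0 [s0 d0]] [ha hb].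
rewrite /Dt (Cder_eq _ _ _ ha) (Cder_eq _ _ _ hb) (Cder_eq _ _ _ (tfun_der x x0)) (Cder_eq _ _ _ (Dfun_der x x0)).
by field; do !split.
Qed.

Definition diffF (F : Defs.Fn) := forall x s, good x s -> exists a b, PD F x s a b.
Definition eqF (F G : Defs.Fn) := forall x s, good x s -> F x s = G x s.

Lemma PD_ext F G x s a b : good x s -> eqF F G -> PD F x s a b -> PD G x s a b.
Proof.
move=> g e [ha hb]; split.
  apply: Der_eq_loc ha; move: (good_locx _ _ g).
  by apply: (@filter_imp C_UniformSpace (locally x) _) => y; apply: e.
apply: Der_eq_loc hb; move: (good_locs _ _ g).
by apply: (@filter_imp C_UniformSpace (locally s) _) => y; apply: e.
Qed.
Lemma diffF_ext F G : eqF F G -> diffF F -> diffF G.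
Proof. by move=> e h x s g; have [a [b p]] := h x s g; exists a, b; apply: PD_ext p. Qed.
Lemma Dt_ext F G : eqF F G -> diffF F -> eqF (Dt c F) (Dt c G).
Proof.
move=> e h x s g; have [a [b p]] := h x s g.
by rewrite (Dt_PD _ _ _ _ _ g p) (Dt_PD _ _ _ _ _ g (PD_ext _ _ _ _ _ _ g e p)).
Qed.

Definition addF (F G : Defs.Fn) : Defs.Fn := fun x s => F x s + G x s.
Definition mulF (F G : Defs.Fn) : Defs.Fn := fun x s => F x s * G x s.
Lemma PD_add F G x s a b a' b' : PD F x s a b -> PD G x s a' b' ->
  PD (addF F G) x s (a + a') (b + b').
Proof. by move=> [h1 h2] [h3 h4]; split; apply: Der_plus. Qed.
Lemma PD_mul F G x s a b a' b' : PD F x s a b -> PD G x s a' b' ->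
  PD (mulF F G) x s (a * G x s + F x s * a') (b * G x s + F x s * b').
Proof. by move=> [h1 h2] [h3 h4]; split; apply: Der_mult => //; apply: id_cont. Qed.
Lemma diffF_add F G : diffF F -> diffF G -> diffF (addF F G).
Proof.
move=> h1 h2 x s g; have [a [b p]] := h1 x s g; have [a' [b' p']] := h2 x s g.
by do 2 eexists; apply: PD_add p p'.
Qed.
Lemma diffF_mul F G : diffF F -> diffF G -> diffF (mulF F G).
Proof.
move=> h1 h2 x s g; have [a [b p]] := h1 x s g; have [a' [b' p']] := h2 x s g.
by do 2 eexists; apply: PD_mul p p'.
Qed.
Lemma Dt_add F G : diffF F -> diffF G -> eqF (Dt c (addF F G)) (addF (Dt c F) (Dt c G)).
Proof.
move=> h1 h2 x s g; have [a [b p]] := h1 x s g; have [a' [b' p']] := h2 x s g.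
rewrite (Dt_PD _ _ _ _ _ g (PD_add _ _ _ _ _ _ _ _ p p')) /addF (Dt_PD _ _ _ _ _ g p) (Dt_PD _ _ _ _ _ g p').
case: g => [x0 [s0 d0]]; by field.
Qed.
Lemma Dt_mul F G : diffF F -> diffF G ->
  eqF (Dt c (mulF F G)) (addF (mulF (Dt c F) G) (mulF F (Dt c G))).
Proof.
move=> h1 h2 x s g; have [a [b p]] := h1 x s g; have [a' [b' p']] := h2 x s g.
rewrite (Dt_PD _ _ _ _ _ g (PD_mul _ _ _ _ _ _ _ _ p p')) /addF /mulF (Dt_PD _ _ _ _ _ g p) (Dt_PD _ _ _ _ _ g p').
case: g => [x0 [s0 d0]]; by field.
Qed.

(* On the surface F(x, s) = c^-k s^a s^-b q(x/s), together with its first n derivatives d/dt. *)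
Definition val k a b q (x s : C) : C := Cpow s a / Cpow s b / Cpow c k * pev q (x / s).
Fixpoint Rel (n : nat) (F : Defs.Fn) k a b (q : {poly R}) : Prop :=
  (forall x s, good x s -> surf x s -> F x s = val k a b q x s) /\
  match n with
  | O => True
  | S n' => diffF F /\ Rel n' (Dt c F) (S k) (S a) b (Dpol (INR a - INR b)%R q)
  end.

Lemma Rel_val n F k a b q x s : Rel n F k a b q -> good x s -> surf x s -> F x s = val k a b q x s.
Proof. by case: n => [|n] [h _]; apply: h. Qed.
Lemma Rel_Dt n F k a b q : Rel n.+1 F k a b q -> Rel n (Dt c F) k.+1 a.+1 b (Dpol (INR a - INR b)%R q).
Proof. by case=> _ []. Qed.
Lemma Rel_ext n F G k a b q : eqF F G -> Rel n F k a b q -> Rel n G k a b q.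
Proof.
elim: n F G k a q => [|n IH] F G k a q e [h1 h2].
  by split=> // x s g hs; rewrite -e // h1.
case: h2 => d h2; split; first by move=> x s g hs; rewrite -e // h1.
split; first exact: diffF_ext d.
by apply: IH h2; apply: Dt_ext.
Qed.
Lemma Rel_S n F k a b q : Rel n.+1 F k a b q -> Rel n F k a b q.
Proof.
elim: n F k a q => [|n IH] F k a q [h1 [d h2]]; first by split.
by split=> //; split=> //; apply: IH.
Qed.
Lemma Rel_polyeq n F k a b q q' : q = q' -> Rel n F k a b q -> Rel n F k a b q'.
Proof. by move=> ->. Qed.
Lemma good_pow x s a : good x s -> Cpow s a <> 0.
Proof. by move=> [_ [s0 _]]; apply: Cpow_nz. Qed.

Lemma Rel_add n F G k a b p q : Rel n F k a b p -> Rel n G k a b q ->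
  Rel n (addF F G) k a b (p + q)%ri.
Proof.
have hval : forall n F G k a p q, Rel n F k a b p -> Rel n G k a b q ->
   forall x s, good x s -> surf x s -> addF F G x s = val k a b (p + q)%ri x s.
  move=> {}n {}F {}G {}k {}a {}p {}q hF hG x s g hs.
  rewrite /addF (Rel_val _ _ _ _ _ _ _ _ hF g hs) (Rel_val _ _ _ _ _ _ _ _ hG g hs).
  by rewrite /val pevD; ring.
elim: n F G k a p q => [|n IH] F G k a p q hF hG.
  by split=> //; apply: hval hF hG.
split; first exact: hval hF hG.
have [_ [dF _]] := hF; have [_ [dG _]] := hG.
split; first exact: diffF_add.
rewrite DpolD; apply: Rel_ext (IH _ _ _ _ _ _ (Rel_Dt _ _ _ _ _ _ hF) (Rel_Dt _ _ _ _ _ _ hG)).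
by move=> x s g; rewrite Dt_add.
Qed.
Lemma Rel_mul n F G k a b p k' a' b' q : Rel n F k a b p -> Rel n G k' a' b' q ->
  Rel n (mulF F G) (k + k') (a + a') (b + b') (p * q)%ri.
Proof.
have hval : forall n F G k a b p k' a' b' q, Rel n F k a b p -> Rel n G k' a' b' q ->
   forall x s, good x s -> surf x s -> mulF F G x s = val (k + k') (a + a') (b + b') (p * q)%ri x s.
  move=> {}n {}F {}G {}k {}a {}b {}p {}k' {}a' {}b' {}q hF hG x s g hs.
  rewrite /mulF (Rel_val _ _ _ _ _ _ _ _ hF g hs) (Rel_val _ _ _ _ _ _ _ _ hG g hs).
  rewrite /val pevM !Cpow_add_r; field.
  by do !split; try exact: Cpow_nz; apply: good_pow g.
elim: n F G k a b p k' a' b' q => [|n IH] F G k a b p k' a' b' q hF hG.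
  by split=> //; apply: hval hF hG.
split; first exact: hval hF hG.
have [_ [dF _]] := hF; have [_ [dG _]] := hG.
split; first exact: diffF_mul.
have -> : (INR (a + a') - INR (b + b') = (INR a - INR b) + (INR a' - INR b'))%R.
  by rewrite !plus_INR; ring.
rewrite DpolM; apply: Rel_ext (Rel_add _ _ _ _ _ _ _ _ (IH _ _ _ _ _ _ _ _ _ _ (Rel_Dt _ _ _ _ _ _ hF) (Rel_S _ _ _ _ _ _ hG)) _).
  by move=> x s g; rewrite Dt_mul.
by rewrite !addSn -!addnS; apply: IH (Rel_S _ _ _ _ _ _ hF) (Rel_Dt _ _ _ _ _ _ hG).
Qed.

Lemma surf_c x s : good x s -> surf x s -> c = - (s * s * s) * pev (pv R) (x / s).
Proof.
move=> [x0 [s0 d0]] h; rewrite pev_pv.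
have -> : c = 4 * x * x * x - Dfun c x * x by rewrite /Dfun /tfun; field.
by rewrite -h; field.
Qed.
(** On the surface c = - s^3 v(w). [Rel] expects one more factor 1 / c after each derivative,
    whereas [Dt] of x, s, 1 / s or 1 / Delta shows none; this supplies it. *)
Lemma Rel_shift n F k a b q : Rel n F k a b q -> Rel n F k.+1 (a + 3) b (- pv R * q)%ri.
Proof.
elim: n F k a q => [|n IH] F k a q [h1 h2].
  split=> // x s g hs; rewrite h1 // /val pevM pevN Cpow_add_r [Cpow c k.+1]/= {2}(surf_c x s g hs).
  have v0 : pev (pv R) (x / s) <> 0.
    by move=> v0; apply: c0; rewrite (surf_c x s g hs) v0; ring.
  case: (g) => [x0 [s0 _]]; rewrite /=; field.
  by do !split => //; try exact: Cpow_nz; apply: good_pow g.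
split.
  move=> x s g hs; rewrite h1 // /val pevM pevN Cpow_add_r [Cpow c k.+1]/= {2}(surf_c x s g hs).
  have v0 : pev (pv R) (x / s) <> 0.
    by move=> v0; apply: c0; rewrite (surf_c x s g hs) v0; ring.
  case: (g) => [x0 [s0 _]]; rewrite /=; field.
  by do !split => //; try exact: Cpow_nz; apply: good_pow g.
case: h2 => d h2; split=> //.
have -> : (INR (a + 3) - INR b = (INR a - INR b) + 3)%R by rewrite plus_INR /=; ring.
have -> : 3%R = (3%:R)%ri by rewrite -natC /=; lra.
by rewrite Dpol_pv; apply: IH h2.
Qed.
(** Only the signed weight a - b matters; two natural exponents stand for an integer one. *)
Lemma Rel_cancel n i F k a b q : Rel n F k (a + i) (b + i) q <-> Rel n F k a b q.
Proof.
have hv x s : good x s -> val k (a + i) (b + i) q x s = val k a b q x s.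
  move=> g; rewrite /val !Cpow_add_r; field.
  by do !split; try exact: Cpow_nz; apply: good_pow g.
elim: n F k a q hv => [|n IH] F k a q hv.
  by split=> -[h _]; split=> // x s g hs; [rewrite -hv|rewrite hv]; auto.
have hv' x s : good x s -> val k.+1 (a.+1 + i) (b + i) (Dpol (INR a - INR b)%R q) x s = val k.+1 a.+1 b (Dpol (INR a - INR b)%R q) x s.
  move=> g; rewrite /val !Cpow_add_r; field.
  by do !split; try exact: Cpow_nz; apply: good_pow g.
have e : (INR (a + i) - INR (b + i) = INR a - INR b)%R by rewrite !plus_INR; ring.
split=> -[h1 [d h2]]; split.
- by move=> x s g hs; rewrite -hv //; apply: h1.
- by split=> //; apply/(IH (Dt c F) k.+1 a.+1 _ hv'); rewrite e in h2.
- by move=> x s g hs; rewrite hv //; apply: h1.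
- by split=> //; rewrite e; apply/(IH (Dt c F) k.+1 a.+1 _ hv').
Qed.
Lemma Rel_const n (r : R) : Rel n (fun _ _ => RtoC r) 0 0 0 (polyC r).
Proof.
have gen : forall n (r : R) (F : Defs.Fn) k a, (forall x s, F x s = 0) -> Rel n F k a 0 0%ri.
  elim=> [|{}n IH] r' F k a h.
    by split=> // x s g hs; rewrite h /val pev0; ring.
  split; first by move=> x s g hs; rewrite h /val pev0; ring.
  have p x s : PD F x s 0 0.
    by split; [apply: (Der_ext _ (fun=> RtoC 0)) (Der_const _ _ _) => y|apply: (Der_ext _ (fun=> RtoC 0)) (Der_const _ _ _) => y].
  split; first by move=> x s g; exists 0, 0.
  rewrite (_ : Dpol _ _ = 0%ri); last by rewrite /Dpol deriv0 !mulr0 addr0.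
  apply: (Rel_ext _ (fun _ _ => RtoC 0)); last exact: IH.
  by move=> x s g; rewrite (Dt_PD _ _ _ _ _ g (p x s)) /Cdiv; ring.
case: n => [|n].
  by split=> // x s g hs; rewrite /val pevC /=; field.
split; first by move=> x s g hs; rewrite /val pevC /=; field.
have p x s : PD (fun _ _ => RtoC r) x s 0 0 by split; apply: Der_const.
split; first by move=> x s g; exists 0, 0.
rewrite (_ : Dpol _ _ = 0%ri); last first.
  by rewrite /Dpol derivC mulr0 add0r /= Rminus_diag polyC0 !mul0r.
apply: (Rel_ext _ (fun _ _ => RtoC 0)); last exact: gen.
by move=> x s g; rewrite (Dt_PD _ _ _ _ _ g (p x s)) /Cdiv; ring.
Qed.

Definition xF : Defs.Fn := fun x _ => x.
Definition sF : Defs.Fn := fun _ s => s.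
Definition yF : Defs.Fn := fun x _ => / Dfun c x.
Definition vF : Defs.Fn := fun _ s => / s.
Definition kF (r : R) : Defs.Fn := fun _ _ => RtoC r.

Lemma RtoC_half : RtoC (/ 2) = / 2. Proof. by rewrite RtoC_inv //; lra. Qed.
Lemma Dt_xF : eqF (mulF (kF (-1)) (mulF xF yF)) (Dt c xF).
Proof.
move=> x s g; case: (g) => [x0 [s0 d0]].
have p : PD xF x s 1 0 by split; [apply: Der_iota|apply: Der_const].
by rewrite (Dt_PD _ _ _ _ _ g p) /mulF /kF /xF /yF; field.
Qed.
Lemma Dt_sF : eqF (addF (mulF (kF (/ 2)) vF) (mulF (kF (-6)) (mulF (mulF xF xF) (mulF vF yF)))) (Dt c sF).
Proof.
move=> x s g; case: (g) => [x0 [s0 d0]].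
have p : PD sF x s 0 1 by split; [apply: Der_const|apply: Der_iota].
by rewrite (Dt_PD _ _ _ _ _ g p) /addF /mulF /kF /xF /yF /vF RtoC_half; field.
Qed.
Lemma Dt_vF : eqF (addF (mulF (kF (- / 2)) (mulF vF (mulF vF vF))) (mulF (kF 6) (mulF (mulF xF xF) (mulF (mulF vF (mulF vF vF)) yF)))) (Dt c vF).
Proof.
move=> x s g; case: (g) => [x0 [s0 d0]].
have p : PD vF x s 0 (- (1) / (s * s)).
  by split; [apply: Der_const|apply: Der_inv; [exact: id_cont|exact: Der_iota|]].
by rewrite (Dt_PD _ _ _ _ _ g p) /addF /mulF /kF /xF /yF /vF RtoC_opp RtoC_half; field.
Qed.
Lemma Dt_yF : eqF (addF (mulF (kF 12) (mulF (mulF xF xF) (mulF yF (mulF yF yF)))) (mulF (kF (-1)) (mulF yF yF))) (Dt c yF).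
Proof.
move=> x s g; case: (g) => [x0 [s0 d0]].
have p : PD yF x s (- ((12 * x * x - Dfun c x) / x) / (Dfun c x * Dfun c x)) 0.
  by split; [apply: Der_inv; [exact: id_cont|exact: Dfun_der|]|apply: Der_const].
by rewrite (Dt_PD _ _ _ _ _ g p) /addF /mulF /kF /xF /yF /vF; field.
Qed.
Lemma diffF_base : diffF xF /\ diffF sF /\ diffF vF /\ diffF yF.
Proof.
split; [|split; [|split]] => x s [x0 [s0 d0]].
- by exists 1, 0; split; [apply: Der_iota|apply: Der_const].
- by exists 0, 1; split; [apply: Der_const|apply: Der_iota].
- by exists 0, (- (1) / (s * s)); split; [apply: Der_const|apply: Der_inv; [exact: id_cont|exact: Der_iota|]].
- exists (- ((12 * x * x - Dfun c x) / x) / (Dfun c x * Dfun c x)), 0.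
  by split; [apply: Der_inv; [exact: id_cont|exact: Dfun_der|]|apply: Der_const].
Qed.
Lemma Rel_base0 : Rel 0 xF 0 1 0 'X%ri /\ Rel 0 sF 0 1 0 1%ri /\ Rel 0 vF 0 0 1 1%ri /\ Rel 0 yF 0 0 2 1%ri.
Proof.
split; [|split; [|split]]; split => // x s [x0 [s0 d0]] hs;
  rewrite /xF /sF /vF /yF /val ?pevX ?pev1 /=; try by field.
by rewrite -hs; field.
Qed.
(** The derivatives of x, s, 1 / s and 1 / Delta are polynomials in x, 1 / s and 1 / Delta, hence a
    joint induction on n. *)
Lemma Rel_base n : Rel n xF 0 1 0 'X%ri /\ Rel n sF 0 1 0 1%ri /\ Rel n vF 0 0 1 1%ri /\ Rel n yF 0 0 2 1%ri.
Proof.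
elim: n => [|n [hx [hs [hv hy]]]]; first exact: Rel_base0.
have [bx [bs [bv by_]]] := Rel_base0; have [dx [ds [dv dy]]] := diffF_base.
have hk r := Rel_const n r.
have hm := Rel_mul n.
have e10 : (INR 1 - INR 0)%R = 1%ri :> R by rewrite /= Rminus_0_r.
have e01 : (INR 0 - INR 1)%R = (-1)%ri :> R by rewrite /= Rminus_0_l.
have e02 : (INR 0 - INR 2)%R = (- 2%:R)%ri :> R by rewrite -natC; apply: Rminus_0_l.
have e6 : (6%:R)%ri = 6%R :> R by rewrite -natC /=; lra.
have e12 : (12%:R)%ri = 12%R :> R by rewrite -natC /=; lra.
split; [|split; [|split]]; (split; [by have [? _] := bx; have [? _] := bs; have [? _] := bv; have [? _] := by_|split=> //]).
- apply: Rel_ext Dt_xF _.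
  apply/(Rel_cancel n 2 _ _ 2 0).
  apply: Rel_polyeq (Rel_shift _ _ _ _ _ _ (hm _ _ _ _ _ _ _ _ _ _ (hk (-1)%R) (hm _ _ _ _ _ _ _ _ _ _ hx hy))).
  by rewrite e10; exact: Dpol_x.
- apply: Rel_ext Dt_sF _.
  have h1 := hm _ _ _ _ _ _ _ _ _ _ (hk (/ 2)%R) hv.
  have h2 := hm _ _ _ _ _ _ _ _ _ _ (hk (-6)%R) (hm _ _ _ _ _ _ _ _ _ _ (hm _ _ _ _ _ _ _ _ _ _ hx hx) (hm _ _ _ _ _ _ _ _ _ _ hv hy)).
  move/(Rel_cancel n 2): h1 => h1.
  apply/(Rel_cancel n 3 _ _ 2 0).
  apply: Rel_polyeq (Rel_shift _ _ _ _ _ _ (Rel_add _ _ _ _ _ _ _ _ h1 h2)).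
  by rewrite e10 -Dpol_s e6.
- apply: Rel_ext Dt_vF _.
  have h3 := hm _ _ _ _ _ _ _ _ _ _ hv (hm _ _ _ _ _ _ _ _ _ _ hv hv).
  have h1 := hm _ _ _ _ _ _ _ _ _ _ (hk (- / 2)%R) h3.
  have h2 := hm _ _ _ _ _ _ _ _ _ _ (hk 6%R) (hm _ _ _ _ _ _ _ _ _ _ (hm _ _ _ _ _ _ _ _ _ _ hx hx) (hm _ _ _ _ _ _ _ _ _ _ h3 hy)).
  move/(Rel_cancel n 2): h1 => h1.
  apply/(Rel_cancel n 4 _ _ 1 1).
  apply: Rel_polyeq (Rel_shift _ _ _ _ _ _ (Rel_add _ _ _ _ _ _ _ _ h1 h2)).
  by rewrite e01 -Dpol_v e6.
- apply: Rel_ext Dt_yF _.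
  have h1 := hm _ _ _ _ _ _ _ _ _ _ (hk 12%R) (hm _ _ _ _ _ _ _ _ _ _ (hm _ _ _ _ _ _ _ _ _ _ hx hx) (hm _ _ _ _ _ _ _ _ _ _ hy (hm _ _ _ _ _ _ _ _ _ _ hy hy))).
  have h2 := hm _ _ _ _ _ _ _ _ _ _ (hk (-1)%R) (hm _ _ _ _ _ _ _ _ _ _ hy hy).
  move/(Rel_cancel n 2): h2 => h2.
  apply/(Rel_cancel n 4 _ _ 1 2).
  apply: Rel_polyeq (Rel_shift _ _ _ _ _ _ (Rel_add _ _ _ _ _ _ _ _ h1 h2)).
  by rewrite e02 -Dpol_y e12.
Qed.
Lemma Rel_zero n k a b : Rel n zeroFn k a b 0%ri.
Proof.
have z : forall n (F : Defs.Fn) k a, (forall x s, F x s = 0) -> Rel n F k a b 0%ri.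
  elim=> [|{}n IH] F {}k {}a h.
    by split=> // x s g hs; rewrite h /val pev0; ring.
  split; first by move=> x s g hs; rewrite h /val pev0; ring.
  have p x s : PD F x s 0 0.
    by split; [apply: (Der_ext _ (fun=> RtoC 0)) (Der_const _ _ _) => y|apply: (Der_ext _ (fun=> RtoC 0)) (Der_const _ _ _) => y].
  split; first by move=> x s g; exists 0, 0.
  rewrite (_ : Dpol _ _ = 0%ri); last by rewrite /Dpol deriv0 !mulr0 addr0.
  apply: (Rel_ext _ (fun _ _ => RtoC 0)); last exact: IH.
  by move=> x s g; rewrite (Dt_PD _ _ _ _ _ g (p x s)) /Cdiv; ring.
by apply: z.
Qed.
Lemma Rel_csum n (f : nat -> Defs.Fn) k a b (p : nat -> {poly R}) N :
  (forall i, (i < N)%nat -> Rel n (f i) k a b (p i)) ->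
  Rel n (fun x s => csum (fun i => f i x s) N) k a b (\sum_(i < N) p i)%ri.
Proof.
elim: N => [|N IH] h; first by rewrite big_ord0; apply: Rel_zero.
rewrite big_ord_recr /=; apply: (Rel_add n (fun x s => csum (fun i => f i x s) N) (f N)).
  by apply: IH => i hi; apply: h; apply: ltn_trans hi _.
by apply: h.
Qed.

Lemma zps_size n : length (zps c n) = n.+1.
Proof. by elim: n => //= n IH; rewrite List.length_app IH /= PeanoNat.Nat.add_1_r. Qed.
Lemma zps_nth k n : (k <= n)%nat -> nthF (zps c n) k = nthF (zps c k) k.
Proof.
elim: n => [|n IH]; first by rewrite leqn0 => /eqP ->.
rewrite leq_eqVlt => /predU1P [-> //|h]; rewrite -IH // /nthF /= List.app_nth1 //.
by apply/ltP; rewrite zps_size.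
Qed.
Lemma zps_last k : nthF (zps c k.+1) k.+1 = zstep c (zps c k).
Proof. by rewrite /nthF /= List.app_nth2 zps_size // PeanoNat.Nat.sub_diag. Qed.

Lemma subn11 k : (k.+1 - 1)%coq_nat = k. Proof. by lia. Qed.
Lemma lam0S k : lam0 c k.+1 = fst (zstep c (zps c k)).
Proof. by rewrite /lam0 zps_last. Qed.
Lemma nu0S k : nu0 c k.+1 = Dt c (lam0 c k).
Proof. by rewrite /nu0 zps_last /zstep zps_size subn11. Qed.

Lemma csum_ext f g N : (forall i, (i < N)%nat -> f i = g i) -> csum f N = csum g N.
Proof.
elim: N => //= N IH h; rewrite IH ?h // => i hi.
by apply: h; apply: ltn_trans hi _.
Qed.

Definition cubeF k : Defs.Fn := fun x s => csum (fun a => csum (fun b => csum (fun d =>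
     if Nat.eqb (a + b + d)%coq_nat k then lam0 c a x s * lam0 c b x s * lam0 c d x s else 0) k) k) k.
Lemma Rel_cubeF n k : (forall m, (m < k)%nat -> Rel n (lam0 c m) m 1 0 (lpol R m)) ->
  Rel n (cubeF k) k 3 0 (\sum_(a < k) \sum_(b < k) \sum_(d < k)
        (if (a + b + d == k)%nat then lpol R a * lpol R b * lpol R d else 0))%ri.
Proof.
move=> IH.
apply: (Rel_csum n (fun a x s => csum (fun b => csum (fun d => if Nat.eqb (a + b + d)%coq_nat k then lam0 c a x s * lam0 c b x s * lam0 c d x s else 0) k) k) _ _ _
    (fun a : nat => \sum_(b < k) \sum_(d < k) (if (a + b + d == k)%nat then lpol R a * lpol R b * lpol R d else 0))%ri) => a ha.
apply: (Rel_csum n (fun b x s => csum (fun d => if Nat.eqb (a + b + d)%coq_nat k then lam0 c a x s * lam0 c b x s * lam0 c d x s else 0) k) _ _ _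
    (fun b : nat => \sum_(d < k) (if (a + b + d == k)%nat then lpol R a * lpol R b * lpol R d else 0))%ri) => b hb.
apply: (Rel_csum n (fun d x s => if Nat.eqb (a + b + d)%coq_nat k then lam0 c a x s * lam0 c b x s * lam0 c d x s else 0) _ _ _
    (fun d : nat => if (a + b + d == k)%nat then lpol R a * lpol R b * lpol R d else 0)%ri) => d hd.
case: eqP => [e|e]; last first.
  apply: Rel_ext (Rel_zero _ _ _ _) => x s g.
  by have -> : Nat.eqb (a + b + d)%coq_nat k = false by apply/PeanoNat.Nat.eqb_neq.
have h := Rel_mul _ _ _ _ _ _ _ _ _ _ _ (Rel_mul _ _ _ _ _ _ _ _ _ _ _ (IH a ha) (IH b hb)) (IH d hd).
rewrite e in h; apply: Rel_ext h => x s g.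
by have -> : Nat.eqb (a + b + d)%coq_nat k = true by apply/PeanoNat.Nat.eqb_eq.
Qed.

Lemma lam0S_E k x s : lam0 c k.+1 x s = (Dt c (nu0 c k) x s + - RtoC 2 * cubeF k.+1 x s) / Dfun c x.
Proof.
rewrite lam0S /zstep zps_size subn11 /nu0 /cubeF; cbn [fst].
have -> : forall X Y Z : C, (X - Y * Z) = X + - Y * Z by move=> X Y Z; ring.
congr ((_ + _ * _) / _).
apply: csum_ext => a ha; apply: csum_ext => b hb; apply: csum_ext => d hd.
by case: Nat.eqb => //; rewrite !zps_nth.
Qed.

Lemma Rel_lam0 k : forall n, Rel n (lam0 c k) k 1 0 (lpol R k).
Proof.
elim/ltn_ind: k => k IH n; rewrite lpolE.
case: k IH => [|k] IH; first by case: (Rel_base n).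
rewrite /lstep.
have hnu n' : Rel n' (Dt c (nu0 c k)) k.+1 3 0
    (if k is k2.+1 then Dpol (2%:R)%ri (Dpol 1%ri (lpol R k2)) else 0)%ri.
  case: k IH => [|k2] IH.
    have := Rel_Dt n' zeroFn 0 2 0 0%ri (Rel_zero _ _ _ _).
    by apply: Rel_polyeq; rewrite /Dpol deriv0 !mulr0 addr0.
  rewrite nu0S.
  have h1 := Rel_Dt _ _ _ _ _ _ (Rel_Dt _ _ _ _ _ _ (IH k2 (ltnW (ltnSn _)) n'.+2)).
  rewrite (_ : (INR 1 - INR 0)%R = 1%ri) in h1; last by rewrite /= Rminus_0_r.
  by rewrite (_ : (INR 2 - INR 0)%R = (2%:R)%ri) in h1; last by rewrite -natC /= Rminus_0_r.
have hsum := Rel_cubeF n k.+1 (fun m hm => IH m hm n).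
have [_ [_ [_ hy]]] := Rel_base n.
have h2 := Rel_mul _ _ _ _ _ _ _ _ _ _ _ (Rel_const n (-2)) hsum.
(* Division by Delta is multiplication by [yF], of weight - 2, which brings weight 3 down to 1. *)
have h3 := Rel_mul _ _ _ _ _ _ _ _ _ _ _ (Rel_add _ _ _ _ _ _ _ _ (hnu n) h2) hy.
rewrite addn0 add0n in h3; move/(Rel_cancel n 2 _ k.+1 1 0): h3 => h3.
apply: Rel_polyeq (Rel_ext _ _ _ _ _ _ _ _ h3).
  rewrite mulr1; congr (_ + _)%ri; rewrite -mulNr; congr (_ * _)%ri.
  by rewrite -polyC_natr -polyCN; congr polyC; rewrite -natC /= -[GRing.opp _]/(Ropp _); lra.
move=> x s g; rewrite lam0S_E /addF /mulF /yF /Cdiv; congr ((_ + _ * _) * _).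
by rewrite -RtoC_opp.
Qed.

Lemma Rlist_size K0 n : length (Rlist c K0 n) = n.+1.
Proof. by elim: n => //= n IH; rewrite List.length_app IH /= PeanoNat.Nat.add_1_r. Qed.
Lemma Rlist_nth K0 k n : (k <= n)%nat -> List.nth k (Rlist c K0 n) zeroFn = Rc c K0 k.
Proof.
elim: n => [|n IH]; first by rewrite leqn0 => /eqP ->.
rewrite leq_eqVlt => /predU1P [-> //|h]; rewrite -IH //= List.app_nth1 //.
by apply/ltP; rewrite Rlist_size.
Qed.
Lemma RcS_E K0 k x s : Rc c K0 k.+1 x s =
  (Qc c k.+1 x s - Dt c (Rc c K0 k) x s
   - csum (fun i => if Nat.eqb i 0 then RtoC 0 else Rc c K0 i x s * Rc c K0 (k.+1 - i)%coq_nat x s) k.+1)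
  / (2 * K0 x s).
Proof.
rewrite /Rc [Rlist c K0 k.+1]/= List.app_nth2 Rlist_size // PeanoNat.Nat.sub_diag [List.nth 0 _ _]/=.
rewrite /Rstep Rlist_size subn11 Rlist_nth //; congr ((_ - _ - _) / _).
apply: csum_ext => -[|i] hi //; cbn [Nat.eqb].
by rewrite !Rlist_nth // leq_subLR addSn ltnS leq_addl.
Qed.

Lemma Rel_Qc n k : Rel n (Qc c k.+1) k.+1 2 0 (Qpol (lpol R) k.+1).
Proof.
have h : Rel n (fun x s => csum (fun a => lam0 c a x s * lam0 c (k.+1 - a)%coq_nat x s) k.+2) k.+1 2 0
    (\sum_(a < k.+2) lpol R a * lpol R (k.+1 - a)%nat)%ri.
  apply: (Rel_csum n (fun a x s => lam0 c a x s * lam0 c (k.+1 - a)%coq_nat x s) _ _ _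
    (fun a : nat => lpol R a * lpol R (k.+1 - a)%nat)%ri) => a ha.
  have := Rel_mul _ _ _ _ _ _ _ _ _ _ _ (Rel_lam0 a n) (Rel_lam0 (k.+1 - a)%nat n).
  by rewrite subnKC.
have h2 := Rel_mul _ _ _ _ _ _ _ _ _ _ _ (Rel_const n 6) h.
apply: Rel_polyeq h2; rewrite /Qpol; congr (_ * _)%ri.
by rewrite -polyC_natr; congr polyC; rewrite -natC /=; lra.
Qed.

Definition Ksgn (sg : bool) : Defs.Fn := if sg then Kminus else Kplus.
Lemma Rel_Rc sg k : forall n, Rel n (Rc c (Ksgn sg) k) k 1 0 (rsgn R sg k).
Proof.
elim/ltn_ind: k => k IH n.
have [hx [hs [hv hy]]] := Rel_base n.
case: k IH => [|k] IH.
  rewrite /rsgn rpol0 mulr1 andbT /Rc /Ksgn; case: sg {IH}; last by [].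
  have h := Rel_mul _ _ _ _ _ _ _ _ _ _ _ (Rel_const n (-1)) hs.
  apply: Rel_polyeq (Rel_ext _ _ _ _ _ _ _ _ h); first by rewrite mulr1 expr1 -polyC1 -polyCN.
  by move=> x s g; rewrite /mulF /sF /Kminus /Ksgn /=; ring.
rewrite rsgnE.
have hsum : Rel n (fun x s => csum (fun i => if Nat.eqb i 0 then RtoC 0 else
     Rc c (Ksgn sg) i x s * Rc c (Ksgn sg) (k.+1 - i)%coq_nat x s) k.+1) k.+1 2 0
    (\sum_(i < k.+1) (if (i : nat) == 0%nat then 0 else rsgn R sg i * rsgn R sg (k.+1 - i)%nat))%ri.
  apply: (Rel_csum n (fun i x s => if Nat.eqb i 0 then RtoC 0 else
     Rc c (Ksgn sg) i x s * Rc c (Ksgn sg) (k.+1 - i)%coq_nat x s) _ _ _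
    (fun i : nat => if i == 0%nat then 0 else rsgn R sg i * rsgn R sg (k.+1 - i)%nat)%ri) => -[|i] hi.
    exact: Rel_zero.
  have hki : (k.+1 - i.+1 < k.+1)%nat by rewrite subSS ltnS leq_subr.
  have := Rel_mul _ _ _ _ _ _ _ _ _ _ _ (IH i.+1 hi n) (IH _ hki n).
  by rewrite subnKC // ltnW.
have hD := Rel_Dt _ _ _ _ _ _ (IH k (ltnSn k) n.+1).
rewrite (_ : (INR 1 - INR 0)%R = 1%ri) in hD; last by rewrite /= Rminus_0_r.
have hm1 := Rel_const n (-1).
have h1 := Rel_mul _ _ _ _ _ _ _ _ _ _ _ hm1 hD.
have h2 := Rel_mul _ _ _ _ _ _ _ _ _ _ _ hm1 hsum.
have h3 := Rel_add _ _ _ _ _ _ _ _ (Rel_add _ _ _ _ _ _ _ _ (Rel_Qc n k) h1) h2.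
(* Division by 2 K0, which is 2 s or - 2 s, splits into [vF] and a constant. *)
have h4 := Rel_mul _ _ _ _ _ _ _ _ _ _ _ (Rel_const n (if sg then - / 2 else / 2)%R) (Rel_mul _ _ _ _ _ _ _ _ _ _ _ hv h3).
rewrite !add0n addn0 in h4; move/(Rel_cancel n 1 _ k.+1 1 0): h4 => h4.
apply: Rel_polyeq (Rel_ext _ _ _ _ _ _ _ _ h4).
  have -> : polyC (-1)%R = (-1)%ri :> {poly R} by rewrite -polyC1 -polyCN.
  rewrite mul1r !mulN1r mulrA; congr (_ * _)%ri.
  by case: (sg); rewrite ?expr1 ?expr0 ?mulN1r ?mul1r -?polyCN //.
move=> x s g; rewrite RcS_E /mulF /addF /vF; case: (g) => [x0 [s0 d0]].
have e2 : RtoC 2 <> 0 by move=> /RtoC_inj; lra.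
have -> : Ksgn sg x s = if sg then - s else s by case: (sg).
have -> : RtoC (if sg then - / 2 else / 2)%R = if sg then - / 2 else / 2.
  by case: (sg); rewrite ?(RtoC_opp (/ 2)) RtoC_half.
move: (Qc c k.+1 x s) (Dt c _ x s) (csum _ _) => A B D.
case: (sg); field => //.
Qed.

Lemma Wint_0 x s : Wint c 0 x s = 0.
Proof. by rewrite /Wint /Rc /= /Kplus /Kminus; field. Qed.
Lemma Wint_even k x s : good x s -> surf x s -> ~~ odd k ->
  Wint c k.+2 x s = s / Cpow c k.+2 * pev (rpol R k.+2) (x / s).
Proof.
move=> g hs hk; rewrite /Wint (Rel_val _ _ _ _ _ _ _ _ (Rel_Rc false k.+2 0) g hs) (Rel_val _ _ _ _ _ _ _ _ (Rel_Rc true k.+2 0) g hs).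
rewrite /val /rsgn /= negbK hk expr0 expr1 mul1r mulN1r pevN; field.
by do !split; apply: Cpow_nz || idtac.
Qed.
Lemma Wint_odd k x s : good x s -> surf x s -> odd k -> Wint c k x s = 0.
Proof.
case: k => // k g hs hk; rewrite /Wint (Rel_val _ _ _ _ _ _ _ _ (Rel_Rc false k.+1 0) g hs) (Rel_val _ _ _ _ _ _ _ _ (Rel_Rc true k.+1 0) g hs).
by rewrite /val /rsgn hk /= expr0 mul1r; rewrite /Cdiv; ring.
Qed.

(** * Integration of the coefficients along branches *)

Lemma cubic_facts t x : cubic c t x = 0 -> x <> 0 /\ t = tfun c x /\ Defs.Delta c t x = Dfun c x.
Proof.
move=> h; have x0 : x <> 0.
  by move=> x0; apply: c0; rewrite -h x0 /cubic; ring.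
have e : t = tfun c x.
  rewrite /tfun; have -> : c = - (2 * x * x * x + t * x).
    transitivity (cubic c t x - (2 * x * x * x + t * x)); first by rewrite /cubic; ring.
    by rewrite h; ring.
  by field.
by split=> //; split=> //; rewrite /Defs.Delta /Dfun e.
Qed.

(** Common to the two passages along Gamma and to the loop, so that one integral formula serves the
    three pieces of Gamma_infty. *)
Record branch (g L S : R -> C) (a b : R) : Prop := Branch {
  br_L : forall u : R, (a <= u <= b)%R -> continuous L u;
  br_S : forall u : R, (a <= u <= b)%R -> continuous S u;
  br_cubic : forall u, (a <= u <= b)%R -> cubic c (g u) (L u) = 0;
  br_Delta : forall u, (a <= u <= b)%R -> S u * S u = Defs.Delta c (g u) (L u);
  br_S0 : forall u, (a <= u <= b)%R -> S u <> 0 }.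

Lemma branch_good g L S a b u : branch g L S a b -> (a <= u <= b)%R -> good (L u) (S u) /\ surf (L u) (S u).
Proof.
move=> br hu; have [x0 [et ed]] := cubic_facts _ _ (br_cubic _ _ _ _ _ br u hu).
have hs : surf (L u) (S u) by rewrite /surf -ed (br_Delta _ _ _ _ _ br).
split=> //; split=> //; split; first exact: br_S0 br u hu.
by rewrite -hs; apply: Cmult_neq_0; apply: br_S0 br u hu.
Qed.
Lemma branch_opp g L S a b : branch g L S a b -> branch g L (fun u => - S u) a b.
Proof.
move=> br; split.
- exact: br_L br.
- by move=> u hu; apply: continuous_Copp; apply: br_S br u hu.
- exact: br_cubic br.
- by move=> u hu; rewrite -(br_Delta _ _ _ _ _ br u hu); ring.
- move=> u hu h; apply: (br_S0 _ _ _ _ _ br u hu); have e : S u = - - S u by ring.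
  by rewrite e h; ring.
Qed.
Lemma branch_wcont g L S a b u : branch g L S a b -> (a <= u <= b)%R -> continuous (fun y => L y / S y) u.
Proof.
move=> br hu; apply: continuous_Cdiv; [exact: br_L br u hu|exact: br_S br u hu|exact: br_S0 br u hu].
Qed.

Lemma locally_interior (a b u : R) : (a < u < b)%R -> locally u (fun y : R => (a <= y <= b)%R).
Proof.
move=> hu; have h : (0 < Rmin (u - a) (b - u))%R by apply: Rmin_glb_lt; lra.
exists (mkposreal _ h) => y; rewrite /ball /= /AbsRing_ball /abs /minus /plus /opp /= => hy.
have := Rmin_l (u - a) (b - u); have := Rmin_r (u - a) (b - u).
by move: hy => /Rabs_def2 [] *; lra.
Qed.

(** L is only known to be continuous. Its derivative comes from g y - g u = (L y - L u) Q y, where Q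
    is the divided difference of [tfun] and is nonzero near u; that of S then comes from
    [Der_sqrt]. *)
Lemma branch_wder g g' L S a b u : branch g L S a b -> (a < u < b)%R ->
  DerR g u g' -> DerR (fun y => L y / S y) u (- (3 / 2) * pev (pv R) (L u / S u) * g' / (S u * S u)).
Proof.
move=> br hu [p [cp [ep hp]]].
have hu' : (a <= u <= b)%R by lra.
have [[x0 [s0 d0]] hs] := branch_good _ _ _ _ _ _ br hu'.
have hloc := locally_interior _ _ _ hu.
have cL := br_L _ _ _ _ _ br u hu'; have cS := br_S _ _ _ _ _ br u hu'.
pose Q y := - 2 * (L y + L u) + c / (L y * L u).
have cQ : continuous Q u.
  apply: continuous_Cplus.
    by apply: continuous_Cmult; [apply: continuous_const|apply: continuous_Cplus => //; apply: continuous_const].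
  apply: continuous_Cdiv; [apply: continuous_const| |exact: Cmult_neq_0].
  by apply: continuous_Cmult => //; apply: continuous_const.
have eQ : Q u = - (Dfun c (L u) / L u) by rewrite /Q /Dfun /tfun; field.
have Q0 : Q u <> 0.
  rewrite eQ => h; apply: d0.
  have -> : Dfun c (L u) = - (- (Dfun c (L u) / L u)) * L u by field.
  by rewrite h; ring.
have dL : DerR L u (g' / Q u).
  exists (fun y => p y / Q y); split; first exact: continuous_Cdiv.
  split; first by rewrite ep.
  have hQ := locally_neq0 _ _ cQ Q0.
  refine (filter_imp _ _ _ (filter_and _ _ (filter_and _ _ hp hloc) hQ)) => y [[h1 h2] h3].
  have [y0 [ety _]] := cubic_facts _ _ (br_cubic _ _ _ _ _ br y h2).
  have [_ [etu _]] := cubic_facts _ _ (br_cubic _ _ _ _ _ br u hu').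
  have e : g y - g u = (L y - L u) * Q y by rewrite ety etu /tfun /Q; field.
  have -> : p y / Q y * (RtoC y - RtoC u) = (p y * (RtoC y - RtoC u)) / Q y by rewrite /Cdiv; ring.
  by rewrite -h1 e; field.
have dD := Der_comp RtoC _ _ _ _ _ RtoC_cont (Dfun_der _ x0) dL.
have dS : DerR S u (((12 * L u * L u - Dfun c (L u)) / L u * (g' / Q u)) / (2 * S u)).
  apply: (Der_sqrt RtoC S (fun y => Dfun c (L y))) => //.
  move: hloc; apply: filter_imp => y hy.
  by have [_ h] := branch_good _ _ _ _ _ _ br hy.
have hw := Der_mult RtoC RtoC_cont _ _ _ _ _ dL (Der_inv RtoC RtoC_cont _ _ _ dS s0).
apply: Der_eq hw; rewrite eQ pev_pv -hs; field; do !split => //.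
Qed.

Definition prim_W k (w : C) : C := pev (Ppol R k.+1) w / Cpow c k.+1.

(** By [Ppol_deriv] the integrand contains (s / c) (3/2) v^2, which equals dw/dt because c = - s^3
    v. *)
Lemma branch_integral g g' L S a b k : (a <= b)%R -> branch g L S a b -> ~~ odd k ->
  (forall u, (a < u < b)%R -> DerR g u (g' u)) ->
  (forall u : R, (a <= u <= b)%R -> continuous g' u) ->
  @is_RInt C_R_NormedModule (fun u => Wint c k.+2 (L u) (S u) * g' u) a b
    (prim_W k (L b / S b) - prim_W k (L a / S a)).
Proof.
move=> hab br hk dg cg.
apply: (is_RInt_ext (fun u => S u / Cpow c k.+2 * pev (rpol R k.+2) (L u / S u) * g' u)).
  rewrite Rmin_left // Rmax_right // => u hu.
  have hu' : (a <= u <= b)%R by lra.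
  by have [h1 h2] := branch_good _ _ _ _ _ _ br hu'; rewrite Wint_even.
have ccpow n : Cpow c n <> 0 by apply: Cpow_nz.
apply: (FTC_open_C (fun u => prim_W k (L u / S u))) => //.
- move=> u hu; have hu' : (a <= u <= b)%R by lra.
  have [g1 s1] := branch_good _ _ _ _ _ _ br hu'; have [x0 [s0 d0]] := g1.
  have dw := branch_wder _ _ _ _ _ _ _ br hu (dg u hu).
  have dP := Der_comp RtoC _ _ _ _ _ RtoC_cont (pev_der (Ppol R k.+1) (L u / S u)) dw.
  have := Der_mult RtoC RtoC_cont _ _ _ _ _ dP (Der_const RtoC (/ Cpow c k.+1) u).
  apply: Der_eq; rewrite Ppol_deriv (pevM (pa R)) pev_pa.
  have v0 : pev (pv R) (L u / S u) <> 0.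
    by move=> v0; apply: c0; rewrite (surf_c _ _ g1 s1) v0; ring.
  have ec := surf_c _ _ g1 s1.
  have -> : Cpow c k.+2 = c * Cpow c k.+1 by [].
  move: (ccpow k.+1) ec v0; move: (Cpow c k.+1) (pev (pv R) _) => K V K0 -> V0.
  by move: (pev _ _) (pev _ _) => P' P; field; do !split.
- move=> u hu; have cw := branch_wcont _ _ _ _ _ _ br hu.
  apply: continuous_Cmult; last exact: continuous_const.
  exact: (continuous_comp (fun y => L y / S y) (pev (Ppol R k.+1)) u cw (pev_cont _ _)).
- move=> u hu; have cw := branch_wcont _ _ _ _ _ _ br hu.
  apply: continuous_Cmult; last exact: cg.
  apply: continuous_Cmult.
    by apply: continuous_Cmult; [exact: br_S br u hu|exact: continuous_const].
  exact: (continuous_comp (fun y => L y / S y) (pev (rpol R k.+2)) u cw (pev_cont _ _)).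
Qed.
End Surface.

(** * Turning points, the limit at infinity and the coefficients of W *)

Lemma cube_cis (a : R) : (cos a, sin a) * (cos a, sin a) * (cos a, sin a) = (cos (3 * a), sin (3 * a)).
Proof.
have -> : (3 * a = a + (a + a))%R by ring.
rewrite !(cos_plus, sin_plus).
by apply: injective_projections; rewrite /=; ring.
Qed.

Lemma tau1_cube (rho theta : R) : (0 < rho)%R ->
  let t := tau1_of rho theta in let c := cpolar rho theta in
  t * t * t = - (27 / 2) * c * c.
Proof.
move=> hr t c; set a := (2 * theta / 3 + 2 * PI / 3)%R.
set r := Rpower (rho / 4) (2 / 3).
have r3 : (r * r * r = (rho / 4) * (rho / 4))%R.
  rewrite /r -!Rpower_plus; have -> : (2 / 3 + 2 / 3 + 2 / 3 = INR 2)%R by rewrite /=; field.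
  by rewrite Rpower_pow; [rewrite /=; ring|lra].
have -> : t = RtoC (- 6 * r) * (cos a, sin a).
  by rewrite /t /tau1_of -/a -/r; apply: injective_projections; rewrite /=; ring.
transitivity (RtoC (- 216 * (r * r * r)) * ((cos a, sin a) * (cos a, sin a) * (cos a, sin a))).
  rewrite (_ : (-216 * (r * r * r) = (-6 * r) * (-6 * r) * (-6 * r))%R); last by ring.
  by rewrite !(RtoC_mult (_ * _)); ring.
rewrite cube_cis r3.
have -> : (3 * a = 2 * theta + 2 * INR 1 * PI)%R by rewrite /a /=; field.
rewrite cos_period sin_period cos_2a sin_2a -Cmult_assoc.
have -> : c * c = RtoC (rho * rho) * ((cos theta * cos theta - sin theta * sin theta)%R, (2 * sin theta * cos theta)%R).
  by rewrite /c /cpolar; apply: injective_projections; rewrite /=; ring.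
by apply: injective_projections; rewrite /=; field.
Qed.

(** The other two cube roots satisfy t^2 + t tau + tau^2 = 0, hence (t - tau)^2 = - 3 t tau: they
    lie at distance sqrt 3 |tau|. *)
Lemma cube_root_far (t tau : C) : t * t * t = tau * tau * tau ->
  (Cmod (t - tau) < Cmod tau)%R -> t = tau.
Proof.
move=> h hd; apply: NNPP => hne.
have hq : t * t + t * tau + tau * tau = 0.
  have h0 : (t - tau) * (t * t + t * tau + tau * tau) = 0.
    by transitivity (t * t * t - tau * tau * tau); [ring|rewrite h; ring].
  have hn := Cminus_neq0 _ _ hne.
  by apply: NNPP => hq; apply: (Cmult_neq_0 _ _ hn hq).
have e : (Cmod t = Cmod tau)%R.
  have := congr1 Cmod h; rewrite !Cmod_mult => h3.
  have a0 := Cmod_ge_0 t; have b0 := Cmod_ge_0 tau; have d0 := Cmod_ge_0 (t - tau).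
  have : ((Cmod t - Cmod tau) * (Cmod t * Cmod t + Cmod t * Cmod tau + Cmod tau * Cmod tau) = 0)%R.
    by transitivity (Cmod t * Cmod t * Cmod t - Cmod tau * Cmod tau * Cmod tau)%R; [ring|rewrite h3; ring].
  by case/Rmult_integral => hp; [lra|nra].
have hs : (t - tau) * (t - tau) = - 3 * (t * tau).
  by transitivity ((t * t + t * tau + tau * tau) - 3 * (t * tau)); [ring|rewrite hq; ring].
have := congr1 Cmod hs; rewrite !Cmod_mult e.
have -> : Cmod (-3) = 3%R by rewrite Cmod_R Rabs_left; lra.
have := Cmod_ge_0 (t - tau); have := Cmod_ge_0 tau; nra.
Qed.

(** Eliminate x from t = - 6 x^2 and c = 4 x^3. *)
Lemma turning_point_cube c t x : cubic c t x = 0 -> Defs.Delta c t x = 0 ->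
  t * t * t = - (27 / 2) * c * c.
Proof.
rewrite /cubic /Defs.Delta => h1 h2.
have et : t = - (6 * x * x).
  by transitivity ((6 * x * x + t) - 6 * x * x); [ring|rewrite h2; ring].
have ec : c = 4 * x * x * x.
  transitivity ((2 * x * x * x + t * x + c) - 2 * x * x * x - t * x); first by ring.
  by rewrite h1 et; ring.
by rewrite et ec; field.
Qed.

Lemma filterlim_Cdiv {T : Type} (F : (T -> Prop) -> Prop) {FF : Filter F} (f g : T -> C) (l m : C) :
  filterlim f F (locally l) -> filterlim g F (locally m) -> m <> 0 ->
  filterlim (fun u => f u / g u) F (locally (l / m)).
Proof.
move=> hf hg hm.
apply: (filterlim_comp _ _ _ (fun u => (f u, g u)) (fun z : C * C => fst z / snd z) F (locally (l, m))).
  apply/filterlim_locally => eps.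
  have h1 := proj1 (@filterlim_locally _ _ F FF f l) hf eps.
  have h2 := proj1 (@filterlim_locally _ _ F FF g m) hg eps.
  by refine (filter_imp _ _ _ (filter_and _ _ h1 h2)) => y [].
pose D := prod_UniformSpace C_UniformSpace C_UniformSpace.
have hc : @continuous D C_UniformSpace (fun z => fst z / snd z) (l, m).
  apply: (@continuous_Cdiv D (fun z => fst z) (fun z => snd z)) => //.
    exact: (@continuous_fst C_UniformSpace C_UniformSpace).
  exact: (@continuous_snd C_UniformSpace C_UniformSpace).
exact: hc.
Qed.

Lemma even_odd n : Nat.even n = ~~ odd n.
Proof.
have : Nat.even n = ~~ odd n /\ Nat.even n.+1 = ~~ odd n.+1.
  by elim: n => [|n [h1 h2]] //; split=> //; rewrite [LHS]h1 /= !negbK.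
by case.
Qed.
Lemma div2_even k : ~~ odd k -> (2 * Nat.div2 k.+2)%coq_nat = k.+2.
Proof.
move=> hk; rewrite -[in RHS](odd_double_half k) (negbTE hk) add0n -[in LHS](odd_double_half k) (negbTE hk) add0n.
elim: (k./2) => [|m IH] //; rewrite doubleS.
have -> : Nat.div2 m.*2.+4 = (Nat.div2 m.*2.+2).+1 by [].
by lia.
Qed.

Lemma Ppol_half_bernoulli k : ~~ odd k ->
  ((Ppol R k.+1).[2^-1])%ri =
  (- ((/ (2 ^ k.+1) - 1) / (INR k.+2 * INR k.+1)) * bernoulli k.+2)%R.
Proof.
move=> hk.
rewrite (Ppol_half (bern_psif R)) bern_midE -signr_odd (negbTE hk) expr0 mul1r bernoulliE.
rewrite -factE -!INRE.
have -> : INR 2 = 2%R by [].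
rewrite -RpowE -!RinvE -!RmultE -!RoppE.
rewrite [(_ - 1)%ri](_ : _ = 2 * / 2 ^ k.+2 - 1)%R; last by [].
have p0 : (2 ^ k.+1 <> 0)%R by apply: pow_nonzero; lra.
have n1 : (INR k.+1 <> 0)%R by apply: not_0_INR.
have n2 : (INR k.+2 <> 0)%R by apply: not_0_INR.
have -> : INR (Factorial.fact k.+2) = (INR k.+2 * INR k.+1 * INR (Factorial.fact k))%R.
  have fS n : Factorial.fact n.+1 = (n.+1 * Factorial.fact n)%coq_nat by [].
  by rewrite !fS !mult_INR; ring.
have -> : (2 ^ k.+2 = 2 * 2 ^ k.+1)%R by [].
match goal with |- @eq _ ?a ?b => change (@eq R a b) end.
by field.
Qed.

Lemma target_even c k : ~~ odd k -> target c k.+2 =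
  RtoC (- ((/ (2 ^ k.+1) - 1) / (INR k.+2 * INR k.+1)) * bernoulli k.+2)%R / Cpow c k.+1.
Proof.
move=> hk; rewrite /target even_odd [odd _]/= negbK hk (div2_even _ hk).
by have -> : (k.+2 - 1)%coq_nat = k.+1 by lia.
Qed.
Lemma target_odd c k : odd k -> target c k = 0.
Proof. by move=> hk; rewrite /target even_odd hk. Qed.

Lemma prim_W_limit (c : C) k : c <> 0 -> ~~ odd k ->
  / 2 * (prim_W c k (/ 2) - prim_W c k (- / 2)) = target c k.+2.
Proof.
move=> c0 hk.
have ck : Cpow c k.+1 <> 0 by apply: Cpow_nz.
have h2 : / 2 = RtoC (2^-1)%ri by rewrite -RtoC_half.
have h2' : - / 2 = RtoC (- 2^-1)%ri by rewrite h2 -RtoC_opp.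
rewrite /prim_W h2' [in pev _ (/ 2)]h2 !pev_real Ppol_half_odd // target_even //.
rewrite Ppol_half_bernoulli // [RtoC (- _)%ri]RtoC_opp.
by set v := (- (_ / _) * _)%R; field.
Qed.

Lemma prim_W_cont (c : C) k w : continuous (prim_W c k) w.
Proof. by apply: continuous_Cmult; [apply: pev_cont|apply: continuous_const]. Qed.

(* Every truncated coefficient integrates, along any branch, to the increment of one function Phi
   of w = lambda_0 / sqrt Delta; the inbound and outbound contributions at the base point cancel. *)
Lemma Wtrunc_primitive (c : C) i u0 g g' L S h h' Lh Sh U Phi : c <> 0 ->
  branch c g L S u0 U -> branch c h Lh Sh 0 1 -> (u0 <= U)%R ->
  (forall u, DerR g u (g' u)) -> (forall u : R, (u0 <= u)%R -> continuous g' u) ->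
  (forall u, DerR h u (h' u)) -> (forall u : R, (0 <= u <= 1)%R -> continuous h' u) ->
  Lh 0%R = L u0 -> Lh 1%R = L u0 -> Sh 0%R = - S u0 -> Sh 1%R = S u0 ->
  (forall g g' L S a b, (a <= b)%R -> branch c g L S a b ->
     (forall u, (a < u < b)%R -> DerR g u (g' u)) ->
     (forall u : R, (a <= u <= b)%R -> continuous g' u) ->
     @is_RInt C_R_NormedModule (fun u => Wint c i (L u) (S u) * g' u) a b
       (Phi (L b / S b) - Phi (L a / S a))) ->
  Wtrunc c i u0 g g' L S h h' Lh Sh U = / 2 * (Phi (L U / S U) - Phi (- (L U / S U))).
Proof.
move=> c0 b1 b2 hU dg cg dh ch e1 e2 e3 e4 hPhi; rewrite /Wtrunc.
have cg' : forall u : R, (u0 <= u <= U)%R -> continuous g' u by move=> u [hu _]; apply: cg.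
have i1 := hPhi _ _ _ _ _ _ hU b1 (fun u _ => dg u) cg'.
have i2 := hPhi _ _ _ _ _ _ hU (branch_opp _ _ _ _ _ _ b1) (fun u _ => dg u) cg'.
have i3 := hPhi _ _ _ _ _ _ Rle_0_1 b2 (fun u _ => dh u) ch.
rewrite (@is_RInt_unique C_R_CompleteNormedModule _ _ _ _ i1).
rewrite (@is_RInt_unique C_R_CompleteNormedModule _ _ _ _ i2).
rewrite (@is_RInt_unique C_R_CompleteNormedModule _ _ _ _ i3).
rewrite e1 e2 e3 e4.
have hU' : (u0 <= U <= U)%R by lra.
have -> : L U / - S U = - (L U / S U) by field; exact: br_S0 b1 U hU'.
by congr (_ * _); ring.
Qed.

Lemma zero_integral (c : C) i g g' L S a b : (a <= b)%R -> branch c g L S a b ->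
  (forall x s, good c x s -> surf c x s -> Wint c i x s = 0) -> c <> 0 ->
  @is_RInt C_R_NormedModule (fun u => Wint c i (L u) (S u) * g' u) a b (0 - 0).
Proof.
move=> hab br hz c0.
apply: (is_RInt_ext (fun _ => RtoC 0)).
  rewrite Rmin_left // Rmax_right // => u hu; have hu' : (a <= u <= b)%R by lra.
  have [h1 h2] := branch_good c c0 _ _ _ _ _ _ br hu'.
  by rewrite hz // Cmult_0_l.
have := @is_RInt_const C_R_NormedModule a b (RtoC 0).
have -> : @scal R_AbsRing C_R_NormedModule (b - a)%R (RtoC 0) = 0 - 0; last by [].
by apply: injective_projections; rewrite /= /scal /= /mult /=; ring.
Qed.

(** For odd i and for i = 0 integrand and target both vanish and a constant serves; the remaining
    indices use [prim_W]. *)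
Lemma voros_primitive (c : C) i : c <> 0 -> exists Phi : C -> C,
  [/\ forall w, continuous Phi w,
       / 2 * (Phi (/ 2) - Phi (- / 2)) = target c i &
       forall g g' L S a b, (a <= b)%R -> branch c g L S a b ->
       (forall u, (a < u < b)%R -> DerR g u (g' u)) ->
       (forall u : R, (a <= u <= b)%R -> continuous g' u) ->
       @is_RInt C_R_NormedModule (fun u => Wint c i (L u) (S u) * g' u) a b
         (Phi (L b / S b) - Phi (L a / S a))].
Proof.
move=> c0; case hi : (odd i).
  exists (fun=> 0); split; [by move=> w; apply: continuous_const|by rewrite target_odd //; ring|].
  by move=> g g' L S a b hab br _ _; apply: (zero_integral c _ g) => // x s g1 s1; apply: Wint_odd.
case: i hi => [|[|k]] // hi.
  exists (fun=> 0); split; [by move=> w; apply: continuous_const|by rewrite /target /=; ring|].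
  by move=> g g' L S a b hab br _ _; apply: (zero_integral c _ g) => // x s g1 s1; apply: Wint_0.
have hk : ~~ odd k by rewrite /= negbK in hi; rewrite hi.
exists (prim_W c k); split; [exact: prim_W_cont|exact: prim_W_limit|].
by move=> g g' L S a b hab br dg cg; apply: (branch_integral c c0 g).
Qed.

Lemma Wtrunc_limit (rho theta : R) (g g' L S : R -> C) (u0 : R) (h h' Lh Sh : R -> C) (i : nat) :
  (0 < rho)%R ->
  IsGamma (cpolar rho theta) (tau1_of rho theta) g g' L S ->
  IsLoop (cpolar rho theta) (tau1_of rho theta) u0 g L S h h' Lh Sh ->
  filterlim (Wtrunc (cpolar rho theta) i u0 g g' L S h h' Lh Sh)
    (Rbar_locally p_infty) (locally (target (cpolar rho theta) i)).
Proof.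
move=> hrho hG hL.
set c := cpolar rho theta.
have c0 : c <> 0.
  move=> e; have e1 := congr1 fst e; have e2 := congr1 snd e; move: e1 e2; rewrite /c /cpolar /= => e1 e2.
  by have := sin2_cos2 theta; rewrite /Rsqr; nra.
case: hG => [g0 [dg [cg [cLS [heq [S0 [_ [_ [r [[M hr] [limL limS]]]]]]]]]]].
case: hL => [hu0 [hd [dh [ch [h0 [h1 [hloop [L0 [L1 [S0' S1]]]]]]]]]].
have dg' u : DerR g u (g' u) by apply/is_derive_DerR.
have dh' u : DerR h u (h' u) by apply/is_derive_DerR.
have bG U : branch c g L S u0 U.
  split=> u [hu _]; have hu' : (0 <= u)%R by lra.
  - by have [] := cLS u hu'.
  - by have [] := cLS u hu'.
  - by have [] := heq u hu'.
  - by have [] := heq u hu'.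
  - by apply: S0; lra.
have bL : branch c h Lh Sh 0 1.
  split=> u hu; have [hn [hne [cL [cS [e1 e2]]]]] := hloop u hu => //.
  (* A zero of Sh would make h v a turning point, and tau1 is the only one in the disc. *)
  move=> z; apply: hne; apply: cube_root_far hn.
  have hD : Defs.Delta c (h u) (Lh u) = 0 by rewrite -e2 z; ring.
  by rewrite (turning_point_cube _ _ _ e1 hD) tau1_cube.
have [Phi [cPhi tPhi iPhi]] := voros_primitive c i c0.
(* The factor r cancels in the quotient, and (- i / sqrt 2) / (- sqrt 2 i) = 1/2. *)
have limw : filterlim (fun u => L u / S u) (Rbar_locally p_infty) (locally (/ 2)).
  have s2 : (sqrt 2 <> 0)%R by apply: Rgt_not_eq; apply: sqrt_lt_R0; lra.
  have s2C : RtoC (sqrt 2) <> 0 by move=> /RtoC_inj.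
  have ci0 : Ci <> 0 by move=> /(congr1 snd) /=; lra.
  have m0 : - RtoC (sqrt 2) * Ci <> 0.
    by apply: Cmult_neq_0 => // e; apply: s2C; rewrite (_ : RtoC (sqrt 2) = - - RtoC (sqrt 2)); [rewrite e|]; ring.
  have -> : / 2 = (- Ci / RtoC (sqrt 2)) / (- RtoC (sqrt 2) * Ci).
    have -> : RtoC 2 = RtoC (sqrt 2) * RtoC (sqrt 2) by rewrite -RtoC_mult sqrt_sqrt //; lra.
    by field.
  have FF : Filter (Rbar_locally p_infty) by typeclasses eauto.
  have hl := @filterlim_Cdiv R _ FF _ _ _ _ limL limS m0.
  refine (filterlim_ext_loc _ _ _ hl); exists (Rmax M 0) => u hu.
  have hM : (M < u)%R by have := Rmax_l M 0; lra.
  have hu' : (0 < u)%R by have := Rmax_r M 0; lra.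
  have [_ hre] := hr u hM.
  have r0 : r u <> 0 by move=> e; rewrite e /= in hre; lra.
  have := S0 u hu'; move=> s0; field.
  by split.
have limPhi : filterlim (fun u => / 2 * (Phi (L u / S u) - Phi (- (L u / S u)))) (Rbar_locally p_infty) (locally (target c i)).
  rewrite -tPhi.
  suff hc : continuous (fun w => / 2 * (Phi w - Phi (- w))) (/ 2).
    exact: (filterlim_comp _ _ _ (fun u => L u / S u) (fun w => / 2 * (Phi w - Phi (- w))) _ _ _ limw hc).
  apply: (@continuous_Cmult C_UniformSpace (fun _ => / 2)); first exact: continuous_const.
  apply: (@continuous_Cplus C_UniformSpace Phi (fun w => - Phi (- w))); first exact: cPhi.
  apply: continuous_Copp; apply: (continuous_comp (fun w => - w) Phi); last exact: cPhi.
  by apply: continuous_Copp; apply: continuous_id.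
apply: (filterlim_ext_loc _ _ _ limPhi); exists u0 => U hU.
symmetry; apply: Wtrunc_primitive => //.
- by lra.
- by move=> u hu; apply: cg; lra.
Qed.

End Voros.

Theorem mainTheorem1 :
  exists delta : R, (0 < delta)%R /\
  forall rho theta : R, (0 < rho)%R -> (Rabs (theta - PI / 2) < delta)%R ->
  forall (g g' L S : R -> C) (u0 : R) (h h' Lh Sh : R -> C),
    IsGamma (cpolar rho theta) (tau1_of rho theta) g g' L S ->
    IsLoop (cpolar rho theta) (tau1_of rho theta) u0 g L S h h' Lh Sh ->
    forall i : nat,
      filterlim (Wtrunc (cpolar rho theta) i u0 g g' L S h h' Lh Sh)
        (Rbar_locally p_infty) (locally (target (cpolar rho theta) i)).
Proof.
exists 1%R; split; [exact Rlt_0_1|].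
intros rho theta hrho _ g g' L S u0 h h' Lh Sh hG hL i.
exact (Voros.Wtrunc_limit _ _ _ _ _ _ _ _ _ _ _ i hrho hG hL).
Qed.
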